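(* Let $\gamma\in\{1,6\}$ and let $N\in\{1,2,3,5,7,8,12,13\}$. Then the global minimizer of $\mathrm{wce}(H^{1,\gamma}_{\mathrm{mix}}(\mathbb{T}^2),\mathcal{P}_N)$ among all $N$-point sets $\mathcal{P}_N=\{p_1,\dots,p_N\}\subset[0,1)^2$ (points counted with multiplicity) is unique up to torus symmetries, and it is, up to torus symmetries, an integration lattice.
   Context: $\mathbb{T}=[0,1)$ is the one-dimensional torus. For $\gamma>0$, $H^{1,\gamma}(\mathbb{T})$ is the Hilbert space of 1-periodic functions with first weak derivative in $L_2(\mathbb T)$, with inner product $(f,g)=\int_0^1 f\,dx\int_0^1 g\,dx+\gamma\int_0^1 f'g'\,dx$. Its reproducing kernel is $K_{1,\gamma}(x,y)=1+\gamma k(|x-y|)$, where $k(t)=\frac12(t^2-t+\frac16)$. The space $H^{1,\gamma}_{\mathrm{mix}}(\mathbb{T}^2)=H^{1,\gamma}(\mathbb{T})\otimes H^{1,\gamma}(\mathbb{T})$ is the Hilbert space tensor product, with reproducing kernel $K_{2,\gamma}((x_1,x_2),(y_1,y_2))=K_{1,\gamma}(x_1,y_1)K_{1,\gamma}(x_2,y_2)$. For $\mathcal{P}_N=\{p_1,\dots,p_N\}\subset[0,1)^2$, the worst case error is $$\mathrm{wce}(H^{1,\gamma}_{\mathrm{mix}}(\mathbb{T}^2),\mathcal{P}_N)=\sup_{\|f\|\le 1}\Big|\int_{[0,1)^2}f(x)\,dx-\frac1N\sum_{i=1}^N f(p_i)\Big|,$$ the supremum being over $f\in H^{1,\gamma}_{\mathrm{mix}}(\mathbb{T}^2)$.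 It satisfies $\mathrm{wce}^2=-1+\frac1{N^2}\sum_{i,j=1}^N K_{2,\gamma}(p_i,p_j)$. An integration lattice with $N\ge2$ points is a set $\{(\frac iN,\frac{ig}{N}\bmod 1): i=0,\dots,N-1\}$ for some $g\in\{1,\dots,N-1\}$ coprime to $N$; for $N=1$ it is the single point $(0,0)$. Torus symmetries are finite compositions of the following maps, applied simultaneously to all points of a point set: shifts $x\mapsto x+c \bmod 1$ of the first coordinate and shifts $y\mapsto y+c\bmod 1$ of the second coordinate ($c\in\mathbb{R}$), reflections $x\mapsto 1-x \bmod 1$ and $y\mapsto 1-y\bmod 1$ of either coordinate, and the interchange $(x,y)\mapsto(y,x)$. The points are unlabelled. ''Unique up to torus symmetries'' means that any two global minimizers are mapped to each other by a torus symmetry.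
   Formalization: The inner product is taken with weight 1/γ on the derivative term instead of γ, since weight γ would give the kernel 1+k/γ, contradicting the stated kernel 1+γk and the stated formula for wce² when γ=6; for γ=1 nothing changes. *)

(* Defs.v *)
From HB Require Import structures.
From mathcomp Require Import all_boot all_order all_algebra perm.
From mathcomp Require Import all_classical all_reals all_analysis.

Set Implicit Arguments.
Unset Strict Implicit.
Unset Printing Implicit Defensive.

Import Order.TTheory GRing.Theory Num.Theory.
Import numFieldNormedType.Exports.

Local Open Scope classical_set_scope.
Local Open Scope ring_scope.

Definition T01 (R : realType) : set R := `[0, 1[.
Arguments T01 R : clear implicits.

Section Univariate.
Variable R : realType.
Implicit Types (f g u v phi : R -> R) (gamma : R).

Definition periodic1 f := forall x, f (x + 1) = f x.

Definition int01 f : R :=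
  (\int[@lebesgue_measure R]_(x in T01 R) f x)%R.

Definition L2_01 g :=
  measurable_fun (T01 R) g /\
  (@lebesgue_measure R).-integrable (T01 R) (fun x => (g x ^+ 2)%:E).

Definition test_function phi :=
  [/\ periodic1 phi, forall x, derivable phi x 1 & continuous (derive1 phi)].

(* On the torus there is no boundary, so the test functions are periodic and
   need not vanish anywhere. *)
Definition is_weak_derivative f g :=
  L2_01 g /\
  forall phi, test_function phi ->
    int01 (fun x => f x * derive1 phi x) = - int01 (fun x => g x * phi x).

(* An equivalence class modulo null sets having a weak derivative in L2 is
   represented by its unique continuous member, so that the point values used
   by a quadrature rule make sense. *)
Definition H1 f :=
  [/\ periodic1 f, continuous f & exists g, is_weak_derivative f g].

(* A weak derivative is only determined almost everywhere; the inner product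
   below does not depend on the one that is chosen. *)
Definition weak_derivative f : R -> R :=
  xget (fun=> 0) [set g | is_weak_derivative f g].

(* The weight of the derivative term is gamma^-1: it is for this inner product
   that the reproducing kernel is 1 + gamma * k(|x - y|) with
   k(t) = (t^2 - t + 1/6) / 2, i.e. k = B_2 / 2 with B_2 the second Bernoulli
   polynomial. *)
Definition H1_dot gamma u v : R :=
  int01 u * int01 v +
  gamma^-1 * int01 (fun x => weak_derivative u x * weak_derivative v x).

End Univariate.

Section TensorProduct.
Variable R : realType.
Implicit Types (gamma : R) (f : R * R -> R).

(* The list [:: (u1, v1); ...; (um, vm)] stands for the element
   u1 (x) v1 + ... + um (x) vm of the algebraic tensor product. *)
Definition tensor := seq ((R -> R) * (R -> R)).

Implicit Types (s t : tensor).

Definition tensor_H1 s := forall p, p \in s -> H1 p.1 /\ H1 p.2.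

Definition tensor_fun s (x : R * R) : R := \sum_(p <- s) p.1 x.1 * p.2 x.2.

Definition tensor_sub s t : tensor :=
  s ++ [seq ((fun x => - p.1 x), p.2) | p <- t].

Definition tensor_dot gamma s t : R :=
  \sum_(p <- s) \sum_(q <- t) H1_dot gamma p.1 q.1 * H1_dot gamma p.2 q.2.

Definition tensor_norm gamma s : R := Num.sqrt (tensor_dot gamma s s).

Definition tensor_cauchy gamma (s_ : nat -> tensor) :=
  forall e : R, 0 < e -> exists M : nat, forall m n : nat,
    (M <= m)%N -> (M <= n)%N ->
    tensor_norm gamma (tensor_sub (s_ m) (s_ n)) < e.

(* f belongs to H^{1,gamma}_mix(T^2), the completion of the algebraic tensor
   product, and has norm r.  Elements of the completion are classes of Cauchy
   sequences of finite tensors; point evaluations being continuous, such a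
   class is identified with the function that is its pointwise limit. *)
Definition Hmix_norm gamma f (r : R) :=
  exists s_ : nat -> tensor,
    [/\ forall n, tensor_H1 (s_ n),
        tensor_cauchy gamma s_,
        forall x, tensor_fun (s_ n) x @[n --> \oo] --> f x
      & tensor_norm gamma (s_ n) @[n --> \oo] --> r].

End TensorProduct.

Section PointSets.
Variable R : realType.

(* A point set is a family indexed by 'I_N; labels are discarded by
   [same_points], multiplicities are not. *)
Definition in_torus2 N (P : 'I_N -> R * R) :=
  forall i, (0 <= (P i).1 < 1) && (0 <= (P i).2 < 1).

Definition same_points N (P Q : 'I_N -> R * R) :=
  exists pi : {perm 'I_N}, forall i, Q i = P (pi i).

Definition int_torus2 (f : R * R -> R) : R :=
  (\int[(@lebesgue_measure R \x @lebesgue_measure R)%E]_(x in T01 R `*` T01 R)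
     f x)%R.

Definition qmc N (P : 'I_N -> R * R) (f : R * R -> R) : R :=
  N%:R^-1 * \sum_(i < N) f (P i).

Definition wce (gamma : R) N (P : 'I_N -> R * R) : \bar R :=
  ereal_sup [set (`|int_torus2 f - qmc P f|)%:E
            | f in [set f | exists2 r, Hmix_norm gamma f r & r <= 1]].

Definition global_minimizer (gamma : R) N (P : 'I_N -> R * R) :=
  in_torus2 P /\
  forall Q : 'I_N -> R * R, in_torus2 Q -> (wce gamma P <= wce gamma Q)%E.

Definition mod1 (x : R) : R := x - (Num.floor x)%:~R.

Inductive torus_symmetry : (R * R -> R * R) -> Prop :=
| TSid : torus_symmetry id
| TSshift1 c s : torus_symmetry s ->
    torus_symmetry (fun p => (mod1 ((s p).1 + c), (s p).2))
| TSshift2 c s : torus_symmetry s ->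
    torus_symmetry (fun p => ((s p).1, mod1 ((s p).2 + c)))
| TSreflect1 s : torus_symmetry s ->
    torus_symmetry (fun p => (mod1 (1 - (s p).1), (s p).2))
| TSreflect2 s : torus_symmetry s ->
    torus_symmetry (fun p => ((s p).1, mod1 (1 - (s p).2)))
| TSswap s : torus_symmetry s ->
    torus_symmetry (fun p => ((s p).2, (s p).1)).

Definition torus_equivalent N (P Q : 'I_N -> R * R) :=
  exists2 s, torus_symmetry s & same_points (s \o P) Q.

Definition lattice_point (N g i : nat) : R * R :=
  (i%:R / N%:R, mod1 ((i * g)%N%:R / N%:R)).

Definition integration_lattice N (P : 'I_N -> R * R) :=
  (N = 1%N /\ forall i, P i = (0, 0)) \/
  ((2 <= N)%N /\
   exists g : nat, [/\ (1 <= g <= N.-1)%N, coprime g N &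
     same_points (fun i : 'I_N => lattice_point N g i) P]).

End PointSets.

(* Main.v *)
(* On [0, 1) the kernel 1 + gamma * k(|x - y|) equals c0 + c1 * (2 |x - y| - 1)^2
   with c0 = 1 - gamma / 24 and c1 = gamma / 8, so that
   wce^2 = N^-2 * energy - 1, where the energy is a sum over pairs of points of
   products of two such factors.  That wce is given by this formula follows from
   the reproducing property, obtained by testing weak derivatives against second
   differences of the periodized third Bernoulli polynomial, and from the
   Cauchy-Schwarz inequality in the algebraic tensor product.

   Translate one point to the origin and sort the points by each coordinate: the
   i-th point is ((i + u_i) / N, (rho(i) + v_i) / N) for a permutation rho fixing
   0.  Up to sign, N (2 |x_i - x_j| - 1) is then an integer, depending only on
   j - i mod N, plus 2 (u_j - u_i), and likewise for the second coordinate.  The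
   part of the energy of degree two is minimal exactly when u and v are constant.
   There remains the form Psi, which is treated for one permutation at a time:
   - the tangent inequality at a rational reference configuration turns strict
     convexity and a small gradient into a lower bound for Psi; for the lattice
     permutations i -> g i the grid is critical and this identifies the minimum,
     for the others it gives a strict inequality;
   - for N = 8, 12, 13 there are too many permutations; a dual certificate bounds
     Psi below by a sum over pairs of nonnegative weights, and a depth-first
     search over prefixes of rho discards all but a few permutations.
   All these verifications are exact integer computations. *)

From Stdlib Require Import ZArith.
From HB Require Import structures.
Require Import Defs.
From mathcomp Require Import all_boot all_order all_algebra perm.
From mathcomp Require Import all_classical all_reals all_analysis.
From mathcomp Require Import measurable_realfun ring lra zify ssrZ.

Set Implicit Arguments.
Unset Strict Implicit.
Unset Printing Implicit Defensive.

Import Order.TTheory GRing.Theory Num.Theory.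
Import numFieldNormedType.Exports.

Local Open Scope ring_scope.
Delimit Scope Z_scope with ZZ.

(** * Lower bounds for the energy of a point configuration *)

(** At [gamma = 6] one has [c0 = c1] and the energy is an affine function of [Psi]; for [gamma <= 6]
    the surplus [c1 (c0 - c1)] multiplies the degree-two part and is nonnegative. So no computation
    depends on [gamma], and both values share the same certificates.

    The weight [N^2] in [Psi] also governs convexity: the pair term [n^2 (s^2 + t^2) + s^2 t^2] lies
    above its tangent plane at [(s, t)] as soon as [|s t| <= n^2]. On the grid distinct points have
    [|s|, |t| <= N - 2], which leaves a margin; a diagonal pair has [|s t| = N^2], but is constant.
    The tangent bound is global, so displacements range over all real vectors, and sorting serves
    only to express distances through gaps.

    A dual certificate works because the gaps from a fixed point to all points exhaust Z/N:
    functions of one gap are multipliers that cannot see the permutation.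

    On the analytic side the sawtooth [b1], whose derivative contains a point mass, is no test
    function and must be smoothed; and [weak_derivative] is a choice, so uniqueness almost
    everywhere precedes any inner product with a kernel. *)

Definition perm_fun (N : nat) (h : nat -> nat) :=
  perm_eq [seq h i | i <- iota 0 N] (iota 0 N).

Lemma perm_fun_inj N h : {in [pred i | (i < N)%N] &, injective h} ->
  (forall i, (i < N)%N -> (h i < N)%N) -> perm_fun N h.
Proof.
move=> hi hN; rewrite /perm_fun.
have u : uniq [seq h i | i <- iota 0 N].
  rewrite map_inj_in_uniq ?iota_uniq// => i j.
  by rewrite !mem_iota !add0n => iN jN; apply: hi.
apply: uniq_perm => //; first exact: iota_uniq.
have [] // := uniq_min_size u (s2 := iota 0 N).
  by move=> x /mapP[i]; rewrite mem_iota => iN ->; rewrite mem_iota /= add0n hN.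
by rewrite size_map.
Qed.

Lemma perm_funP N h : perm_fun N h ->
  {in [pred i | (i < N)%N] &, injective h} /\
  (forall i, (i < N)%N -> (h i < N)%N).
Proof.
move=> hp; split.
  move=> i j iN jN hij.
  have u : uniq [seq h i | i <- iota 0 N] by rewrite (perm_uniq hp) iota_uniq.
  apply/eqP; rewrite -(nth_uniq 0%N _ _ u) ?size_map ?size_iota//.
  by rewrite !(nth_map 0%N) ?size_iota// !nth_iota// hij.
move=> i iN.
have : h i \in [seq h i | i <- iota 0 N] by apply: map_f; rewrite mem_iota.
by rewrite (perm_mem hp) mem_iota.
Qed.

Lemma big_perm_fun (V : nmodType) N h (f : nat -> V) : perm_fun N h ->
  \sum_(j < N) f (h j) = \sum_(k < N) f k.
Proof.
move=> hp; rewrite -(big_mkord xpredT (fun j => f (h j))) -(big_mkord xpredT f).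
rewrite /index_iota subn0 -[RHS](perm_big _ hp) /=.
by rewrite big_map.
Qed.

(** The residue of [j - i]; adding [N] first keeps the truncated subtraction exact. *)
Definition gap (N i j : nat) : nat := (j + N - i) %% N.

Lemma gap_lt N i j : (0 < N)%N -> (gap N i j < N)%N.
Proof. exact: ltn_pmod. Qed.

Lemma gapxx N i : gap N i i = 0%N.
Proof. by rewrite /gap addKn modnn. Qed.

Lemma gapE N i j : (i < N)%N -> (j < N)%N ->
  gap N i j = if (i <= j)%N then (j - i)%N else (j + N - i)%N.
Proof.
move=> iN jN; rewrite /gap; case: leqP => ij.
  by rewrite -addnBAC// modnDr modn_small//; lia.
by rewrite modn_small//; lia.
Qed.

Lemma perm_fun_gapr N i : (i < N)%N -> perm_fun N (gap N i).
Proof.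
move=> iN; apply: perm_fun_inj => [j k|j jN]; last by apply: gap_lt; lia.
by rewrite !inE => jN kN /=; rewrite !gapE//; case: leqP => ?; case: leqP => ?; lia.
Qed.

Lemma perm_fun_gapl N j : (j < N)%N -> perm_fun N (gap N ^~ j).
Proof.
move=> jN; apply: perm_fun_inj => [i k|i iN]; last by apply: gap_lt; lia.
by rewrite !inE => iN kN /=; rewrite !gapE//; case: leqP => ?; case: leqP => ?; lia.
Qed.

Lemma perm_fun_comp N g h : perm_fun N g -> perm_fun N h -> perm_fun N (g \o h).
Proof.
move=> /perm_funP[gi gN] /perm_funP[hi hN]; apply: perm_fun_inj.
  move=> i j iN jN /= e; apply: hi => //; apply: gi => //; exact: hN.
by move=> i iN /=; apply/gN/hN.
Qed.

(** For fixed [i] the residues [rho j - rho i] run through all of Z/N, so the sum does not depend on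
    the permutation. *)
Lemma sum_gapr (V : nmodType) N rho (f : nat -> V) i :
  perm_fun N rho -> (i < N)%N ->
  \sum_(j < N) f (gap N (rho i) (rho j)) = \sum_(k < N) f k.
Proof.
move=> hp iN; apply: (@big_perm_fun _ _ (gap N (rho i) \o rho)).
by apply: perm_fun_comp => //; apply: perm_fun_gapr; apply: (perm_funP hp).2.
Qed.

Lemma sum_gapl (V : nmodType) N rho (f : nat -> V) j :
  perm_fun N rho -> (j < N)%N ->
  \sum_(i < N) f (gap N (rho i) (rho j)) = \sum_(k < N) f k.
Proof.
move=> hp jN; apply: (@big_perm_fun _ _ (gap N ^~ (rho j) \o rho)).
by apply: perm_fun_comp => //; apply: perm_fun_gapl; apply: (perm_funP hp).2.
Qed.

Section Embedding.
Variable R : realFieldType.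

(** The checks run in the binary integers [Z], on which [vm_compute] is fast; this ring morphism
    carries their outcome to the reals. *)
Definition zr (z : Z) : R := (int_of_Z z)%:~R.

Lemma zrD x y : zr (Z.add x y) = zr x + zr y.
Proof. by rewrite /zr -[Z.add x y]/(x + y) !rmorphD. Qed.
Lemma zrN x : zr (Z.opp x) = - zr x.
Proof. by rewrite /zr -[Z.opp x]/(- x) !rmorphN. Qed.
Lemma zrB x y : zr (Z.sub x y) = zr x - zr y.
Proof. by rewrite /Z.sub zrD zrN. Qed.
Lemma zrM x y : zr (Z.mul x y) = zr x * zr y.
Proof. by rewrite /zr -[Z.mul x y]/(x * y) !rmorphM. Qed.
Lemma zr_nat n : zr (Z.of_nat n) = n%:R.
Proof.
rewrite /zr; have -> : Z.of_nat n = n%:R :> Z.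
  by elim: n => // n IH; rewrite Nat2Z.inj_succ -Z.add_1_l IH mulrS.
by rewrite !rmorph_nat.
Qed.
Lemma zr0 : zr 0%ZZ = 0. Proof. by []. Qed.
Lemma zr1 : zr 1%ZZ = 1. Proof. by []. Qed.
Lemma zr2 : zr 2%ZZ = 2. Proof. by rewrite -[2%ZZ]/(Z.of_nat 2) zr_nat. Qed.
Lemma zr4 : zr 4%ZZ = 4. Proof. by rewrite -[4%ZZ]/(Z.of_nat 4) zr_nat. Qed.
Lemma zr8 : zr 8%ZZ = 8. Proof. by rewrite -[8%ZZ]/(Z.of_nat 8) zr_nat. Qed.

Lemma int_of_Z_le x y : (int_of_Z x <= int_of_Z y) = Z.leb x y.
Proof. by apply/idP/idP; lia. Qed.
Lemma int_of_Z_lt x y : (int_of_Z x < int_of_Z y) = Z.ltb x y.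
Proof. by apply/idP/idP; lia. Qed.
Lemma zr_le x y : (zr x <= zr y) = Z.leb x y.
Proof. by rewrite /zr ler_int int_of_Z_le. Qed.
Lemma zr_lt x y : (zr x < zr y) = Z.ltb x y.
Proof. by rewrite /zr ltr_int int_of_Z_lt. Qed.
Definition zrE := (zrD, zrB, zrN, zrM, zr0, zr1, zr2, zr4, zr8).

End Embedding.
Arguments zr {R}.

(** * Tangent inequalities for the energy *)

Section Energy.
Variable R : realFieldType.
Implicit Types (N : nat) (S T : nat -> nat -> R).

Definition Psi (n : R) N S T : R :=
  \sum_(i < N) \sum_(j < N)
    (n ^+ 2 * (S i j ^+ 2 + T i j ^+ 2) + S i j ^+ 2 * T i j ^+ 2).

(** With [X = s + 2 a] and [Y = t + 2 b], the right side minus the left is [(X Y - s t)^2 + 4 (n^2 -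
    c) (a^2 + b^2) + 8 s t a b], and the last term is at least [- 4 |s t| (a^2 + b^2)]. The
    condition concerns only the reference point [(s, t)], while [a] and [b] are arbitrary. *)
Lemma pair_tangent (n c s t a b : R) : `|s * t| <= n ^+ 2 - c ->
  n ^+ 2 * (s ^+ 2 + t ^+ 2) + s ^+ 2 * t ^+ 2
    + 4 * (a * (s * (n ^+ 2 + t ^+ 2)) + b * (t * (n ^+ 2 + s ^+ 2)))
    + 4 * c * (a ^+ 2 + b ^+ 2) <=
  n ^+ 2 * ((s + 2 * a) ^+ 2 + (t + 2 * b) ^+ 2)
    + (s + 2 * a) ^+ 2 * (t + 2 * b) ^+ 2.
Proof.
move=> h; rewrite -subr_ge0.
set d := (X in 0 <= X).
have -> : d = ((s + 2 * a) * (t + 2 * b) - s * t) ^+ 2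
    + 4 * (n ^+ 2 - c - `|s * t|) * (a ^+ 2 + b ^+ 2)
    + 4 * (`|s * t| * (a ^+ 2 + b ^+ 2) + 2 * (s * t) * (a * b)).
  by rewrite /d; ring.
have ab0 : 0 <= a ^+ 2 + b ^+ 2 by rewrite addr_ge0 ?sqr_ge0.
apply: addr_ge0; first by rewrite addr_ge0 ?sqr_ge0// !mulr_ge0 ?subr_ge0.
apply: mulr_ge0 => //; have [st0|st0] := ger0P (s * t).
  have -> : s * t * (a ^+ 2 + b ^+ 2) + 2 * (s * t) * (a * b)
    = s * t * (a + b) ^+ 2 by ring.
  by rewrite mulr_ge0 ?sqr_ge0.
have -> : - (s * t) * (a ^+ 2 + b ^+ 2) + 2 * (s * t) * (a * b)
  = - (s * t) * (a - b) ^+ 2 by ring.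
by rewrite mulr_ge0 ?sqr_ge0// oppr_ge0 ltW.
Qed.

Lemma sum_diff_sq N (x : nat -> R) :
  \sum_(i < N) \sum_(j < N) (x j - x i) ^+ 2 =
  2 * N%:R * (\sum_(i < N) x i ^+ 2) - 2 * (\sum_(i < N) x i) ^+ 2.
Proof.
have -> : \sum_(i < N) \sum_(j < N) (x j - x i) ^+ 2 =
    \sum_(i < N) (\sum_(j < N) x j ^+ 2 - 2 * x i * (\sum_(j < N) x j)
      + N%:R * x i ^+ 2).
  apply: eq_bigr => i _.
  have -> : N%:R * x i ^+ 2 = \sum_(j < N) x i ^+ 2.
    by rewrite sumr_const card_ord mulr_natl.
  rewrite mulr_sumr -sumrB -big_split /=.
  by apply: eq_bigr => j _; ring.
rewrite big_split sumrB /= sumr_const card_ord -!mulr_sumr -mulr_suml -mulr_sumr.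
by rewrite -mulr_natl; ring.
Qed.

(** For centred [x] the double sum is [2 N |x|^2], and [8 <x, G> + 8 N c |x|^2] has minimum
    [- 2 |G|^2 / (N c)]. The statement is this minimum with the denominator cleared; the proof
    completes the square. *)
Lemma gradient_bound N (x G : nat -> R) (c : R) : \sum_(j < N) G j = 0 ->
  0 <= N%:R * c * (8 * (\sum_(j < N) x j * G j)
      + 4 * c * (\sum_(i < N) \sum_(j < N) (x j - x i) ^+ 2))
    + 2 * (\sum_(j < N) G j ^+ 2).
Proof.
move=> G0; rewrite sum_diff_sq; set X := \sum_(i < N) x i.
suff -> : N%:R * c * (8 * (\sum_(j < N) x j * G j)
      + 4 * c * (2 * N%:R * (\sum_(i < N) x i ^+ 2) - 2 * X ^+ 2))
    + 2 * (\sum_(j < N) G j ^+ 2) =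
    \sum_(j < N) 2 * (2 * N%:R * c * x j - 2 * c * X + G j) ^+ 2.
  by apply: sumr_ge0 => j _; rewrite mulr_ge0 ?sqr_ge0.
have -> : \sum_(j < N) 2 * (2 * N%:R * c * x j - 2 * c * X + G j) ^+ 2 =
  \sum_(j < N) (8 * N%:R ^+ 2 * c ^+ 2 * x j ^+ 2 + 2 * G j ^+ 2
   + 8 * N%:R * c * (x j * G j) - 16 * N%:R * c ^+ 2 * X * x j - 8 * c * X * G j
   + 8 * c ^+ 2 * X ^+ 2).
  by apply: eq_bigr => j _; ring.
rewrite !(big_split, sumrB) /= sumr_const card_ord !sumrN -!mulr_sumr G0 -/X.
by rewrite -mulr_natl; ring.
Qed.

(** Exchange [i] and [j] in half of the sum. The diagonal is left out on the right because gap 0 has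
    offset [- N], which is not its own opposite; on the left the factor [x j - x i] removes it. *)
Lemma sum_antisym N (x : nat -> R) (g : nat -> nat -> R) :
  (forall i j, (i < N)%N -> (j < N)%N -> i != j -> g i j = - g j i) ->
  \sum_(i < N) \sum_(j < N) (x j - x i) * g i j =
  2 * \sum_(j < N) x j * \sum_(i < N | i != j) g i j.
Proof.
move=> ga.
have e : \sum_(i < N) \sum_(j < N) (x j - x i) * g i j =
    \sum_(i < N) \sum_(j < N | i != j) (x j - x i) * g i j.
  apply: eq_bigr => i _; rewrite [LHS](bigD1 i)//= subrr mul0r add0r.
  by apply: eq_bigl => j; rewrite eq_sym.
rewrite e.
have -> : \sum_(i < N) \sum_(j < N | i != j) (x j - x i) * g i j =
    \sum_(i < N) \sum_(j < N | i != j) x j * g i j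
    + \sum_(i < N) \sum_(j < N | i != j) x i * g j i.
  rewrite -big_split /=; apply: eq_bigr => i _; rewrite -big_split /=.
  by apply: eq_bigr => j ij; rewrite (ga i j)//; ring.
rewrite mulr_sumr (exchange_big_dep predT)//= -big_split /=; apply: eq_bigr => j _.
rewrite -!mulr_sumr; have -> : \sum_(j0 < N | j != j0) g j0 j = \sum_(i < N | i != j) g i j.
  by apply: eq_bigl => i; rewrite eq_sym.
by ring.
Qed.

(* The reference displacements are integers in practice; [c] is a lower bound
   for the convexity modulus at the reference configuration. *)
Lemma Psi_lower_bound N (n c : R) (S T S0 T0 : nat -> nat -> R) (x y : nat -> R) :
  (forall i j, (i < N)%N -> (j < N)%N -> S i j = S0 i j + 2 * (x j - x i)) ->
  (forall i j, (i < N)%N -> (j < N)%N -> T i j = T0 i j + 2 * (y j - y i)) ->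
  (forall i j, (i < N)%N -> (j < N)%N -> i != j -> S0 i j = - S0 j i) ->
  (forall i j, (i < N)%N -> (j < N)%N -> i != j -> T0 i j = - T0 j i) ->
  (forall i j, (i < N)%N -> (j < N)%N -> i != j ->
     `|S0 i j * T0 i j| <= n ^+ 2 - c) ->
  Psi n N S0 T0
    + 8 * (\sum_(j < N) x j *
         \sum_(i < N | i != j) S0 i j * (n ^+ 2 + T0 i j ^+ 2))
    + 8 * (\sum_(j < N) y j *
         \sum_(i < N | i != j) T0 i j * (n ^+ 2 + S0 i j ^+ 2))
    + 4 * c * (\sum_(i < N) \sum_(j < N) (x j - x i) ^+ 2)
    + 4 * c * (\sum_(i < N) \sum_(j < N) (y j - y i) ^+ 2) <= Psi n N S T.
Proof.
move=> hS hT aS aT hc.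
have gx := @sum_antisym N x (fun i j => S0 i j * (n ^+ 2 + T0 i j ^+ 2)).
have gy := @sum_antisym N y (fun i j => T0 i j * (n ^+ 2 + S0 i j ^+ 2)).
set u := \sum_(j < N) x j * _; set v := \sum_(j < N) y j * _.
have -> : 8 * u = 4 * (2 * u) by ring.
have -> : 8 * v = 4 * (2 * v) by ring.
rewrite -gx; last by move=> i j iN jN ij; rewrite (aS i j)// (aT i j)// sqrrN; ring.
rewrite -gy; last by move=> i j iN jN ij; rewrite (aS i j)// (aT i j)// sqrrN; ring.
rewrite /Psi !mulr_sumr -!big_split /=; apply: ler_sum => i _.
rewrite !mulr_sumr -!big_split /=; apply: ler_sum => j _.
rewrite (hS i j)// (hT i j)//.
(* A diagonal pair does not move, so both sides coincide there. *)
have [->|ij] := eqVneq (i : nat) j.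
  by rewrite !subrr !mul0r expr0n /= !mulr0 !addr0.
have := @pair_tangent n c (S0 i j) (T0 i j) (x j - x i) (y j - y i) (hc i j _ _ ij).
by move=> /(_ (ltn_ord _) (ltn_ord _)); apply: le_trans; rewrite le_eqVlt; apply/orP; left; apply/eqP; ring.
Qed.

End Energy.

(** * Dual certificates on (Z/N)^2 *)

Section Certificate.
Variable R : realFieldType.

(** The value of [N (2 t - 1)] at [t = k / N]. *)
Definition offset N k : Z := Z.sub (Z.of_nat k.*2) (Z.of_nat N).

(** For coordinates [(rho i + x i) / N] in the order given by [rho], this is [N (2 d - 1)] up to
    sign, [d] being the distance of the coordinates of [i] and [j]. *)
Definition spread N (rho : nat -> nat) (x : nat -> R) (i j : nat) : R :=
  zr (offset N (gap N (rho i) (rho j))) + 2 * (x j - x i).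

Definition correlation N (u w : nat -> nat -> R) (k l : nat) : R :=
  \sum_(c < N) \sum_(d < N) u ((c + k) %% N)%N ((d + l) %% N)%N * w c d.

Lemma gap_gap N i j c : (i < N)%N -> (j < N)%N -> (c < N)%N ->
  ((gap N j c + gap N i j) %% N = gap N i c)%N.
Proof.
move=> iN jN cN; rewrite /gap modnDm.
have -> : (c + N - j + (j + N - i) = (c + N - i) + N)%N by lia.
by rewrite modnDr.
Qed.

Lemma correlation_reindex N rho (u w : nat -> nat -> R) i j :
  perm_fun N rho -> (i < N)%N -> (j < N)%N ->
  correlation N u w (gap N i j) (gap N (rho i) (rho j)) =
  \sum_(c < N) \sum_(d < N)
     u (gap N i c) (gap N (rho i) d) * w (gap N j c) (gap N (rho j) d).
Proof.
move=> /perm_funP[_ hr] iN jN; rewrite /correlation.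
rewrite -(@big_perm_fun _ _ (gap N j) (fun c => \sum_(d < N)
  u ((c + gap N i j) %% N)%N ((d + gap N (rho i) (rho j)) %% N)%N * w c d)); last first.
  exact: perm_fun_gapr.
apply: eq_bigr => c _.
rewrite -(@big_perm_fun _ _ (gap N (rho j)) (fun d =>
  u ((gap N j c + gap N i j) %% N)%N ((d + gap N (rho i) (rho j)) %% N)%N * w (gap N j c) d)); last first.
  exact/perm_fun_gapr/hr.
by apply: eq_bigr => d _; rewrite !gap_gap// hr.
Qed.

(** The index [a < 3] refers to the components of [vec3 x y], namely 1, [x], [y]. The
    autocorrelation is thus matrix valued, and the resulting form mixes constants with
    displacements. *)
Definition quad_corr N (u : nat -> nat -> nat -> R) (k l : nat) (v v' : nat -> R) :=
  \sum_(a < 3) \sum_(b < 3) correlation N (u a) (u b) k l * (v a * v' b).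

(* An autocorrelation is a positive definite kernel on (Z/N)^2, restricted here
   to the graph of [rho]. *)
Lemma quad_corr_ge0 N rho (u : nat -> nat -> nat -> R) (v : nat -> nat -> R) :
  perm_fun N rho ->
  0 <= \sum_(i < N) \sum_(j < N)
         quad_corr N u (gap N i j) (gap N (rho i) (rho j)) (v i) (v j).
Proof.
move=> hr.
suff -> : \sum_(i < N) \sum_(j < N)
         quad_corr N u (gap N i j) (gap N (rho i) (rho j)) (v i) (v j) =
  \sum_(c < N) \sum_(d < N)
   (\sum_(i < N) \sum_(a < 3) u a (gap N i c) (gap N (rho i) d) * v i a) ^+ 2.
  by do 2!apply: sumr_ge0 => ? _; apply: sqr_ge0.
transitivity (\sum_(i < N) \sum_(j < N) \sum_(c < N) \sum_(d < N)
  (\sum_(a < 3) u a (gap N i c) (gap N (rho i) d) * v i a) *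
  (\sum_(b < 3) u b (gap N j c) (gap N (rho j) d) * v j b)).
  apply: eq_bigr => i _; apply: eq_bigr => j _; rewrite /quad_corr.
  under eq_bigr => a _ do under eq_bigr => b _ do
    rewrite correlation_reindex// mulr_suml.
  under eq_bigr => a _ do rewrite exchange_big /=.
  rewrite exchange_big /=; apply: eq_bigr => c _.
  under eq_bigr => a _ do under eq_bigr => b _ do rewrite mulr_suml.
  under eq_bigr => a _ do rewrite exchange_big /=.
  rewrite exchange_big /=; apply: eq_bigr => d _.
  rewrite mulr_suml; apply: eq_bigr => a _.
  by rewrite mulr_sumr; apply: eq_bigr => b _; ring.
under eq_bigr => i _ do rewrite exchange_big /=.
rewrite exchange_big /=; apply: eq_bigr => c _.
under eq_bigr => i _ do rewrite exchange_big /=.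
rewrite exchange_big /=; apply: eq_bigr => d _.
by rewrite expr2 mulr_suml; apply: eq_bigr => i _; rewrite mulr_sumr.
Qed.

Definition vec3 (x y : R) (a : nat) : R := nth 0 [:: 1; x; y] a.

(** This lemma and the next two make the coefficients of [pair_cert] Lagrange multipliers for the
    constraint that [rho] is a permutation: after summation over all pairs a term vanishes or
    becomes a constant independent of [rho]. *)
Lemma sum_gap_diff N rho (g x : nat -> R) : perm_fun N rho ->
  \sum_(i < N) \sum_(j < N) g (gap N (rho i) (rho j)) * (x j - x i) = 0.
Proof.
move=> hr.
under eq_bigr => i _ do under eq_bigr => j _ do rewrite mulrBr.
under eq_bigr => i _ do rewrite sumrB.
rewrite sumrB exchange_big /=.
under eq_bigr => j _ do rewrite -mulr_suml (@sum_gapl _ N rho g j)//.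
under [X in _ - X]eq_bigr => i _ do rewrite -mulr_suml (@sum_gapr _ N rho g i)//.
by rewrite subrr.
Qed.

Lemma sum_gap_sum N rho (g x : nat -> R) : perm_fun N rho ->
  \sum_(k < N) g k = 0 ->
  \sum_(i < N) \sum_(j < N) g (gap N (rho i) (rho j)) * (x i + x j) = 0.
Proof.
move=> hr g0.
under eq_bigr => i _ do under eq_bigr => j _ do rewrite mulrDr.
under eq_bigr => i _ do rewrite big_split /= -mulr_suml (@sum_gapr _ N rho g i)// g0 mul0r add0r.
rewrite exchange_big /=.
under eq_bigr => j _ do rewrite -mulr_suml (@sum_gapl _ N rho g j)// g0 mul0r.
by rewrite big1.
Qed.

Lemma sum_gap_const N rho (g : nat -> R) : perm_fun N rho ->
  \sum_(i < N) \sum_(j < N) g (gap N (rho i) (rho j)) =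
  N%:R * \sum_(k < N) g k.
Proof.
move=> hr; under eq_bigr => i _ do rewrite (@sum_gapr _ N rho g i)//.
by rewrite sumr_const card_ord mulr_natl.
Qed.

Lemma perm_fun_id N : perm_fun N id.
Proof. by rewrite /perm_fun map_id. Qed.

(* The right-hand side comes from [L * Psi] by the tangent inequality
   [S^2 T^2 >= 2 s t S T - (s t)^2], applied to an individual pair of points. *)
Definition pair_cert N (L q0 : R) (al av p q : nat -> R)
   (us : seq (nat -> nat -> nat -> R)) (slack : nat -> nat -> R)
   (k l : nat) (x x' y y' : R) : Prop :=
  let s : R := zr (offset N k) in let t : R := zr (offset N l) in
  slack k l + al k + al l + av k * (x' - x) + av l * (y' - y)
  + \sum_(u <- us) quad_corr N u k l (vec3 x y) (vec3 x' y')
  + q0 * (x * x' + y * y')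
  + (p k + q l) * (x ^+ 2 + x' ^+ 2) + (p l + q k) * (y ^+ 2 + y' ^+ 2) <=
  L * (2 * (s * t) * ((s + 2 * (x' - x)) * (t + 2 * (y' - y))) - (s * t) ^+ 2
       + 4 * N%:R ^+ 2 * ((x' - x) ^+ 2 + (y' - y) ^+ 2)).

(** Sum the pair inequalities. The [av] terms cancel, the [p] and [q] terms vanish because these
    functions have mean zero, the [q0] term because the displacements are centred, and the
    autocorrelations are nonnegative. Diagonal pairs carry the same point twice, hence the separate
    condition with equal displacements. *)
Lemma certificate_bound N (L q0 : R) (al av p q : nat -> R)
   (us : seq (nat -> nat -> nat -> R)) (slack : nat -> nat -> R)
   (rho : nat -> nat) (x y : nat -> R) :
  0 <= L -> perm_fun N rho ->
  \sum_(k < N) p k = 0 -> \sum_(k < N) q k = 0 ->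
  \sum_(i < N) x i = 0 -> \sum_(i < N) y i = 0 ->
  (forall k l x x' y y', (0 < k < N)%N -> (0 < l < N)%N ->
     pair_cert N L q0 al av p q us slack k l x x' y y') ->
  (forall x y, pair_cert N L q0 al av p q us slack 0 0 x x y y) ->
  \sum_(i < N) \sum_(j < N) slack (gap N i j) (gap N (rho i) (rho j))
   + N%:R * (2 * \sum_(k < N) al k)
   + L * (2 * N%:R ^+ 3 * \sum_(k < N) zr (offset N k) ^+ 2)
  <= L * Psi N%:R N (spread N id x) (spread N rho y).
Proof.
move=> L0 hr p0 q00 x0 y0 hpair hdiag.
have hid := perm_fun_id N.
(* [u] collects the constants of the degree-two part, [A] the slack and its multipliers, [v] all
   terms linear in the displacements, [w] the autocorrelations and [z] the quadratic multipliers.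
   The constants in [u] and the linear terms with factor [L] in [v] are those parts of [L * Psi]
   that [pair_cert] omits. *)
pose u i j : R := L * (N%:R ^+ 2 * (zr (offset N (gap N i j)) ^+ 2)
                  + N%:R ^+ 2 * (zr (offset N (gap N (rho i) (rho j))) ^+ 2)).
pose A i j := slack (gap N i j) (gap N (rho i) (rho j)) + al (gap N i j) + al (gap N (rho i) (rho j)).
pose v i j := av (gap N i j) * (x j - x i) + av (gap N (rho i) (rho j)) * (y j - y i)
  + L * (4 * N%:R ^+ 2) * (zr (offset N (gap N i j)) * (x j - x i))
  + L * (4 * N%:R ^+ 2) * (zr (offset N (gap N (rho i) (rho j))) * (y j - y i)).
pose w i j := \sum_(u <- us) quad_corr N u (gap N i j) (gap N (rho i) (rho j)) (vec3 (x i) (y i)) (vec3 (x j) (y j)).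
pose z i j := q0 * (x i * x j) + q0 * (y i * y j)
  + p (gap N i j) * (x i ^+ 2 + x j ^+ 2) + q (gap N (rho i) (rho j)) * (x i ^+ 2 + x j ^+ 2)
  + p (gap N (rho i) (rho j)) * (y i ^+ 2 + y j ^+ 2) + q (gap N i j) * (y i ^+ 2 + y j ^+ 2).
have key : \sum_(i < N) \sum_(j < N) (A i j + u i j + v i j + w i j + z i j)
   <= L * Psi N%:R N (spread N id x) (spread N rho y).
  rewrite /Psi mulr_sumr; apply: ler_sum => i _; rewrite mulr_sumr; apply: ler_sum => j _.
  set S := spread N id x i j; set T := spread N rho y i j.
  set k := gap N i j; set l := gap N (rho i) (rho j).
  have h : pair_cert N L q0 al av p q us slack k l (x i) (x j) (y i) (y j).
    have [ij|ij] := eqVneq (i : nat) j.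
      by rewrite /k /l ij !gapxx; apply: hdiag.
    have k0 n m : (n < N)%N -> (m < N)%N -> n != m -> (0 < gap N n m < N)%N.
      by move=> nN mN nm; rewrite gapE//; case: (leqP n m) => ?; apply/andP; split; lia.
    apply: hpair; rewrite k0 ?(perm_funP hr).2//.
    by apply: contra_neq ij; apply: (perm_funP hr).1; rewrite inE.
  rewrite /A /u /v /w /z -/k -/l.
  move: h; rewrite /pair_cert.
  have -> : zr (offset N k) + 2 * (x j - x i) = S by [].
  have -> : zr (offset N l) + 2 * (y j - y i) = T by [].
  set Q := \sum_(u <- us) _.
  set s : R := zr (offset N k); set t : R := zr (offset N l).
  move=> h.
  have tang : 2 * (s * t) * (S * T) - (s * t) ^+ 2 <= S ^+ 2 * T ^+ 2.
    rewrite -subr_ge0 (_ : _ - _ = (S * T - s * t) ^+ 2) ?sqr_ge0//; ring.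
  have hL : L * (2 * (s * t) * (S * T) - (s * t) ^+ 2) <= L * (S ^+ 2 * T ^+ 2).
    exact: ler_wpM2l.
  have eS : S = s + 2 * (x j - x i) by [].
  have eT : T = t + 2 * (y j - y i) by [].
  have -> : L * (N%:R ^+ 2 * (S ^+ 2 + T ^+ 2) + S ^+ 2 * T ^+ 2) =
     L * (S ^+ 2 * T ^+ 2) + L * (N%:R ^+ 2 * (s ^+ 2 + t ^+ 2))
     + L * (4 * N%:R ^+ 2 * ((x j - x i) ^+ 2 + (y j - y i) ^+ 2))
     + L * (4 * N%:R ^+ 2) * (s * (x j - x i)) + L * (4 * N%:R ^+ 2) * (t * (y j - y i)).
    by rewrite eS eT; ring.
  move: h hL; clear; clearbody Q S T s t.
  move: (slack k l) (al k) (al l) (av k) (av l) (p k) (p l) (q k) (q l) => S1 a1 a2 v1 v2 p1 p2 q1 q2.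
  move: (x i) (x j) (y i) (y j) => xi xj yi yj.
  move: (N%:R : R) => n h hL.
  have e : L * (2 * (s * t) * (S * T) - (s * t) ^+ 2 + 4 * n ^+ 2 * ((xj - xi) ^+ 2 + (yj - yi) ^+ 2))
    = L * (2 * (s * t) * (S * T) - (s * t) ^+ 2) + L * (4 * n ^+ 2 * ((xj - xi) ^+ 2 + (yj - yi) ^+ 2)) by ring.
  rewrite e in h.
  have h2 := le_trans h (lerD hL (lexx _)).
  rewrite -subr_ge0; move: h2; rewrite -subr_ge0.
  by congr (0 <= _); ring.
apply: le_trans key.
have sv : \sum_(i < N) \sum_(j < N) v i j = 0.
  rewrite /v; under eq_bigr => i _ do rewrite !big_split /= -!mulr_sumr.
  rewrite !big_split /= -!mulr_sumr.
  rewrite (@sum_gap_diff N id av)// (@sum_gap_diff N rho av)//.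
  rewrite (@sum_gap_diff N id (fun k => zr (offset N k)))//.
  by rewrite (@sum_gap_diff N rho (fun k => zr (offset N k)))// !mulr0 !addr0.
have sq (f : nat -> R) : \sum_(i < N) f i = 0 -> \sum_(i < N) \sum_(j < N) q0 * (f i * f j) = 0.
  move=> f0; under eq_bigr => i _ do rewrite -mulr_sumr -mulr_sumr f0 !mulr0.
  by rewrite big1.
have sz : \sum_(i < N) \sum_(j < N) z i j = 0.
  rewrite /z; under eq_bigr => i _ do rewrite !big_split /=.
  rewrite !big_split /= !sq// (@sum_gap_sum N id p (fun i => x i ^+ 2))//.
  rewrite (@sum_gap_sum N rho q (fun i => x i ^+ 2))// (@sum_gap_sum N rho p (fun i => y i ^+ 2))//.
  by rewrite (@sum_gap_sum N id q (fun i => y i ^+ 2))// !addr0.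
have sw : 0 <= \sum_(i < N) \sum_(j < N) w i j.
  rewrite /w; under eq_bigr => i _ do rewrite exchange_big /=.
  rewrite exchange_big /=; apply: sumr_ge0 => u' _.
  exact: (@quad_corr_ge0 N rho u' (fun i => vec3 (x i) (y i))).
have su : \sum_(i < N) \sum_(j < N) u i j = L * (2 * N%:R ^+ 3 * \sum_(k < N) zr (offset N k) ^+ 2).
  rewrite /u; under eq_bigr => i _ do rewrite -mulr_sumr big_split /= -!mulr_sumr.
  rewrite -mulr_sumr big_split /= -!mulr_sumr.
  rewrite (@sum_gap_const N id (fun k => zr (offset N k) ^+ 2))//.
  by rewrite (@sum_gap_const N rho (fun k => zr (offset N k) ^+ 2))//; ring.
have sA : \sum_(i < N) \sum_(j < N) A i j = \sum_(i < N) \sum_(j < N) slack (gap N i j) (gap N (rho i) (rho j))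
   + N%:R * (2 * \sum_(k < N) al k).
  rewrite /A; under eq_bigr => i _ do rewrite !big_split /=.
  rewrite !big_split /= (@sum_gap_const N id al)// (@sum_gap_const N rho al)//; ring.
have -> : \sum_(i < N) \sum_(j < N) (A i j + u i j + v i j + w i j + z i j)
  = \sum_(i < N) \sum_(j < N) A i j + \sum_(i < N) \sum_(j < N) u i j
    + \sum_(i < N) \sum_(j < N) v i j + \sum_(i < N) \sum_(j < N) w i j + \sum_(i < N) \sum_(j < N) z i j.
  clear; clearbody A u v w z.
  under eq_bigr => i _ do rewrite !big_split /=.
  by rewrite !big_split.
by rewrite sA su sv sz !addr0 lerDl.
Qed.

End Certificate.

(* A quadratic form is stored as the list of the rows of the upper triangle of
   its symmetric matrix. *)
Fixpoint schur (d : Z) (b : seq Z) (A : seq (seq Z)) : seq (seq Z) :=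
  match A, b with
  | row :: A', x :: b' =>
    [seq Z.sub (Z.mul d ey.1) (Z.mul x ey.2) | ey <- zip row b] :: schur d b' A'
  | _, _ => [::]
  end.

(** Symmetric Gaussian elimination without division. It is a sufficient test only: a zero pivot is
    accepted in the last row and nowhere else. *)
Fixpoint psd (fuel : nat) (A : seq (seq Z)) : bool :=
  match fuel, A with
  | _, [::] => true
  | f.+1, (d :: b) :: A' =>
    if b is [::] then Z.leb Z0 d
    else if Z.ltb Z0 d then psd f (schur d b A') else false
  | _, _ => false
  end.

Fixpoint triangular (A : seq (seq Z)) : bool :=
  if A is row :: A' then (size row == (size A').+1) && triangular A' else true.

Lemma size_schur d b A : size b = size A -> size (schur d b A) = size A.
Proof. by elim: A b => [|row A IH] [|x b] //= [/IH ->]. Qed.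

Lemma triangular_schur d b A : size b = size A -> triangular A ->
  triangular (schur d b A).
Proof.
elim: A b => [|[|e es] A IH] [|x b] //= [sb] /andP[/eqP[se] tA].
by rewrite size_map size_zip se sb minnn size_schur// eqxx IH.
Qed.

Section QuadraticForms.
Variable R : realFieldType.

Fixpoint dotr (b : seq Z) (v : seq R) : R :=
  match b, v with x :: b', y :: v' => zr x * y + dotr b' v' | _, _ => 0 end.

Fixpoint quadr (A : seq (seq Z)) (v : seq R) : R :=
  match A, v with
  | (d :: b) :: A', x :: v' => zr d * x ^+ 2 + 2 * x * dotr b v' + quadr A' v'
  | _, _ => 0
  end.

Lemma dotr_schur d x (e b : seq Z) (v : seq R) : size e = size b ->
  dotr [seq Z.sub (Z.mul d ey.1) (Z.mul x ey.2) | ey <- zip e b] v =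
  zr d * dotr e v - zr x * dotr b v.
Proof.
elim: e b v => [|y e IH] [|z b] [|w v] //=; rewrite ?mulr0 ?subr0// => -[sb].
by rewrite IH// !zrE; ring.
Qed.

Lemma quadr_schur d b A (v : seq R) : size b = size A -> triangular A ->
  size v = size A ->
  quadr (schur d b A) v = zr d * quadr A v - (dotr b v) ^+ 2.
Proof.
elim: A b v => [|[|e es] A IH] [|x b] [|y v] //=; first by rewrite mulr0 expr0n subr0.
move=> [sb] /andP[/eqP[se] tA] [sv].
rewrite dotr_schur ?se ?sb// IH// !zrE; ring.
Qed.

(** Completing the square in the first variable: [d Q = (d x + B)^2 + (d q - B^2)], where the second
    bracket is the form of the Schur complement. *)
Lemma psdP fuel A (v : seq R) : triangular A -> size v = size A ->
  psd fuel A -> 0 <= quadr A v.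
Proof.
elim: fuel A v => [|f IH] [|[|d b] A] // [|x v] //= /andP[/eqP[sb] tA] [sv].
case: b sb => [|b0 b] sb.
  by case: A sb {tA sv} => // _; rewrite -(@zr_le R) zr0 /= mulr0 !addr0 => h; rewrite mulr_ge0 ?sqr_ge0.
case: ifP => // d0 h; rewrite -(@zr_lt R) zr0 in d0.
have := IH _ v (triangular_schur d sb tA); rewrite (size_schur d sb) sv (quadr_schur d sb tA sv).
move=> /(_ erefl h); set B := dotr _ _; set q := quadr _ _ => h'.
rewrite -(pmulr_rge0 _ d0).
have -> : zr d * (zr d * x ^+ 2 + 2 * x * B + q) = (zr d * x + B) ^+ 2 + (zr d * q - B ^+ 2) by ring.
by rewrite addr_ge0 ?sqr_ge0.
Qed.
End QuadraticForms.

(** * Exact verification over the integers *)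

Definition zsum (N : nat) (f : nat -> Z) : Z :=
  foldr (fun i a => Z.add (f i) a) Z0 (iota 0 N).

Lemma zr_zsum (R : realFieldType) N f : zr (zsum N f) = \sum_(i < N) zr (f i) :> R.
Proof.
rewrite -(big_mkord xpredT (fun i => zr (f i))) /index_iota subn0 /zsum.
by elim: (iota 0 N) => [|i s IH]; rewrite ?big_nil ?zr0// big_cons /= zrD IH.
Qed.

Definition fold_idx N k := minn k (N - k).

Definition parity N (odd : bool) k : Z :=
  if odd && (N < k.*2)%N then Zneg xH else Zpos xH.

Definition look (s : seq Z) k := nth Z0 s k.
Definition look2 (T : seq (seq Z)) k l := nth Z0 (nth [::] T k) l.

(** Missing entries are read as zero, so an empty list of values stands for the zero function. The
    triples of tables in a certificate thereby form a triangular array, like a Cholesky factor. *)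
Record table := Table { odd1 : bool; odd2 : bool; values : seq (seq Z) }.

Definition unfold_table N (T : table) : seq (seq Z) :=
  [seq [seq Z.mul (Z.mul (parity N (odd1 T) c) (parity N (odd2 T) d))
              (look2 (values T) (fold_idx N c) (fold_idx N d)) | d <- iota 0 N]
  | c <- iota 0 N].

(* Every function on Z/N that occurs is even or odd: it is tabulated on
   0, ..., N/2 only.  Entry 0 of [c_p] and [c_q] is minus the sum of the values
   at the nonzero residues. *)
Record cert := Cert {
  c_scale : Z; c_q0 : Z; c_al : seq Z; c_av : seq Z; c_p : seq Z; c_q : seq Z;
  c_slack : seq (seq Z); c_tables : seq (seq table) }.

Fixpoint zdot (s t : seq Z) : Z :=
  match s, t with x :: s', y :: t' => Z.add (Z.mul x y) (zdot s' t') | _, _ => Z0 end.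

Fixpoint zdot2 l (A B : seq (seq Z)) : Z :=
  match A, B with
  | a :: A', b :: B' => Z.add (zdot (rot l a) b) (zdot2 l A' B')
  | _, _ => Z0
  end.

(** Rotating a list shifts its index cyclically, so a value of the cyclic correlation is a rotation
    followed by a scalar product. *)
Definition zcorr (A B : seq (seq Z)) k l := zdot2 l (rot k A) B.

Definition zcorrs (U : seq (seq (seq (seq Z)))) a b k l : Z :=
  foldr (fun u acc => Z.add (zcorr (nth [::] u a) (nth [::] u b) k l) acc) Z0 U.

(** The matrix, in the variables [(x, x', y, y', 1)], of twice the difference of the two sides of
    [pair_cert]; the doubling keeps the off-diagonal entries integral. *)
Definition pair_matrix N (C : cert) (U : seq (seq (seq (seq Z)))) k l : seq (seq Z) :=
  let s := offset N k in let t := offset N l in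
  let fk := fold_idx N k in let fl := fold_idx N l in
  let L := c_scale C in let q0 := c_q0 C in
  let n2 := Z.mul (Z.mul 4 L) (Z.of_nat (N * N)) in
  let e := Z.mul (Z.mul 8 L) (Z.mul s t) in
  let ak := Z.mul (parity N true k) (look (c_av C) fk) in
  let al := Z.mul (parity N true l) (look (c_av C) fl) in
  let wx := Z.add (look (c_p C) fk) (look (c_q C) fl) in
  let wy := Z.add (look (c_p C) fl) (look (c_q C) fk) in
  let D a b := zcorrs U a b k l in
  let gx := Z.mul (Z.mul 4 L) (Z.mul (Z.mul s t) t) in
  let gy := Z.mul (Z.mul 4 L) (Z.mul (Z.mul s t) s) in
  let d := D 0%N 0%N in
  (let xx := Z.mul 2 (Z.sub n2 wx) in let yy := Z.mul 2 (Z.sub n2 wy) in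
  [:: [:: xx; Z.sub (Z.opp (Z.add (Z.mul 2 n2) q0)) (D 1%N 1%N); e; Z.opp (Z.add e (D 1%N 2%N));
          Z.sub (Z.sub ak gx) (D 1%N 0%N)];
      [:: xx; Z.opp (Z.add e (D 2%N 1%N)); e; Z.sub (Z.sub gx ak) (D 0%N 1%N)];
      [:: yy; Z.sub (Z.opp (Z.add (Z.mul 2 n2) q0)) (D 2%N 2%N); Z.sub (Z.sub al gy) (D 2%N 0%N)];
      [:: yy; Z.sub (Z.sub gy al) (D 0%N 2%N)];
      [:: Z.mul 2 (Z.sub (Z.mul L (Z.mul (Z.mul s t) (Z.mul s t)))
           (Z.add (Z.add (look (c_al C) fk) (look (c_al C) fl))
                  (Z.add d (look2 (c_slack C) fk fl))))]])%ZZ.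

(** The same at gap 0, where [x' = x] and [y' = y] leave the variables [(x, y, 1)], and
    [s = t = - N] turns the constant [(s t)^2] into [N^4]. *)
Definition diag_matrix N (C : cert) (U : seq (seq (seq (seq Z)))) : seq (seq Z) :=
  let L := c_scale C in let q0 := c_q0 C in
  let w := Z.add (look (c_p C) 0) (look (c_q C) 0) in
  let D a b := zcorrs U a b 0 0 in
  let g := Z.add q0 (Z.mul 2 w) in
  [:: [:: Z.opp (Z.mul 2 (Z.add (D 1 1) g)); Z.opp (Z.add (D 1 2) (D 2 1)); Z.opp (Z.add (D 0 1) (D 1 0))];
      [:: Z.opp (Z.mul 2 (Z.add (D 2 2) g)); Z.opp (Z.add (D 0 2) (D 2 0))];
      [:: Z.mul 2 (Z.sub (Z.mul L (Z.of_nat (N * N * (N * N))))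
            (Z.add (Z.mul 2 (look (c_al C) 0)) (Z.add (D 0 0) (look2 (c_slack C) 0 0))))]]%N.

Definition check_cert N (C : cert) : bool :=
  let U := [seq [seq unfold_table N T | T <- u] | u <- c_tables C] in
  [&& (0 < N)%N, Z.leb Z0 (c_scale C),
      Z.eqb (zsum N (fun k => look (c_p C) (fold_idx N k))) Z0,
      Z.eqb (zsum N (fun k => look (c_q C) (fold_idx N k))) Z0,
      all (fun u => size u == 3) (c_tables C),
      psd 3 (diag_matrix N C U) &
      all (fun k => all (fun l => psd 5 (pair_matrix N C U k l)) (iota 1 N.-1)) (iota 1 N.-1)].

Section Checked.
Variable R : realFieldType.

Definition zfun (A : seq (seq Z)) (c d : nat) : R := zr (look2 A c d).

Lemma zr_zdot s t : size s = size t ->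
  zr (zdot s t) = \sum_(d < size t) zr (look s d) * zr (look t d) :> R.
Proof.
elim: s t => [|x s IH] [|y t] //=; first by rewrite big_ord0.
by move=> [st]; rewrite !zrE IH// big_ord_recl.
Qed.

Lemma nth_rot (T : Type) (x0 : T) (s : seq T) k i : (k < size s)%N -> (i < size s)%N ->
  nth x0 (rot k s) i = nth x0 s ((i + k) %% size s)%N.
Proof.
move=> ks iS; rewrite /rot nth_cat size_drop nth_drop.
case: ltnP => h; first by rewrite addnC modn_small//; lia.
rewrite nth_take; last by lia.
congr nth; have -> : (i + k = (i - (size s - k)) + size s)%N by lia.
by rewrite modnDr modn_small//; lia.
Qed.

Definition square N (A : seq (seq Z)) :=
  size A = N /\ forall c, (c < N)%N -> size (nth [::] A c) = N.

Lemma zr_zcorr N A B k l : square N A -> square N B -> (k < N)%N -> (l < N)%N ->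
  zr (zcorr A B k l) = correlation N (zfun A) (zfun B) k l.
Proof.
move=> [sA rA] [sB rB] kN lN; rewrite /zcorr.
have gen (P Q : seq (seq Z)) : size P = size Q ->
    (forall c, (c < size Q)%N -> size (nth [::] P c) = N) ->
    (forall c, (c < size Q)%N -> size (nth [::] Q c) = N) ->
    zr (zdot2 l P Q) = \sum_(c < size Q) \sum_(d < N)
      zr (look (nth [::] P c) ((d + l) %% N)%N) * zr (look (nth [::] Q c) d) :> R.
  elim: P Q => [|a P IH] [|b Q] //=; first by rewrite big_ord0.
  move=> [sPQ] hP hQ; rewrite zrD IH//; first last.
  - by move=> c; apply: (hQ c.+1).
  - by move=> c; apply: (hP c.+1).
  have sa := hP 0%N isT; have sb := hQ 0%N isT; rewrite /= in sa sb.
  rewrite big_ord_recl /= zr_zdot ?size_rot ?sa ?sb//; congr (_ + _).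
  by apply: eq_bigr => d _; rewrite /look nth_rot ?sa.
rewrite gen ?size_rot ?sA ?sB//; last first.
  by move=> c cN; rewrite nth_rot ?sA// rA// ltn_pmod//; lia.
apply: eq_bigr => c _; apply: eq_bigr => d _.
by rewrite /zfun /look2 nth_rot ?sA.
Qed.

Variables (N : nat) (C : cert).
Let U := [seq [seq unfold_table N T | T <- u] | u <- c_tables C].

Definition cert_us : seq (nat -> nat -> nat -> R) :=
  [seq (fun a => zfun (nth [::] u a)) | u <- U].
Definition cert_fun (s : seq Z) (k : nat) : R := zr (look s (fold_idx N k)).
Definition cert_av (k : nat) : R := zr (Z.mul (parity N true k) (look (c_av C) (fold_idx N k))).
Definition cert_slack (k l : nat) : R := zr (look2 (c_slack C) (fold_idx N k) (fold_idx N l)).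

Hypothesis tables3 : all (fun u => size u == 3) (c_tables C).

Lemma sum_quad_corr k l (v v' : nat -> R) : (k < N)%N -> (l < N)%N ->
  \sum_(u <- cert_us) quad_corr N u k l v v' =
  \sum_(a < 3) \sum_(b < 3) zr (zcorrs U a b k l) * (v a * v' b).
Proof.
move=> kN lN; rewrite /cert_us big_map.
have : all (fun u => (size u == 3) && all (fun A => (size A == N) && all (fun r => size r == N) A) u) U.
  rewrite /U all_map; apply: sub_all tables3 => u /= su; rewrite size_map su /=.
  rewrite all_map; elim: u {su} => //= T u ->; rewrite size_map size_iota eqxx andbT /=.
  by apply/allP => r /mapP[c _ ->]; rewrite size_map size_iota.
rewrite /zcorrs; elim: U => [|u V IH] /=.
  by rewrite big_nil; do 2!rewrite big1// => ? _; rewrite zr0 mul0r.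
move=> /andP[/andP[/eqP su au] /IH{}IH]; rewrite big_cons IH /quad_corr -big_split /=.
apply: eq_bigr => a _; rewrite -big_split /=; apply: eq_bigr => b _.
rewrite zrD mulrDl; congr (_ * _ + _).
have sq i : (i < 3)%N -> square N (nth [::] u i).
  move=> i3; have iu : nth [::] u i \in u by rewrite mem_nth ?su.
  have := allP au _ iu => /= /andP[/eqP sA aA]; have {}aA := allP aA.
  by split=> // c cN; apply/eqP/aA/mem_nth; rewrite sA.
by rewrite (@zr_zcorr N)//; apply: sq.
Qed.

Lemma check_pair k l x x' y y' : (0 < k < N)%N -> (0 < l < N)%N ->
  psd 5 (pair_matrix N C U k l) ->
  pair_cert N (zr (c_scale C)) (zr (c_q0 C)) (cert_fun (c_al C)) cert_av
    (cert_fun (c_p C)) (cert_fun (c_q C)) cert_us cert_slack k l x x' y y'.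
Proof.
move=> /andP[k0 kN] /andP[l0 lN] /(@psdP R 5 (pair_matrix N C U k l) [:: x; x'; y; y'; 1] isT erefl).
lazy beta zeta iota delta [pair_matrix quadr dotr]; rewrite !zrE !zr_nat natrM => h.
rewrite /pair_cert sum_quad_corr// !big_ord_recl !big_ord0 /=.
rewrite /cert_fun /cert_av /cert_slack /vec3 /= !zrE !zr_nat.
rewrite /bump /= ?add0n ?addn0 ?add1n.
rewrite -subr_ge0 -(@pmulr_rge0 _ 2)//.
by apply: le_trans h _; rewrite le_eqVlt; apply/orP; left; apply/eqP; ring.
Qed.

Lemma check_diag x y : (0 < N)%N -> psd 3 (diag_matrix N C U) ->
  pair_cert N (zr (c_scale C)) (zr (c_q0 C)) (cert_fun (c_al C)) cert_av
    (cert_fun (c_p C)) (cert_fun (c_q C)) cert_us cert_slack 0 0 x x y y.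
Proof.
move=> N0 /(@psdP R 3 (diag_matrix N C U) [:: x; y; 1] isT erefl).
lazy beta zeta iota delta [diag_matrix quadr dotr]; rewrite !zrE !zr_nat !natrM => h.
rewrite /pair_cert sum_quad_corr// !big_ord_recl !big_ord0 /=.
rewrite /cert_fun /cert_av /cert_slack /vec3 /= !zrE /fold_idx min0n !zr_nat.
rewrite /bump /= ?add0n ?addn0 ?add1n.
rewrite -subr_ge0 -(@pmulr_rge0 _ 2)//.
by apply: le_trans h _; rewrite le_eqVlt; apply/orP; left; apply/eqP; ring.
Qed.

End Checked.

Lemma check_certP (R : realFieldType) N (C : cert) (rho : nat -> nat) (x y : nat -> R) :
  check_cert N C -> perm_fun N rho ->
  \sum_(i < N) x i = 0 -> \sum_(i < N) y i = 0 ->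
  \sum_(i < N) \sum_(j < N) cert_slack R N C (gap N i j) (gap N (rho i) (rho j))
   + N%:R * (2 * \sum_(k < N) cert_fun R N (c_al C) k)
   + zr (c_scale C) * (2 * N%:R ^+ 3 * \sum_(k < N) zr (offset N k) ^+ 2)
  <= zr (c_scale C) * Psi N%:R N (spread N id x) (spread N rho y).
Proof.
move=> /and5P[N0 L0 /Z.eqb_spec p0 /Z.eqb_spec q0 /and3P[t3 hd /allP hp]] hr x0 y0.
apply: (@certificate_bound R N _ (zr (c_q0 C)) _ (cert_av R N C)
  (cert_fun R N (c_p C)) (cert_fun R N (c_q C)) (cert_us R N C)) => //.
- by rewrite -(@zr0 R) zr_le.
- by rewrite -[RHS](zr0 R) -p0 zr_zsum.
- by rewrite -[RHS](zr0 R) -q0 zr_zsum.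
- move=> k l u u' v v' k0 l0; apply: check_pair => //.
  have kN : k \in iota 1 N.-1 by rewrite mem_iota; lia.
  have lN : l \in iota 1 N.-1 by rewrite mem_iota; lia.
  by have /allP := hp _ kN; apply.
- by move=> u v; apply: check_diag.
Qed.

Definition dist_nat a b := (a - b + (b - a))%N.

Lemma fold_gap N i j : (i < N)%N -> (j < N)%N ->
  fold_idx N (gap N i j) = fold_idx N (dist_nat i j).
Proof.
move=> iN jN; rewrite gapE// /fold_idx /dist_nat.
by case: (leqP i j) => ij; rewrite /minn; case: ifP => h; case: ifP => h'; lia.
Qed.

Lemma dist_natC a b : dist_nat a b = dist_nat b a.
Proof. by rewrite /dist_nat addnC. Qed.

Lemma dist_natxx a : dist_nat a a = 0%N.
Proof. by rewrite /dist_nat subnn. Qed.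

(** * Depth-first search over permutations *)

Section Search.
Variables (N : nat) (slack : seq (seq Z)) (budget : Z) (leaf : seq nat -> bool).

Definition weight k l : Z := look2 slack (fold_idx N k) (fold_idx N l).

Fixpoint added_cost d v (pre : seq nat) : Z :=
  if pre is w :: pre' then
    Z.add (weight d (dist_nat v w)) (added_cost d.+1 v pre')
  else Z0.

Fixpoint total_cost (pre : seq nat) : Z :=
  if pre is v :: pre' then Z.add (added_cost 1%N v pre') (total_cost pre') else Z0.

(* [pre] is a reversed prefix; nested conditionals (rather than boolean
   connectives) keep the evaluation lazy. *)
Fixpoint search fuel (pre : seq nat) (cost : Z) : bool :=
  if fuel is f.+1 then
    all (fun v => if v \in pre then true else
      let c := Z.add (added_cost 1%N v pre) cost in
      if Z.ltb budget (Z.add c c) then true else search f (v :: pre) c) (iota 0 N)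
  else leaf (rev pre).

Hypothesis weight_ge0 : forall k l, Z.leb Z0 (weight k l).

Lemma added_cost_ge0 d v pre : Z.leb Z0 (added_cost d v pre).
Proof. by elim: pre d => //= w pre IH d; have := weight_ge0 d (dist_nat v w); have := IH d.+1; lia. Qed.

Lemma total_cost_cat q pre : Z.leb (total_cost pre) (total_cost (q ++ pre)).
Proof.
elim: q => [|v q IH] /=; first by lia.
by have := added_cost_ge0 1%N v (q ++ pre); lia.
Qed.

Lemma searchP fuel pre q : search fuel pre (total_cost pre) ->
  size q = fuel -> uniq (q ++ pre) -> all (fun v => (v < N)%N) q ->
  leaf (rev (q ++ pre)) \/
  Z.ltb budget (Z.add (total_cost (q ++ pre)) (total_cost (q ++ pre))).
Proof.
elim: fuel pre q => [|f IH] pre q /=; first by move=> h /size0nil -> _ _; left.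
move=> /allP h; case/lastP: q => // q v; rewrite size_rcons => -[sq].
rewrite cat_rcons all_rcons => u /andP[vN qN].
have := h v; rewrite mem_iota add0n => /(_ vN).
have -> : v \in pre = false.
  by apply/negbTE; move: u; rewrite cat_uniq => /and3P[_ _ /= /andP[]].
case: ifP => [hb _|_ hs]; last exact: (IH (v :: pre)).
by right; have := total_cost_cat q (v :: pre); move: hb => /=; lia.
Qed.

End Search.

(** * Tests for a single permutation *)

Section Leaf.
Variables (N : nat) (T : Z).

Definition zmax (f : nat -> Z) : Z := foldr (fun i a => Z.max (f i) a) Z0 (iota 0 N).

Lemma zmax_ge f i : (i < N)%N -> Z.leb (f i) (zmax f).
Proof.
move=> iN; have : i \in iota 0 N by rewrite mem_iota.
rewrite /zmax; elim: (iota 0 N) => //= k s IH.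
by rewrite in_cons => /orP[/eqP ->|/IH]; lia.
Qed.

Lemma zmax_ge0 f : Z.leb Z0 (zmax f).
Proof.
rewrite /zmax; elim: (iota 0 N) => // k s IH.
by apply/Z.leb_le; apply: Z.le_trans (Z.le_max_r _ _); apply/Z.leb_le.
Qed.

(** [M] times the spread at displacements [x / M], which makes a rational reference configuration
    integral. *)
Definition ref_spread (M : Z) (r : seq nat) (x : seq Z) i j : Z :=
  Z.add (Z.mul M (offset N (gap N (nth 0%N r i) (nth 0%N r j))))
        (Z.mul 2 (Z.sub (look x j) (look x i))).

Section Reference.
Variables (M : Z) (r : seq nat) (x y : seq Z).
Let id_r := iota 0 N.
Let n2 : Z := Z.mul (Z.mul M (Z.of_nat N)) (Z.mul M (Z.of_nat N)).
Let S := ref_spread M id_r x.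
Let U := ref_spread M r y.

Definition ref_energy : Z := zsum N (fun i => zsum N (fun j =>
  let s := S i j in let t := U i j in
  let s2 := Z.mul s s in let t2 := Z.mul t t in
  Z.add (Z.mul n2 (Z.add s2 t2)) (Z.mul s2 t2))).

(** [n2] minus this maximum is the modulus [c] in the tangent inequality. *)
Definition ref_max : Z := zmax (fun i => zmax (fun j =>
  if i == j then Z0 else Z.abs (Z.mul (S i j) (U i j)))).

Definition ref_gradx j : Z := zsum N (fun i => if i == j then Z0 else
  Z.mul (S i j) (Z.add n2 (Z.mul (U i j) (U i j)))).

Definition ref_grady j : Z := zsum N (fun i => if i == j then Z0 else
  Z.mul (U i j) (Z.add n2 (Z.mul (S i j) (S i j)))).

Definition ref_grad2 : Z := zsum N (fun j =>
  let a := ref_gradx j in let b := ref_grady j in Z.add (Z.mul a a) (Z.mul b b)).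

(** The tangent bound minimized over all displacements is [ref_energy - 2 ref_grad2 / (N c)]. It is
    compared with [T] after clearing the denominator; the factor [M^4] appears because [Psi] is
    homogeneous of degree four in [n], [S] and [T]. *)
Definition ref_strict : bool :=
  let c := Z.sub n2 ref_max in
  if Z.ltb Z0 c then
    Z.ltb (Z.mul 2 ref_grad2)
      (Z.mul (Z.mul (Z.of_nat N) c)
             (Z.sub ref_energy (Z.mul T (Z.mul (Z.mul M M) (Z.mul M M)))))
  else false.

Definition ref_critical : bool :=
  [&& Z.eqb ref_energy T, Z.eqb ref_grad2 Z0 & Z.ltb Z0 (Z.sub n2 ref_max)].

(** The energy is quadratic in one displacement, so a Newton step reaches its minimum. The term
    [i = j] of the denominator and the rounding of [Z.div] only move the reference point slightly,
    and the test made at that point is exact. *)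
Definition ref_stepx : seq Z := [seq Z.sub (look x j)
  (Z.div (ref_gradx j) (Z.mul 2 (zsum N (fun i => Z.add n2 (Z.mul (U i j) (U i j))))))
  | j <- iota 0 N].

Definition ref_stepy : seq Z := [seq Z.sub (look y j)
  (Z.div (ref_grady j) (Z.mul 2 (zsum N (fun i => Z.add n2 (Z.mul (S i j) (S i j))))))
  | j <- iota 0 N].

End Reference.

(* Jacobi iteration from the grid: each coordinate moves to the minimum of the
   energy in that coordinate. *)
Fixpoint descend fuel (M : Z) (r : seq nat) (x y : seq Z) : bool :=
  if ref_strict M r x y then true
  else if fuel is f.+1 then descend f M r (ref_stepx M r x y) (ref_stepy M r x y)
  else false.

Definition linear_perm g : seq nat := [seq (g * i) %% N | i <- iota 0 N]%N.

(** Empty lists are read as zero displacements, that is, the grid. The iteration uses reference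
    points in sixteenths of a grid step and at most four steps. *)
Definition leaf_ok (gens : seq nat) (r : seq nat) : bool :=
  if has (fun g => r == linear_perm g) gens then ref_critical (Zpos xH) r [::] [::]
  else descend 4 (Z.of_nat 16) r [::] [::].

End Leaf.

Section LeafSound.
Variable R : realFieldType.

Lemma zr_abs z : zr (Z.abs z) = `|zr z| :> R.
Proof.
have [z0|z0] := ger0P (zr z : R).
  by congr zr; move: z0; rewrite -(zr0 R) zr_le; lia.
by rewrite -zrN; congr zr; move: z0; rewrite -(zr0 R) zr_lt; lia.
Qed.

Variables (N : nat) (M : Z) (r : seq nat) (x y : seq Z).
Hypothesis hr : perm_fun N (nth 0%N r).

Let rho := nth 0%N r.
Let S i j : R := zr (ref_spread N M (iota 0 N) x i j).
Let T i j : R := zr (ref_spread N M r y i j).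
Let n : R := zr M * N%:R.

Lemma offset_anti i j : (i < N)%N -> (j < N)%N -> i != j ->
  offset N (gap N i j) = Z.opp (offset N (gap N j i)).
Proof.
by move=> iN jN ij; rewrite /offset !gapE//; case: leqP => h; case: leqP => h'; lia.
Qed.

Lemma ref_spread_anti s z i j : perm_fun N (nth 0%N s) -> (i < N)%N -> (j < N)%N -> i != j ->
  zr (ref_spread N M s z i j) = - zr (ref_spread N M s z j i) :> R.
Proof.
move=> /perm_funP[si sN] iN jN ij; rewrite /ref_spread offset_anti ?sN//; last first.
  by apply: contra_neq ij; apply: si; rewrite inE.
by rewrite !zrE; ring.
Qed.

Lemma perm_fun_iota : perm_fun N (nth 0%N (iota 0 N)).
Proof.
apply: perm_fun_inj => [i j|i iN]; last by rewrite nth_iota.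
by rewrite !inE => iN jN; rewrite !nth_iota.
Qed.

Lemma sum_dropif (f : nat -> R) (j : 'I_N) :
  \sum_(i < N) (if (i : nat) == j then 0 else f i) = \sum_(i < N | i != j) f i.
Proof. by rewrite [RHS]big_mkcond /=; apply: eq_bigr => i _; rewrite -val_eqE; case: eqP. Qed.

Lemma zr_ref_gradx (j : 'I_N) :
  zr (ref_gradx N M r x y j) = \sum_(i < N | i != j) S i j * (n ^+ 2 + T i j ^+ 2).
Proof.
rewrite zr_zsum -(@sum_dropif (fun i => S i j * (n ^+ 2 + T i j ^+ 2))).
apply: eq_bigr => i _; case: eqP => // _.
rewrite /S /T /n; move: (ref_spread _ _ _ _ _ _) (ref_spread _ _ _ _ _ _) => s t.
by rewrite !(zrM, zrD) !zr_nat; ring.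
Qed.

Lemma zr_ref_grady (j : 'I_N) :
  zr (ref_grady N M r x y j) = \sum_(i < N | i != j) T i j * (n ^+ 2 + S i j ^+ 2).
Proof.
rewrite zr_zsum -(@sum_dropif (fun i => T i j * (n ^+ 2 + S i j ^+ 2))).
apply: eq_bigr => i _; case: eqP => // _.
rewrite /S /T /n; move: (ref_spread _ _ _ _ _ _) (ref_spread _ _ _ _ _ _) => s t.
by rewrite !(zrM, zrD) !zr_nat; ring.
Qed.

Lemma zr_ref_energy : zr (ref_energy N M r x y) = Psi n N S T.
Proof.
rewrite zr_zsum; apply: eq_bigr => i _; rewrite zr_zsum; apply: eq_bigr => j _.
rewrite /S /T /n; move: (ref_spread _ _ _ _ _ _) (ref_spread _ _ _ _ _ _) => s t.
by rewrite !(zrM, zrD) !zr_nat; ring.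
Qed.

Lemma Psi_scale (m k : R) (P Q : nat -> nat -> R) :
  Psi (m * k) N (fun i j => m * P i j) (fun i j => m * Q i j) = m ^+ 4 * Psi k N P Q.
Proof.
rewrite /Psi mulr_sumr; apply: eq_bigr => i _.
by rewrite mulr_sumr; apply: eq_bigr => j _; ring.
Qed.

Lemma sum_antisym0 (g : nat -> nat -> R) :
  (forall i j, (i < N)%N -> (j < N)%N -> i != j -> g i j = - g j i) ->
  \sum_(j < N) \sum_(i < N | i != j) g i j = 0.
Proof.
move=> ga; have := sum_antisym (fun=> 1) ga; rewrite big1 => [|i _]; last first.
  by rewrite big1// => j _; rewrite subrr mul0r.
move/esym/eqP; rewrite mulf_eq0 pnatr_eq0 /= => /eqP e.
by rewrite -[RHS]e; apply: eq_bigr => j _; rewrite mul1r.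
Qed.

Lemma ref_bound (u v : nat -> R) :
  let c := n ^+ 2 - zr (ref_max N M r x y) in
  let a j := zr M * u j - zr (look x j) in
  let b j := zr M * v j - zr (look y j) in
  zr (ref_energy N M r x y)
   + (8 * (\sum_(j < N) a j * zr (ref_gradx N M r x y j))
     + 4 * c * (\sum_(i < N) \sum_(j < N) (a j - a i) ^+ 2))
   + (8 * (\sum_(j < N) b j * zr (ref_grady N M r x y j))
     + 4 * c * (\sum_(i < N) \sum_(j < N) (b j - b i) ^+ 2))
  <= zr M ^+ 4 * Psi N%:R N (spread N id u) (spread N rho v).
Proof.
lazy beta zeta; set c := n ^+ 2 - _.
pose a j := zr M * u j - zr (look x j); pose b j := zr M * v j - zr (look y j).
have aS := ref_spread_anti x perm_fun_iota.
have aT := ref_spread_anti y hr.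
have := @Psi_lower_bound R N n c (fun i j => zr M * spread N id u i j)
  (fun i j => zr M * spread N rho v i j) S T a b.
rewrite Psi_scale zr_ref_energy.
under [\sum_(j < N) _ * zr (ref_gradx _ _ _ _ _ _)]eq_bigr => j _ do rewrite zr_ref_gradx.
under [\sum_(j < N) _ * zr (ref_grady _ _ _ _ _ _)]eq_bigr => j _ do rewrite zr_ref_grady.
move=> h; apply: le_trans (h _ _ _ _ _) => //.
- by rewrite le_eqVlt; apply/orP; left; apply/eqP; rewrite /a /b; ring.
- move=> i j iN jN; rewrite /S /ref_spread /spread !nth_iota// !zrE /a; ring.
- by move=> i j iN jN; rewrite /T /ref_spread /spread !zrE /b /rho; ring.
- move=> i j iN jN ij; rewrite /c opprB addrC subrK -zrM -zr_abs zr_le.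
  have := zmax_ge (fun i => zmax N (fun j => if i == j then Z0 else
    Z.abs (Z.mul (ref_spread N M (iota 0 N) x i j) (ref_spread N M r y i j)))) iN.
  have := zmax_ge (fun j => if i == j then Z0 else
    Z.abs (Z.mul (ref_spread N M (iota 0 N) x i j) (ref_spread N M r y i j))) jN.
  by rewrite (negbTE ij) /ref_max; lia.
Qed.

(** The energy is invariant under translation, so its gradient is orthogonal to the constants, as
    [gradient_bound] demands. Here this comes from antisymmetry. *)
Lemma ref_gradx_sum : \sum_(j < N) zr (ref_gradx N M r x y j) = 0 :> R.
Proof.
under eq_bigr => j _ do rewrite zr_ref_gradx.
apply: (@sum_antisym0 (fun i j => S i j * (n ^+ 2 + T i j ^+ 2))) => i j iN jN ij.
rewrite /S /T (ref_spread_anti x perm_fun_iota iN jN ij) (ref_spread_anti y hr iN jN ij)//.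
by rewrite sqrrN mulNr.
Qed.

Lemma ref_grady_sum : \sum_(j < N) zr (ref_grady N M r x y j) = 0 :> R.
Proof.
under eq_bigr => j _ do rewrite zr_ref_grady.
apply: (@sum_antisym0 (fun i j => T i j * (n ^+ 2 + S i j ^+ 2))) => i j iN jN ij.
rewrite /S /T (ref_spread_anti x perm_fun_iota iN jN ij) (ref_spread_anti y hr iN jN ij).
by rewrite sqrrN mulNr.
Qed.

Lemma zr_ref_grad2 : zr (ref_grad2 N M r x y) =
  \sum_(j < N) zr (ref_gradx N M r x y j) ^+ 2
  + \sum_(j < N) zr (ref_grady N M r x y j) ^+ 2 :> R.
Proof.
by rewrite zr_zsum -big_split; apply: eq_bigr => j _; rewrite !zrE -!expr2.
Qed.

Lemma ref_strictP (E : Z) (u v : nat -> R) : (0 < N)%N -> ref_strict N E M r x y ->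
  zr E < Psi N%:R N (spread N id u) (spread N rho v).
Proof.
rewrite /ref_strict => N0; set c := Z.sub _ _; case: ifP => // c0.
rewrite -(@zr_lt R) !zrM zr2 zrB !zrM zr_nat => h.
have cE : zr c = n ^+ 2 - zr (ref_max N M r x y).
  by rewrite /c zrB !zrM zr_nat /n; congr (_ - _); ring.
have := ref_bound u v; rewrite /= -cE.
set A := 8 * _ + _; set B := 8 * _ + _ => hb.
have hA := @gradient_bound R N (fun j => zr M * u j - zr (look x j))
  (fun j => zr (ref_gradx N M r x y j)) (zr c) ref_gradx_sum.
have hB := @gradient_bound R N (fun j => zr M * v j - zr (look y j))
  (fun j => zr (ref_grady N M r x y j)) (zr c) ref_grady_sum.
rewrite -/A in hA; rewrite -/B in hB.
have c0' : 0 < zr c :> R by rewrite -(zr0 R) zr_lt.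
(* [c > 0] and [ref_max >= 0] force [n2 > 0]. *)
have M0 : (M != Z0).
  apply/eqP => M0; have : Z.leb Z0 (ref_max N M r x y) by apply: zmax_ge0.
  by move: c0; rewrite /c; move: (ref_max N M r x y) => m; rewrite M0; lia.
have m4 : 0 < zr M ^+ 4 :> R.
  by rewrite exprn_even_gt0//= -(zr0 R) /zr intr_eq0 -[_ == _](inj_eq (can_inj int_of_ZK)) in M0 *.
rewrite -(ltr_pM2l m4); apply: lt_le_trans hb.
have Nc0 : 0 < N%:R * zr c :> R by rewrite mulr_gt0// ltr0n.
rewrite -subr_gt0 -(pmulr_rgt0 _ Nc0).
rewrite zr_ref_grad2 -subr_gt0 in h.
apply: lt_le_trans h _; rewrite -subr_ge0.
apply: le_trans (addr_ge0 hA hB) _.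
by rewrite le_eqVlt; apply/orP; left; apply/eqP; ring.
Qed.

End LeafSound.

Definition lattice_energy N g : Z :=
  Z.mul (Z.of_nat N) (zsum N (fun k =>
    let s := offset N k in let t := offset N ((g * k) %% N)%N in
    let s2 := Z.mul s s in let t2 := Z.mul t t in
    Z.add (Z.mul (Z.of_nat (N * N)) (Z.add s2 t2)) (Z.mul s2 t2))).

(** The inequality of [certificate_bound] solved for the slack: when [c_scale] is positive, a
    permutation of larger total slack has [Psi > E]. *)
Definition cert_budget N (C : cert) (E : Z) : Z :=
  Z.sub (Z.mul (c_scale C) E)
    (Z.add (Z.mul (Z.of_nat N) (Z.mul 2 (zsum N (fun k => look (c_al C) (fold_idx N k)))))
       (Z.mul (c_scale C) (Z.mul (Z.mul 2 (Z.of_nat (N * N * N)))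
          (zsum N (fun k => Z.mul (offset N k) (offset N k)))))).

(* The first generator provides the energy to be matched.  Without a certificate
   every permutation fixing 0 is examined. *)
Definition check_optimal N (gens : seq nat) (C : option cert) : bool :=
  let E := lattice_energy N (head 1%N gens) in
  let leaf := leaf_ok N E gens in
  if C is Some C then
    let w := c_slack C in
    [&& check_cert N C, Z.ltb Z0 (c_scale C), all (all (Z.leb Z0)) w,
        Z.eqb (look2 w 0 0) Z0
      & search N w (cert_budget N C E) leaf N.-1 [:: 0%N] Z0]
  else search N [::] Z0 leaf N.-1 [:: 0%N] Z0.

(** * Soundness of the search *)

Section Soundness.
Variable R : realFieldType.

Lemma zr_added_cost N w d v (s : seq nat) :
  zr (added_cost N w d v (rev s)) =
  \sum_(j < size s) zr (weight N w (d + ((size s).-1 - j)) (dist_nat v (nth 0%N s j))) :> R.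
Proof.
elim/last_ind: s d => [|s a IH] d; first by rewrite big_ord0.
rewrite rev_rcons size_rcons /= zrD IH big_ord_recr /= subnn addn0 [LHS]addrC.
rewrite nth_rcons ltnn eqxx; congr (_ + _); apply: eq_bigr => j _.
by rewrite nth_rcons ltn_ord; congr (zr (weight _ _ _ _)); have := ltn_ord j; lia.
Qed.

Lemma zr_total_cost N w (s : seq nat) :
  zr (total_cost N w (rev s)) =
  \sum_(i < size s) \sum_(j < i) zr (weight N w (i - j) (dist_nat (nth 0%N s i) (nth 0%N s j))) :> R.
Proof.
elim/last_ind: s => [|s a IH]; first by rewrite big_ord0.
rewrite rev_rcons size_rcons /= zrD IH zr_added_cost big_ord_recr /= [LHS]addrC.
congr (_ + _).
  apply: eq_bigr => i _; apply: eq_bigr => j _; rewrite !nth_rcons ltn_ord.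
  by rewrite (ltn_trans (ltn_ord j) (ltn_ord i)).
apply: eq_bigr => j _; rewrite !nth_rcons ltnn eqxx ltn_ord.
by congr (zr (weight _ _ _ _)); have := ltn_ord j; lia.
Qed.

Lemma sum_symmetric N (f : nat -> nat -> R) :
  (forall i, f i i = 0) ->
  (forall i j, (i < N)%N -> (j < N)%N -> f i j = f j i) ->
  \sum_(i < N) \sum_(j < N) f i j = 2 * \sum_(i < N) \sum_(j < i) f i j.
Proof.
move=> f0; elim: N => [|n IH] fs; first by rewrite !big_ord0 mulr0.
rewrite !big_ord_recr /= f0 addr0.
under eq_bigr => i _ do rewrite big_ord_recr /=.
rewrite big_split /= IH; last by move=> i j iN jN; apply: fs; lia.
rewrite -!addrA [in LHS](eq_bigr (fun j : 'I_n => f n j)); last first.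
  by move=> i _; apply: fs => //; apply: ltnW; rewrite ltnS.
ring.
Qed.

(** Folded gaps are folded distances, so the slack is symmetric in the two points; it vanishes on
    the diagonal, and the full double sum is twice the cost accumulated by the search. *)
Lemma zr_slack_sum N w (s : seq nat) : size s = N -> perm_fun N (nth 0%N s) ->
  look2 w 0 0 = Z0 ->
  \sum_(i < N) \sum_(j < N) zr (look2 w (fold_idx N (gap N i j))
     (fold_idx N (gap N (nth 0%N s i) (nth 0%N s j)))) =
  2 * zr (total_cost N w (rev s)) :> R.
Proof.
move=> sN /perm_funP[_ hs] w0.
have e i j : (i < N)%N -> (j < N)%N -> look2 w (fold_idx N (gap N i j))
     (fold_idx N (gap N (nth 0%N s i) (nth 0%N s j))) =
   weight N w (dist_nat i j) (dist_nat (nth 0%N s i) (nth 0%N s j)).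
  by move=> iN jN; rewrite !fold_gap// hs.
under eq_bigr => i _ do under eq_bigr => j _ do rewrite e//.
rewrite (@sum_symmetric N (fun i j => zr (weight N w (dist_nat i j) (dist_nat (nth 0%N s i) (nth 0%N s j))))).
- rewrite zr_total_cost sN; congr (_ * _); apply: eq_bigr => i _; apply: eq_bigr => j _.
  by rewrite /dist_nat; congr (zr (weight _ _ _ _)); have := ltn_ord j; lia.
- by move=> i; rewrite !dist_natxx /weight /fold_idx min0n w0 zr0.
- by move=> i j _ _; rewrite (dist_natC i) (dist_natC (nth _ _ i)).
Qed.

Lemma spread_shift N rho (x : nat -> R) c i j :
  spread N rho (fun i => x i - c) i j = spread N rho x i j.
Proof. by rewrite /spread; congr (_ + _ * _); ring. Qed.

Lemma cert_optimal N (C : cert) (E : Z) (s : seq nat) (u v : nat -> R) :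
  check_cert N C -> Z.ltb Z0 (c_scale C) -> look2 (c_slack C) 0 0 = Z0 ->
  size s = N -> perm_fun N (nth 0%N s) ->
  Z.ltb (cert_budget N C E)
     (Z.add (total_cost N (c_slack C) (rev s)) (total_cost N (c_slack C) (rev s))) ->
  zr E < Psi N%:R N (spread N id u) (spread N (nth 0%N s) v).
Proof.
move=> hC L0 w0 sN hs; rewrite -(@zr_lt R) zrD => hb.
have N0 : (0 < N)%N by case/and3P: hC.
have L0' : 0 < zr (c_scale C) :> R by rewrite -(zr0 R) zr_lt.
have nz : N%:R != 0 :> R by rewrite pnatr_eq0 -lt0n.
(* The certificate asks for centred displacements; subtracting the means changes no spread. *)
pose mu := (\sum_(i < N) u i) / N%:R; pose mv := (\sum_(i < N) v i) / N%:R.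
have mean0 (x : nat -> R) : \sum_(i < N) (x i - (\sum_(i < N) x i) / N%:R) = 0.
  by rewrite sumrB sumr_const card_ord -[X in _ - X]mulr_natr divfK// subrr.
have := @check_certP R N C (nth 0%N s) (fun i => u i - mu) (fun i => v i - mv)
  hC hs (mean0 u) (mean0 v).
have -> : Psi N%:R N (spread N id (fun i => u i - mu)) (spread N (nth 0%N s) (fun i => v i - mv))
   = Psi N%:R N (spread N id u) (spread N (nth 0%N s) v).
  by apply: eq_bigr => i _; apply: eq_bigr => j _; rewrite !spread_shift.
rewrite /cert_slack zr_slack_sum// => h.
rewrite -(ltr_pM2l L0'); apply: lt_le_trans h.
move: hb; rewrite /cert_budget !zrE !zr_zsum !zr_nat !natrM => hb.
rewrite -subr_gt0; move: hb; rewrite -subr_gt0 => hb; apply: lt_le_trans hb _.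
under [\sum_(i < N) zr (Z.mul _ _)]eq_bigr => i _ do rewrite zrM -expr2.
rewrite /cert_fun le_eqVlt; apply/orP; left; apply/eqP; ring.
Qed.

(** With zero gradient at the grid the tangent bound is [E] plus a positive multiple of the sums of
    [(u j - u i)^2] and [(v j - v i)^2], so equality forces constant displacements. *)
Lemma critical_optimal N (E : Z) (s : seq nat) (u v : nat -> R) :
  perm_fun N (nth 0%N s) -> ref_critical N E (Zpos xH) s [::] [::] ->
  zr E <= Psi N%:R N (spread N id u) (spread N (nth 0%N s) v) /\
  (Psi N%:R N (spread N id u) (spread N (nth 0%N s) v) <= zr E ->
   forall i j, (i < N)%N -> (j < N)%N -> u i = u j /\ v i = v j).
Proof.
move=> hs /and3P[/Z.eqb_spec hE /Z.eqb_spec hg]; rewrite -(@zr_lt R) zr0 => c0.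
have := zr_ref_grad2 R N (Zpos xH) s [::] [::]; rewrite hg zr0 => /esym/eqP.
rewrite paddr_eq0 ?sumr_ge0// => [|? _|? _]; rewrite ?sqr_ge0//.
rewrite !psumr_eq0 => [|? _|? _]; rewrite ?sqr_ge0// => /andP[/allP gx /allP gy].
have := ref_bound (Zpos xH) [::] [::] hs u v.
have nn k : look [::] k = Z0 by rewrite /look nth_nil.
rewrite hE /= zr1 expr1n !mul1r.
move: c0; rewrite !zrE !zr_nat !mul1r -expr2 => c0.
rewrite [\sum_(j < N) _ * zr (ref_gradx _ _ _ _ _ _)]big1 => [|i _]; last first.
  by have := gx i (mem_index_enum _); rewrite sqrf_eq0 => /eqP ->; rewrite mulr0.
rewrite [\sum_(j < N) _ * zr (ref_grady _ _ _ _ _ _)]big1 => [|i _]; last first.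
  by have := gy i (mem_index_enum _); rewrite sqrf_eq0 => /eqP ->; rewrite mulr0.
rewrite mulr0 !add0r; set c := 4 * _.
have {}c0 : 0 < c by rewrite mulr_gt0.
pose a i := zr (Zpos xH) * u i - zr (look [::] i); pose b i := zr (Zpos xH) * v i - zr (look [::] i).
rewrite -/a -/b.
have aE i : a i = u i by rewrite /a zr1 mul1r nn zr0 subr0.
have bE i : b i = v i by rewrite /b zr1 mul1r nn zr0 subr0.
set A := \sum_(i < N) _; set B := \sum_(i < N) _ => h.
have A0 : 0 <= A by do 2!apply: sumr_ge0 => ? _; apply: sqr_ge0.
have B0 : 0 <= B by do 2!apply: sumr_ge0 => ? _; apply: sqr_ge0.
split; first by apply: le_trans h; rewrite -addrA lerDl addr_ge0// mulr_ge0// ltW.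
move=> hle i j iN jN; have := le_trans h hle.
rewrite -addrA gerDl -mulrDr pmulr_rle0// => AB.
have sq0 (x : nat -> R) : \sum_(i < N) \sum_(j < N) (x j - x i) ^+ 2 <= 0 -> x i = x j.
  move=> x0; have x0' : \sum_(i < N) \sum_(j < N) (x j - x i) ^+ 2 == 0.
    by rewrite eq_le x0 /=; do 2!apply: sumr_ge0 => ? _; apply: sqr_ge0.
  move: x0'; rewrite psumr_eq0 => [/allP /(_ (Ordinal iN) (mem_index_enum _))/=|k _].
    rewrite psumr_eq0 => [/allP /(_ (Ordinal jN) (mem_index_enum _))/=|k _].
      by rewrite sqrf_eq0 subr_eq0 => /eqP.
    exact: sqr_ge0.
  by apply: sumr_ge0 => ? _; apply: sqr_ge0.
rewrite -!aE -!bE; split; apply: sq0.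
  by apply: le_trans AB; rewrite lerDl.
by apply: le_trans AB; rewrite lerDr.
Qed.

Lemma descend_optimal fuel N (E : Z) (M : Z) (s : seq nat) x y (u v : nat -> R) :
  (0 < N)%N -> perm_fun N (nth 0%N s) -> descend N E fuel M s x y ->
  zr E < Psi N%:R N (spread N id u) (spread N (nth 0%N s) v).
Proof.
move=> N0 hs; elim: fuel x y => [|f IH] x y /=.
  by case: ifP => // h _; apply: (@ref_strictP R N M s x y hs E u v N0 h).
by case: ifP => [h _|_ /IH//]; apply: (@ref_strictP R N M s x y hs E u v N0 h).
Qed.

Theorem check_optimalP N gens C (s : seq nat) (u v : nat -> R) :
  (0 < N)%N -> check_optimal N gens C -> perm_eq s (iota 0 N) -> nth 0%N s 0 = 0%N ->
  let E := zr (lattice_energy N (head 1%N gens)) in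
  E <= Psi N%:R N (spread N id u) (spread N (nth 0%N s) v) /\
  (Psi N%:R N (spread N id u) (spread N (nth 0%N s) v) <= E ->
   (exists2 g, g \in gens & s = linear_perm N g) /\
   forall i j, (i < N)%N -> (j < N)%N -> u i = u j /\ v i = v j).
Proof.
move=> N0 hC ps s0; set E0 := lattice_energy _ _; move=> E.
have sN : size s = N by rewrite (perm_size ps) size_iota.
have hs : perm_fun N (nth 0%N s).
  by rewrite /perm_fun -sN map_nth_iota0// take_size sN.
have us : uniq s by rewrite (perm_uniq ps) iota_uniq.
have as_ : all (fun v => (v < N)%N) s.
  by apply/allP => k; rewrite (perm_mem ps) mem_iota.
have gt_case : E < Psi N%:R N (spread N id u) (spread N (nth 0%N s) v) ->
  E <= Psi N%:R N (spread N id u) (spread N (nth 0%N s) v) /\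
  (Psi N%:R N (spread N id u) (spread N (nth 0%N s) v) <= E ->
   (exists2 g, g \in gens & s = linear_perm N g) /\
   forall i j, (i < N)%N -> (j < N)%N -> u i = u j /\ v i = v j).
  by move=> h; split; [exact: ltW|rewrite leNgt h].
have leaf_case : leaf_ok N E0 gens s ->
  E <= Psi N%:R N (spread N id u) (spread N (nth 0%N s) v) /\
  (Psi N%:R N (spread N id u) (spread N (nth 0%N s) v) <= E ->
   (exists2 g, g \in gens & s = linear_perm N g) /\
   forall i j, (i < N)%N -> (j < N)%N -> u i = u j /\ v i = v j).
  rewrite /leaf_ok; case: ifP => [/hasP[g hg /eqP sg]|_] h.
    have [h1 h2] := critical_optimal u v hs h.
    by split=> // h3; split; [exists g|exact: h2].
  exact/gt_case/(descend_optimal _ _ N0 hs h).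
case: s s0 ps sN hs us as_ gt_case leaf_case => [|a s] /=; first by move=> _ _ sN; rewrite -sN in N0.
move=> -> ps [sN] hs /andP[s0 us] as_ gt_case leaf_case.
have srch w b : (forall k l, Z.leb Z0 (weight N w k l)) ->
    search N w b (leaf_ok N E0 gens) N.-1 [:: 0%N] Z0 ->
    leaf_ok N E0 gens (0%N :: s) \/
    Z.ltb b (Z.add (total_cost N w (rev (0%N :: s))) (total_cost N w (rev (0%N :: s)))).
  move=> w0 hsr; have hu : uniq (rev s ++ [:: 0%N]).
    by rewrite cats1 -rev_cons rev_uniq /= s0.
  have ha : all (fun v => (v < N)%N) (rev s) by rewrite all_rev; case/andP: as_.
  have sz : size (rev s) = N.-1 by rewrite size_rev -sN.
  have := @searchP N w b (leaf_ok N E0 gens) w0 N.-1 [:: 0%N] (rev s) hsr sz hu ha.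
  by rewrite cats1 -rev_cons revK.
case: C hC => [C|] /=.
  move=> /and5P[hC L0 /allP hw /Z.eqb_spec w0 hsr].
  have wpos k l : Z.leb Z0 (weight N (c_slack C) k l).
    rewrite /weight /look2.
    have [kl|kl] := ltnP (fold_idx N k) (size (c_slack C)); last first.
      by rewrite [nth [::] _ _]nth_default// nth_nil.
    have /allP hr := hw _ (mem_nth [::] kl).
    have [ll|ll] := ltnP (fold_idx N l) (size (nth [::] (c_slack C) (fold_idx N k))).
      exact/hr/mem_nth.
    by rewrite nth_default.
  have [|hb] := srch _ _ wpos hsr; first exact: leaf_case.
  by apply: gt_case; apply: (@cert_optimal N C E0 (0%N :: s)) => //=; rewrite sN.
move=> hsr.
(* Without a certificate all costs and the budget are 0, so no prefix is ever discarded. *)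
have tot0 q : total_cost N [::] q = Z0.
  have w0 k l : weight N [::] k l = Z0 by rewrite /weight /look2 !nth_nil.
  have a0 d x p : added_cost N [::] d x p = Z0 by elim: p d => //= w p IH d; rewrite w0 IH.
  by elim: q => //= x q ->; rewrite a0.
have wpos k l : Z.leb Z0 (weight N [::] k l) by rewrite /weight /look2 !nth_nil.
by have [|] := srch _ _ wpos hsr; [exact: leaf_case|rewrite tot0].
Qed.

End Soundness.

(* The certificates are rounded numerical solutions of the dual semidefinite
   programs. *)
Definition cert8 : cert := (Cert (1024) (-539367)
  [:: 1894983; 415184; 138360; -87649; -173076]
  [:: 0; -283344; -282105; -149022; 0]
  [:: -257467; -11594; 64840; 68668; 13639]
  [:: -307959; 18034; 62206; 92167; -36855]
  [:: [:: 0; 0; 0; 0; 0];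
     [:: 0; 21601; 5200; 248; 4594];
     [:: 0; 5203; 2; 4490; 25554];
     [:: 0; 248; 4496; 10698; 8857];
     [:: 0; 4623; 25557; 8863; 4]]
  [:: [:: Table false false
    [:: [:: 301; 64; -22; -124; -136];
     [:: 64; 85; 12; -83; -93];
     [:: -22; 12; -30; 18; 22];
     [:: -124; -83; 18; 80; 93];
     [:: -136; -93; 22; 93; 94]];
   Table true false
    [:: [:: 0; 0; 0; 0; 0];
     [:: 165; 101; 41; -143; -162];
     [:: 135; 131; -75; -64; -117];
     [:: -1; 19; 4; 9; -63];
     [:: 0; 0; 0; 0; 0]];
   Table false true
    [:: [:: 0; 165; 135; -1; 0];
     [:: 0; 101; 131; 19; 0];
     [:: 0; 41; -75; 4; 0];
     [:: 0; -143; -64; 9; 0];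
     [:: 0; -162; -117; -63; 0]]];
  [:: Table false false [::];
   Table false false
    [:: [:: 1066; -20; 43; -48; 36];
     [:: -20; 47; -9; -33; -14];
     [:: 46; -4; -11; -43; -60];
     [:: -50; -30; -28; -36; -37];
     [:: 46; -36; -48; -43; 9]];
   Table true true
    [:: [:: 0; 0; 0; 0; 0];
     [:: 0; 82; 18; -12; 0];
     [:: 0; 17; 63; 31; 0];
     [:: 0; -12; 30; 49; 0];
     [:: 0; 0; 0; 0; 0]]];
  [:: Table false false [::]; Table false false [::];
   Table false false
    [:: [:: 1035; -30; 58; -39; 52];
     [:: -30; 38; -4; -22; -24];
     [:: 55; -9; -23; -28; -37];
     [:: -38; -24; -42; -45; -55];
     [:: 42; -2; -49; -48; -18]]]])%ZZ.

Definition cert12 : cert := (Cert (65536) (-73473788)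
  [:: 569676391; 202670587; 120694470; 42742051; -16639035; -51796916; -63183778]
  [:: 0; -78564526; -94579422; -71141233; -47979055; -22954282; 0]
  [:: -64618131; -25287967; 9949103; 11905195; 15524659; 12585615; 15264921]
  [:: -90804310; 6336464; 9563799; 7199689; 14533891; 13228942; -10921260]
  [:: [:: 0; 0; 0; 0; 0; 0; 0];
     [:: 0; 2220366; 1824547; 34798; 3; 1836; 202];
     [:: 0; 1824755; 7037; 3; 2141192; 1283898; 1028769];
     [:: 0; 34629; 7; 9329; 388607; 41626; 21915];
     [:: 0; 2; 2140876; 388547; 20080; 17684; 13929];
     [:: 0; 1834; 1284078; 41797; 17683; 30430; 21845];
     [:: 0; 198; 1028792; 21860; 13929; 21848; 82880]]
  [:: [:: Table false false
    [:: [:: 5773; 2752; 701; -1290; -2079; -2016; -1908];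
     [:: 2752; 1746; 987; -100; -1129; -1831; -2100];
     [:: 701; 987; -197; -609; -333; -143; -109];
     [:: -1290; -100; -609; -144; 457; 693; 694];
     [:: -2079; -1129; -333; 457; 757; 847; 883];
     [:: -2016; -1831; -143; 693; 847; 933; 1018];
     [:: -1908; -2100; -109; 694; 883; 1018; 1134]];
   Table true false
    [:: [:: 0; 0; 0; 0; 0; 0; 0];
     [:: 2939; 2013; 852; 693; 481; -3768; -3481];
     [:: 2879; 2269; -328; -803; -979; -1374; -449];
     [:: 1800; 1033; -1936; -533; 197; -170; 1018];
     [:: 615; 1586; -751; 174; -371; -946; 0];
     [:: 1378; -426; -602; -179; 1514; -975; -42];
     [:: 0; 0; 0; 0; 0; 0; 0]];
   Table false true
    [:: [:: 0; 2939; 2879; 1800; 615; 1378; 0];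
     [:: 0; 2013; 2269; 1033; 1586; -426; 0];
     [:: 0; 852; -328; -1936; -751; -602; 0];
     [:: 0; 693; -803; -533; 174; -179; 0];
     [:: 0; 481; -979; 197; -371; 1514; 0];
     [:: 0; -3768; -1374; -170; -946; -975; 0];
     [:: 0; -3481; -449; 1018; 0; -42; 0]]];
  [:: Table false false [::];
   Table false false
    [:: [:: 10920; 721; 659; -219; 73; -954; -481];
     [:: 481; 229; -70; 955; -202; -379; -795];
     [:: 1010; 67; -48; -422; -610; -575; -509];
     [:: -191; -100; 74; 68; -175; -403; 839];
     [:: 551; 374; -154; 341; -265; -348; -130];
     [:: -793; -223; -221; 359; -444; -140; 187];
     [:: -65; -350; -509; -473; -126; -269; 465]];
   Table true true
    [:: [:: 0; 0; 0; 0; 0; 0; 0];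
     [:: 0; 1531; 422; 1016; 627; 439; 0];
     [:: 0; 498; -104; 512; 463; 259; 0];
     [:: 0; 1092; 554; 330; -196; 633; 0];
     [:: 0; 517; 596; -216; -80; 366; 0];
     [:: 0; 349; 541; 697; 269; 585; 0];
     [:: 0; 0; 0; 0; 0; 0; 0]]];
  [:: Table false false [::]; Table false false [::];
   Table false false
    [:: [:: 9227; -130; 950; -160; 943; -213; 965];
     [:: 101; 4; 67; -145; 442; 48; 135];
     [:: 585; -98; 2; 175; -275; -295; -291];
     [:: -138; 887; -356; 248; 236; 247; -476];
     [:: 478; -167; -751; -234; -242; -420; -294];
     [:: -413; -86; -642; -536; -310; -300; -751];
     [:: 551; -199; -264; 723; -324; -293; -666]]]])%ZZ.

Definition cert13 : cert := (Cert (4096) (-5869884)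
  [:: 48379969; 18391563; 11663133; 5023070; -107138; -3649780; -5445280]
  [:: 0; -6303664; -7343901; -5869907; -4382224; -2673680; -916294]
  [:: -5765790; -1068612; 564382; 619346; 841993; 913510; 1012276]
  [:: -5765786; -88435; 222023; 546299; 744934; 794455; 663617]
  [:: [:: 0; 0; 0; 0; 0; 0; 0];
     [:: 0; 537719; 310212; 115065; 37474; 612; 17891];
     [:: 0; 310163; 39183; 3; 34814; 117461; 181584];
     [:: 0; 114718; 3; 38565; 89339; 111940; 70889];
     [:: 0; 37431; 34808; 89339; 65280; 38362; 2];
     [:: 0; 612; 117459; 111916; 38370; 61192; 44079];
     [:: 0; 17875; 181582; 70714; 2; 44073; 77586]]
  [:: [:: Table false false
    [:: [:: 1835; 799; 266; -206; -468; -603; -706];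
     [:: 799; 640; 270; -49; -263; -473; -525];
     [:: 266; 270; 22; -178; -114; -71; -61];
     [:: -206; -49; -178; -30; 68; 132; 161];
     [:: -468; -263; -114; 68; 146; 197; 200];
     [:: -603; -473; -71; 132; 197; 242; 275];
     [:: -706; -525; -61; 161; 200; 275; 303]];
   Table true false
    [:: [:: 0; 0; 0; 0; 0; 0; 0];
     [:: 727; 558; 347; 68; -60; -529; -748];
     [:: 652; 476; 287; -227; -314; -259; -288];
     [:: 224; 184; -103; -60; -52; 18; -99];
     [:: 216; 231; -21; -56; -61; -70; -131];
     [:: 197; 130; -28; -104; -78; -9; -10];
     [:: 76; -2; -63; -12; 1; 3; 35]];
   Table false true
    [:: [:: 0; 727; 652; 224; 216; 197; 76];
     [:: 0; 558; 476; 184; 231; 130; -2];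
     [:: 0; 347; 287; -103; -21; -28; -63];
     [:: 0; 68; -227; -60; -56; -104; -12];
     [:: 0; -60; -314; -52; -61; -78; 1];
     [:: 0; -529; -259; 18; -70; -9; 3];
     [:: 0; -748; -288; -99; -131; -10; 35]]];
  [:: Table false false [::];
   Table false false
    [:: [:: 4161; 174; 106; 66; 18; 1; -4];
     [:: 156; 120; 21; 24; -31; -45; 26];
     [:: 109; 28; 27; -71; -91; -105; -109];
     [:: 64; 25; -35; 21; -92; -124; -108];
     [:: 34; 24; -56; -67; -9; -87; -96];
     [:: 35; -9; -29; -56; -74; -50; -104];
     [:: 35; -7; -32; -54; -69; -88; -55]];
   Table true true
    [:: [:: 0; 0; 0; 0; 0; 0; 0];
     [:: 0; 321; 98; 79; 31; -27; 17];
     [:: 0; 94; 179; 63; 77; 59; 32];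
     [:: 0; 74; 58; 136; 19; 50; 33];
     [:: 0; 25; 64; 14; 14; -10; 11];
     [:: 0; -35; 41; 43; -12; 64; 15];
     [:: 0; 14; 25; 29; 10; 12; 5]]];
  [:: Table false false [::]; Table false false [::];
   Table false false
    [:: [:: 4051; 108; 107; 76; 68; 66; 64];
     [:: 127; 77; 17; 33; 38; 18; 22];
     [:: 106; 11; 10; -38; -52; -20; -15];
     [:: 80; 33; -72; 17; -67; -62; -59];
     [:: 53; -16; -87; -92; -23; -85; -82];
     [:: 30; -19; -96; -129; -97; -69; -105];
     [:: 22; 53; -92; -112; -108; -121; -81]]]])%ZZ.

(** * Reduction to sorted configurations *)

Section Mod1.
Variable R : realType.
Implicit Types x y c : R.

Lemma mod1_itv x : 0 <= mod1 x < 1.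
Proof.
rewrite /mod1 subr_ge0 floor_le ltrBlDl.
by have := floorD1_gt x; rewrite intrD.
Qed.

Lemma mod1_eq x : exists m : int, mod1 x = x + m%:~R.
Proof. by exists (- Num.floor x); rewrite /mod1 rmorphN. Qed.

Lemma mod1_unique x y (m : int) : 0 <= y < 1 -> y = x + m%:~R -> mod1 x = y.
Proof.
move=> /andP[y0 y1] e; rewrite /mod1 e.
suff -> : Num.floor x = - m by rewrite rmorphN opprK.
apply: floor_def; rewrite [(- m + 1)%:~R]rmorphD rmorphN /=; lra.
Qed.

Lemma mod1_small x : 0 <= x < 1 -> mod1 x = x.
Proof. by move=> h; apply: (@mod1_unique _ _ 0) => //; rewrite addr0. Qed.

Lemma mod1D x c : mod1 (mod1 x + c) = mod1 (x + c).
Proof.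
have [m em] := mod1_eq x; have [k ek] := mod1_eq (x + c).
apply: (@mod1_unique _ _ (k - m)); first exact: mod1_itv.
by rewrite ek em rmorphB /=; ring.
Qed.

Lemma mod1K x c : 0 <= x < 1 -> mod1 (mod1 (x - c) + c) = x.
Proof. by move=> h; rewrite mod1D subrK mod1_small. Qed.

(** A common shift changes the difference [d] by -1, 0 or 1. If it changes, the new absolute value
    is [1 - |d|], which only flips the sign inside the square. *)
Lemma mod1_dist x y c : 0 <= x < 1 -> 0 <= y < 1 ->
  (2 * `|mod1 (x + c) - mod1 (y + c)| - 1) ^+ 2 = (2 * `|x - y| - 1) ^+ 2.
Proof.
move=> /andP[x0 x1] /andP[y0 y1].
have [m em] := mod1_eq (x + c); have [k ek] := mod1_eq (y + c).
have := mod1_itv (x + c); have := mod1_itv (y + c); rewrite em ek.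
set d := m - k; have -> : x + c + m%:~R - (y + c + k%:~R) = x - y + d%:~R.
  by rewrite /d rmorphB /=; ring.
move=> /andP[h1 h2] /andP[h3 h4].
have d1 : (d%:~R : R) < 2 by rewrite /d rmorphB /=; lra.
have d2 : -2 < (d%:~R : R) by rewrite /d rmorphB /=; lra.
have {}d1 : d < 2 by rewrite -(ltr_int R).
have {}d2 : - 2 < d by rewrite -(ltr_int R).
have dd : x - y + d%:~R = x + c + m%:~R - (y + c + k%:~R).
  by rewrite /d rmorphB /=; ring.
have : [\/ d = -1, d = 0 | d = 1].
  have [e|[e|e]] : d = -1 \/ d = 0 \/ d = 1 by lia.
  - by constructor 1.
  - by constructor 2.
  - by constructor 3.
case=> e; rewrite e /= in dd *; last 2 first.
- by rewrite addr0.
- have xy : x - y <= 0 by lra.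
  have xy' : 0 <= x - y + 1 by lra.
  by rewrite (ler0_norm xy) (ger0_norm xy'); ring.
have xy : 0 <= x - y by lra.
have xy' : x - y - 1 <= 0 by lra.
by rewrite (ger0_norm xy) (ler0_norm xy'); ring.
Qed.

End Mod1.

Section Equivalence.
Variable R : realType.

Lemma torus_symmetry_comp (s t : R * R -> R * R) :
  torus_symmetry s -> torus_symmetry t -> torus_symmetry (s \o t).
Proof.
move=> hs ht; elim: hs => [//|c s' _ h|c s' _ h|s' _ h|s' _ h|s' _ h].
- exact: (TSshift1 c h).
- exact: (TSshift2 c h).
- exact: (TSreflect1 h).
- exact: (TSreflect2 h).
- exact: (TSswap h).
Qed.

Lemma same_points_refl N (P : 'I_N -> R * R) : same_points P P.
Proof. by exists 1%g => i; rewrite perm1. Qed.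

Lemma torus_equivalent_trans N (P Q S : 'I_N -> R * R) :
  torus_equivalent P Q -> torus_equivalent Q S -> torus_equivalent P S.
Proof.
move=> [s hs [p hp]] [t ht [q hq]]; exists (t \o s); first exact: torus_symmetry_comp.
by exists (q * p)%g => i; rewrite hq /= hp /= permM.
Qed.

Definition lattice N g : 'I_N -> R * R := fun i => lattice_point R N g i.
Arguments lattice : clear implicits.

Lemma mod1_ratio N (a : nat) : (0 < N)%N -> mod1 (a%:R / N%:R : R) = (a %% N)%N%:R / N%:R.
Proof.
move=> N0; have nz : N%:R != 0 :> R by rewrite pnatr_eq0 -lt0n.
apply: (@mod1_unique _ _ _ (- (a %/ N)%N%:Z)).
  by rewrite divr_ge0 //= ltr_pdivrMr ?ltr0n// mul1r ltr_nat ltn_pmod.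
rewrite [in a%:R / _](divn_eq a N) rmorphN /= natrD natrM mulrDl mulfK//.
by rewrite -pmulrn addrAC subrr add0r.
Qed.

Lemma latticeE N g (i : 'I_N) :
  lattice N g i = (i%:R / N%:R, ((i * g) %% N)%N%:R / N%:R).
Proof. by rewrite /lattice /lattice_point mod1_ratio//; case: i => ? /= ?; lia. Qed.

Lemma lattice_reflect N g : (g <= N)%N -> torus_equivalent (lattice N g) (lattice N (N - g)).
Proof.
move=> gN; exists (fun p => (p.1, mod1 (1 - p.2))); first exact: (TSreflect2 (TSid R)).
exists 1%g => i; rewrite perm1 /= !latticeE /=; congr (_, _).
have N0 : (0 < N)%N by case: i => ? /= ?; lia.
have nz : N%:R != 0 :> R by rewrite pnatr_eq0 -lt0n.
rewrite [mod1 (_ / _)]mod1_ratio//.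
have -> : 1 - ((i * g) %% N)%N%:R / N%:R = (N - (i * g) %% N)%N%:R / N%:R :> R.
  by rewrite natrB ?mulrBl ?divff// ltnW// ltn_pmod.
rewrite mod1_ratio//; congr (_%:R / _).
apply/eqP; rewrite -(eqn_modDr (i * g)%N) -mulnDr subnK// modnMl.
rewrite -modnDmr subnK ?modnn//; last by rewrite ltnW// ltn_pmod.
Qed.

(** Relabel the points by [i -> i g']: the second coordinate becomes [i / N], and the interchange
    produces the lattice of [g']. *)
Lemma lattice_swap N g g' : (g * g' = 1 %[mod N])%N ->
  torus_equivalent (lattice N g) (lattice N g').
Proof.
move=> gg; exists (fun p => (p.2, p.1)); first exact: (TSswap (TSid R)).
case: N gg => [|n] gg; first by exists 1%g => -[].
have key (i : nat) : ((((i * g') %% n.+1) * g) %% n.+1 = i %% n.+1)%N.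
  by rewrite modnMml -mulnA (mulnC g') -modnMmr gg modnMmr muln1.
pose f (i : 'I_n.+1) : 'I_n.+1 := inord ((i * g') %% n.+1).
have fi : injective f.
  move=> i j /(congr1 (@nat_of_ord _)); rewrite /f !inordK ?ltn_pmod// => h.
  apply/val_inj; have := congr1 (fun k => (k * g) %% n.+1)%N h.
  by rewrite /= !key !modn_small.
exists (perm fi) => i.
transitivity ((lattice n.+1 g (f i)).2, (lattice n.+1 g (f i)).1); last by rewrite permE.
have fE : f i = ((i * g') %% n.+1)%N :> nat by rewrite /f inordK ?ltn_pmod.
by rewrite !latticeE /= fE key [(i %% _)%N]modn_small.
Qed.

End Equivalence.
Arguments lattice R N g : clear implicits.

Section Sorting.
Variable R : realType.

Lemma sorting_perm n (f : 'I_n -> R) :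
  exists t : {perm 'I_n}, forall i j : 'I_n, (i <= j)%N -> f (t i) <= f (t j).
Proof.
case: n f => [|n] f; first by exists 1%g => -[].
pose r : rel 'I_n.+1 := fun a b => f a <= f b.
have rT : total r by move=> a b; apply: le_total.
have rt : transitive r by move=> a b c; apply: le_trans.
pose s := sort r (enum 'I_n.+1).
have sz : size s = n.+1 by rewrite size_sort size_enum_ord.
have us : uniq s by rewrite sort_uniq enum_uniq.
have gi : injective (fun i : 'I_n.+1 => nth ord0 s i).
  by move=> i j /eqP; rewrite nth_uniq ?sz// => /eqP/val_inj.
exists (perm gi) => i j ij; rewrite !permE.
have rr : reflexive r by move=> a; apply: lexx.
by apply: (sorted_leq_nth rt rr ord0 (sort_sorted rT _)) => //; rewrite inE sz.
Qed.

Lemma sorting_perm_min n (f : 'I_n.+1 -> R) i0 : (forall i, f i0 <= f i) ->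
  exists2 t : {perm 'I_n.+1}, t ord0 = i0 &
    forall i j : 'I_n.+1, (i <= j)%N -> f (t i) <= f (t j).
Proof.
(* Lowering one value breaks the ties, so that [i0] is sorted into first place. *)
move=> hi0; pose f' i := if i == i0 then f i0 - 1 else f i.
have [t ht] := sorting_perm f'.
have t0 i : (f' (t i) <= f' i0) -> t i = i0.
  rewrite /f' eqxx; case: eqP => // _ h; exfalso; have := hi0 (t i); lra.
have t00 : t ord0 = i0.
  by apply: t0; rewrite -[i0 in leRHS](permKV t) ht.
exists t => // i j ij; have := ht _ _ ij; rewrite /f'.
have [->|ni] := eqVneq (t i) i0; first by [].
have [->|nj] := eqVneq (t j) i0 => //; have := hi0 (t i); lra.
Qed.

End Sorting.

Section SpreadSum.
Variable R : realFieldType.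

Lemma sum_spread_sq N (rho : nat -> nat) (u : nat -> R) : perm_fun N rho ->
  \sum_(i < N) \sum_(j < N) spread N rho u i j ^+ 2 =
  N%:R * (\sum_(k < N) zr (offset N k) ^+ 2)
  + 4 * \sum_(i < N) \sum_(j < N) (u j - u i) ^+ 2.
Proof.
move=> hr; rewrite -(@sum_gap_const _ N rho (fun k => zr (offset N k) ^+ 2))//.
have h := sum_gap_diff (fun k => zr (offset N k)) u hr.
transitivity (\sum_(i < N) \sum_(j < N) zr (offset N (gap N (rho i) (rho j))) ^+ 2
  + 4 * (\sum_(i < N) \sum_(j < N) zr (offset N (gap N (rho i) (rho j))) * (u j - u i))
  + 4 * \sum_(i < N) \sum_(j < N) (u j - u i) ^+ 2); last by rewrite h mulr0 addr0.
rewrite !mulr_sumr -!big_split /=.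
apply: eq_bigr => i _; rewrite !mulr_sumr -!big_split /=; apply: eq_bigr => j _.
by rewrite /spread; ring.
Qed.

End SpreadSum.

(** * The energy of a point set in terms of spreads *)

Section Energy.
Variable R : realType.
Variables c0 c1 : R.

Definition pair_energy (p q : R * R) : R :=
  (c0 + c1 * (2 * `|p.1 - q.1| - 1) ^+ 2) * (c0 + c1 * (2 * `|p.2 - q.2| - 1) ^+ 2).

Definition energy N (P : 'I_N -> R * R) : R :=
  \sum_(i < N) \sum_(j < N) pair_energy (P i) (P j).

Lemma energy_perm N (P : 'I_N -> R * R) (t : {perm 'I_N}) :
  energy (fun i => P (t i)) = energy P.
Proof.
rewrite /energy [RHS](reindex_inj (@perm_inj _ t)); apply: eq_bigr => i _.
by rewrite [RHS](reindex_inj (@perm_inj _ t)).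
Qed.

(** Only the squares agree: when [rho j < rho i], the gap wraps around and the spread has the
    opposite sign. Coinciding coordinates are allowed, since the gap is decided by [rho]. *)
Lemma spread_sq N (rho : nat -> nat) (X u : nat -> R) i j :
  (0 < N)%N -> (rho i < N)%N -> (rho j < N)%N ->
  ((rho i <= rho j)%N -> X i <= X j) -> ((rho j <= rho i)%N -> X j <= X i) ->
  (forall k, u k = N%:R * X k - (rho k)%:R) ->
  spread N rho u i j ^+ 2 = (N%:R * (2 * `|X i - X j| - 1)) ^+ 2.
Proof.
move=> N0 iN jN hij hji hu; rewrite /spread gapE// /offset !zrE !zr_nat !hu.
have [ij|ij] := leqP (rho i) (rho j).
  rewrite ler0_norm ?subr_le0 ?hij// -mul2n natrM natrB//.
  by ring.
rewrite ger0_norm ?subr_ge0 ?hji ?(ltnW ij)// -mul2n natrM natrB; last by lia.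
by rewrite natrD; ring.
Qed.

(** The coefficient [c0 c1] of the degree-two part is split as [c1^2 + c1 (c0 - c1)], and its first
    half is absorbed into [Psi]. *)
Lemma energyE N (P : 'I_N -> R * R) (S T : nat -> nat -> R) :
  (forall i j : 'I_N, S i j ^+ 2 = (N%:R * (2 * `|(P i).1 - (P j).1| - 1)) ^+ 2) ->
  (forall i j : 'I_N, T i j ^+ 2 = (N%:R * (2 * `|(P i).2 - (P j).2| - 1)) ^+ 2) ->
  N%:R ^+ 4 * energy P = c0 ^+ 2 * N%:R ^+ 6 + c1 ^+ 2 * Psi N%:R N S T
    + c1 * (c0 - c1) * N%:R ^+ 2 * (\sum_(i < N) \sum_(j < N) S i j ^+ 2
       + \sum_(i < N) \sum_(j < N) T i j ^+ 2).
Proof.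
move=> hS hT.
have -> : c0 ^+ 2 * N%:R ^+ 6 = \sum_(i < N) \sum_(j < N) c0 ^+ 2 * N%:R ^+ 4.
  rewrite !sumr_const !card_ord -mulrnA -[RHS]mulr_natr natrM; ring.
rewrite /energy /Psi mulrDr !mulr_sumr -!big_split /=; apply: eq_bigr => i _.
rewrite !mulr_sumr -!big_split /=; apply: eq_bigr => j _.
by rewrite hS hT /pair_energy; ring.
Qed.

Lemma energy_translate N (P : 'I_N -> R * R) a b : in_torus2 P ->
  energy (fun i => (mod1 ((P i).1 + a), mod1 ((P i).2 + b))) = energy P.
Proof.
move=> hP; apply: eq_bigr => i _; apply: eq_bigr => j _.
have /andP[xi yi] := hP i; have /andP[xj yj] := hP j.
by rewrite /pair_energy /= !mod1_dist.
Qed.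

End Energy.

Section Optimal.
Variable R : realType.
Variables c0 c1 : R.
Hypotheses (c1_gt0 : 0 < c1) (c1_le : c1 <= c0).

Lemma nth_linear_perm N g i : (i < N)%N -> nth 0%N (linear_perm N g) i = ((g * i) %% N)%N.
Proof. by move=> iN; rewrite (nth_map 0%N) ?size_iota// nth_iota. Qed.

Lemma perm_fun_nth N s : perm_eq s (iota 0 N) -> perm_fun N (nth 0%N s).
Proof.
move=> ps; have sN : size s = N by rewrite (perm_size ps) size_iota.
by rewrite /perm_fun -{1}sN map_nth_iota0// take_size.
Qed.

Lemma gap_linear N g i j : (i < N)%N -> (j < N)%N ->
  gap N ((g * i) %% N)%N ((g * j) %% N)%N = ((g * gap N i j) %% N)%N.
Proof.
move=> iN jN; have N0 : (0 < N)%N by lia.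
have e a b : (a < N)%N -> (gap N a b + a = b %[mod N])%N.
  move=> aN; rewrite /gap modnDml subnK; last by lia.
  by rewrite modnDr.
apply/eqP; rewrite -(modn_small (gap_lt _ _ N0)) -(eqn_modDr ((g * i) %% N)%N).
rewrite e ?ltn_pmod// modn_mod modnDmr -mulnDr -[eqbRHS]modnMmr e// modnMmr.
exact: eqxx.
Qed.

Lemma Psi_linear N g : Psi N%:R N (spread N id (fun=> 0 : R))
    (spread N (nth 0%N (linear_perm N g)) (fun=> 0)) = zr (lattice_energy N g).
Proof.
pose F k := let s := offset N k in let t := offset N ((g * k) %% N)%N in
  let s2 := Z.mul s s in let t2 := Z.mul t t in
  Z.add (Z.mul (Z.of_nat (N * N)) (Z.add s2 t2)) (Z.mul s2 t2).
have -> : lattice_energy N g = Z.mul (Z.of_nat N) (zsum N F) by [].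
rewrite zrM zr_zsum zr_nat.
have e i j : (i < N)%N -> (j < N)%N ->
  gap N (nth 0%N (linear_perm N g) i) (nth 0%N (linear_perm N g) j) = ((g * gap N i j) %% N)%N.
  by move=> iN jN; rewrite !nth_linear_perm// gap_linear.
rewrite -(@sum_gap_const R N id (fun k => zr (F k)))//; last exact: perm_fun_id.
apply: eq_bigr => i _; apply: eq_bigr => j _; rewrite /F.
by rewrite /spread e// !(zrM, zrD) !zr_nat natrM subr0; ring.
Qed.

Lemma energy_lattice N g : (0 < N)%N -> perm_eq (linear_perm N g) (iota 0 N) ->
  N%:R ^+ 4 * energy c0 c1 (lattice R N g) = c0 ^+ 2 * N%:R ^+ 6
   + c1 ^+ 2 * zr (lattice_energy N g)
   + c1 * (c0 - c1) * N%:R ^+ 2 * (2 * (N%:R * \sum_(k < N) zr (offset N k) ^+ 2)).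
Proof.
move=> N0 ps; have hs := perm_fun_nth ps; have [_ sN] := perm_funP hs.
have nz : N%:R != 0 :> R by rewrite pnatr_eq0 -lt0n.
have Ngt : 0 < N%:R :> R by rewrite ltr0n.
rewrite (@energyE _ c0 c1 N (lattice R N g) (spread N id (fun=> 0 : R))
    (spread N (nth 0%N (linear_perm N g)) (fun=> 0))).
- rewrite Psi_linear !sum_spread_sq//; last exact: perm_fun_id.
  have -> : \sum_(i < N) \sum_(j < N) ((0 : R) - 0) ^+ 2 = 0.
    by rewrite big1// => i _; rewrite big1// => j _; rewrite subr0 expr0n.
  by ring.
- move=> i j; rewrite !latticeE /=.
  apply: (@spread_sq R N id (fun k => k%:R / N%:R)) => // [h|h|k].
  + by rewrite ler_pM2r ?invr_gt0// ler_nat.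
  + by rewrite ler_pM2r ?invr_gt0// ler_nat.
  + by rewrite mulrC divfK// subrr.
- have en (i : 'I_N) : ((i * g) %% N)%N = nth 0%N (linear_perm N g) i.
    by rewrite nth_linear_perm// mulnC.
  move=> i j; rewrite !latticeE /= !en.
  apply: (@spread_sq R N (nth 0%N (linear_perm N g)) (fun k => (nth 0%N (linear_perm N g) k)%:R / N%:R)) => //.
  + exact: sN.
  + exact: sN.
  + by move=> h; rewrite ler_pM2r ?invr_gt0// ler_nat.
  + by move=> h; rewrite ler_pM2r ?invr_gt0// ler_nat.
  + by move=> k; rewrite mulrC divfK// subrr.
Qed.

Lemma energy_sorted_optimal n gens C (Q : 'I_n.+1 -> R * R) :
  check_optimal n.+1 gens C -> perm_eq (linear_perm n.+1 (head 1%N gens)) (iota 0 n.+1) ->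
  in_torus2 Q -> Q ord0 = (0, 0) ->
  (forall i j : 'I_n.+1, (i <= j)%N -> (Q i).1 <= (Q j).1) ->
  energy c0 c1 (lattice R n.+1 (head 1%N gens)) <= energy c0 c1 Q /\
  (energy c0 c1 Q <= energy c0 c1 (lattice R n.+1 (head 1%N gens)) ->
   exists2 g, g \in gens & forall i, Q i = lattice R n.+1 g i).
Proof.
move=> hC hl hQ Q0 hsort; pose N := n.+1.
have Ngt : 0 < N%:R :> R by rewrite ltr0n.
have nz : N%:R != 0 :> R by rewrite gt_eqF.
have [k k0 hk] : exists2 k : {perm 'I_n.+1}, k ord0 = ord0 &
    forall i j : 'I_n.+1, (i <= j)%N -> (Q (k i)).2 <= (Q (k j)).2.
  apply: (sorting_perm_min (f := fun i => (Q i).2)) => i; rewrite Q0.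
  by have /andP[_ /andP[]] := hQ i.
(* [k] lists the points by second coordinate, so its inverse gives the rank of a point in that
   order. *)
pose s := [seq (k^-1%g (inord i) : nat) | i <- iota 0 N].
have sE (i : 'I_N) : nth 0%N s i = k^-1%g i.
  by rewrite (nth_map 0%N) ?size_iota// nth_iota// inord_val.
have sN i : (i < N)%N -> (nth 0%N s i < N)%N.
  by move=> iN; rewrite (sE (Ordinal iN)).
have ps : perm_eq s (iota 0 N).
  rewrite /s -/(perm_fun N (fun i => (k^-1%g (inord i) : nat))).
  apply: perm_fun_inj => // i j.
  rewrite !inE => iN jN /val_inj /perm_inj /(congr1 (@nat_of_ord _)).
  by rewrite !inordK.
have s0 : nth 0%N s 0 = 0%N by rewrite (sE ord0) -k0 permK.
pose X i := (Q (inord i)).1; pose Y i := (Q (inord i)).2.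
pose u i := N%:R * X i - i%:R; pose v i := N%:R * Y i - (nth 0%N s i)%:R.
have XE (i : 'I_N) : X i = (Q i).1 by rewrite /X inord_val.
have YE (i : 'I_N) : Y i = (Q i).2 by rewrite /Y inord_val.
have hs := perm_fun_nth ps.
have hY (i j : 'I_N) : (nth 0%N s i <= nth 0%N s j)%N -> (Q i).2 <= (Q j).2.
  by rewrite !sE => ij; rewrite -(permKV k i) -(permKV k j); apply: hk.
have hS (i j : 'I_N) : spread N id u i j ^+ 2 = (N%:R * (2 * `|(Q i).1 - (Q j).1| - 1)) ^+ 2.
  rewrite -!XE; apply: (@spread_sq R N id X u) => //; rewrite !XE; exact: hsort.
have hR (i j : 'I_N) :
    spread N (nth 0%N s) v i j ^+ 2 = (N%:R * (2 * `|(Q i).2 - (Q j).2| - 1)) ^+ 2.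
  rewrite -!YE; apply: (@spread_sq R N (nth 0%N s) Y v) => //; try exact: sN.
    by rewrite !YE; apply: hY.
  by rewrite !YE; apply: hY.
have hE := @energyE R c0 c1 N Q (spread N id u) (spread N (nth 0%N s) v) hS hR.
have [h1 h2] := check_optimalP u v (ltn0Sn n) hC ps s0.
have hL := energy_lattice (ltn0Sn n) hl.
have N4 : 0 < N%:R ^+ 4 :> R by rewrite exprn_gt0.
have N2 : 0 < N%:R ^+ 2 :> R by rewrite exprn_gt0.
have sqge (x : nat -> R) : 0 <= \sum_(i < N) \sum_(j < N) (x j - x i) ^+ 2.
  by do 2!apply: sumr_ge0 => ? _; apply: sqr_ge0.
have hc : 0 <= c1 * (c0 - c1) * N%:R ^+ 2.
  by apply: mulr_ge0; [apply: mulr_ge0; [apply: ltW|rewrite subr_ge0]|apply: ltW].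
have c12 : 0 < c1 ^+ 2 by rewrite exprn_gt0.
have hT : 2 * (N%:R * \sum_(k < N) zr (offset N k) ^+ 2) <=
   \sum_(i < N) \sum_(j < N) spread N id u i j ^+ 2
   + \sum_(i < N) \sum_(j < N) spread N (nth 0%N s) v i j ^+ 2 :> R.
  rewrite (sum_spread_sq u (perm_fun_id N)) (sum_spread_sq v hs).
  have := sqge u; have := sqge v; lra.
split.
  rewrite -(ler_pM2l N4) hE hL; apply: lerD; last exact: ler_wpM2l.
  by rewrite lerD2l ler_pM2l.
rewrite -(ler_pM2l N4) hE hL => hle.
have {}hle : Psi N%:R N (spread N id u) (spread N (nth 0%N s) v)
    <= zr (lattice_energy N (head 1%N gens)).
  rewrite -(ler_pM2l c12).
  rewrite -(lerD2l (c0 ^+ 2 * N%:R ^+ 6)).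
  rewrite -(lerD2r (c1 * (c0 - c1) * N%:R ^+ 2 * (2 * (N%:R * \sum_(k < N) zr (offset N k) ^+ 2)))).
  by apply: le_trans hle; rewrite lerD2l; apply: ler_wpM2l.
have [[g gg sg] huv] := h2 hle; exists g => // i.
(* The displacements are constant and vanish at the point moved to the origin, so every point lies
   on the grid. *)
have [ui vi] := huv i 0%N (ltn_ord i) (ltn0Sn n).
have i0 : (inord 0 : 'I_n.+1) = ord0 by apply/val_inj; rewrite /= inordK.
have u0 : u 0%N = 0 by rewrite /u /X i0 Q0 mulr0 subrr.
have v0 : v 0%N = 0 by rewrite /v /Y i0 Q0 s0 mulr0 subrr.
rewrite latticeE (mulnC i) -nth_linear_perm// -sg.
move: ui vi; rewrite u0 v0 /u /v XE YE => /eqP; rewrite subr_eq0 => /eqP ex /eqP.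
rewrite subr_eq0 => /eqP ey; rewrite -ex -ey [Q i]surjective_pairing.
by rewrite ![N%:R * _]mulrC !mulfK.
Qed.

(** Equivalence is stated in both directions, so that two minimizers can later be joined through a
    lattice without inverting a general torus symmetry. *)
Theorem energy_optimal N gens C (P : 'I_N -> R * R) :
  (0 < N)%N -> check_optimal N gens C ->
  perm_eq (linear_perm N (head 1%N gens)) (iota 0 N) -> in_torus2 P ->
  energy c0 c1 (lattice R N (head 1%N gens)) <= energy c0 c1 P /\
  (energy c0 c1 P <= energy c0 c1 (lattice R N (head 1%N gens)) ->
   exists g, [/\ g \in gens, torus_equivalent P (lattice R N g)
     & torus_equivalent (lattice R N g) P]).
Proof.
case: N P => // n P _ hC hl hP.
set a := (P ord0).1; set b := (P ord0).2.
pose P' (i : 'I_n.+1) := (mod1 ((P i).1 + - a), mod1 ((P i).2 + - b)).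
have P0 : P' ord0 = (0, 0) by rewrite /P' !subrr mod1_small ?lexx ?ltr01.
have hP' : in_torus2 P' by move=> i; rewrite !mod1_itv.
have [t t0 ht] : exists2 t : {perm 'I_n.+1}, t ord0 = ord0 &
    forall i j : 'I_n.+1, (i <= j)%N -> (P' (t i)).1 <= (P' (t j)).1.
  apply: (sorting_perm_min (f := fun i => (P' i).1)) => i; rewrite P0.
  by have /andP[/andP[]] := hP' i.
have := @energy_sorted_optimal n gens C (fun i => P' (t i)) hC hl.
rewrite (energy_perm c0 c1 P' t) (energy_translate c0 c1 (- a) (- b) hP) t0 P0.
move=> /(_ (fun i => hP' (t i)) erefl ht)[h1 h2]; split=> // /h2[g gg hg].
exists g; split=> //.
  exists (fun p => (mod1 (p.1 + - a), mod1 (p.2 + - b))).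
    exact: (TSshift1 (- a) (TSshift2 (- b) (TSid R))).
  by exists t => i; rewrite -hg.
exists (fun p => (mod1 (p.1 + a), mod1 (p.2 + b))).
  exact: (TSshift1 a (TSshift2 b (TSid R))).
exists t^-1%g => i.
transitivity (mod1 ((lattice R n.+1 g (t^-1%g i)).1 + a),
              mod1 ((lattice R n.+1 g (t^-1%g i)).2 + b)); last by [].
have /andP[xi yi] := hP i.
by rewrite -hg permKV /P' /= !mod1K//; case: (P i).
Qed.

End Optimal.

Local Open Scope classical_set_scope.
Local Open Scope ring_scope.

(** * Sobolev functions on the circle *)

Section UnitInterval.
Variable R : realType.
Implicit Types f g u v : R -> R.
Notation mu := (@lebesgue_measure R).

Definition integrable01 f := mu.-integrable (T01 R) (EFin \o f).

(* The real line carries two canonical measurable structures: that of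
   [measurableTypeR R], on which the Lebesgue measure lives, and that of the type
   [R] itself. *)
Lemma measurable_T01 : measurable (T01 R : set (measurableTypeR R)).
Proof. exact: measurable_itv. Qed.
Hint Resolve measurable_T01 : core.

Lemma measurable_T01R : measurable (T01 R).
Proof. exact: measurable_itv. Qed.
Hint Resolve measurable_T01R : core.

Lemma measure_T01 : mu (T01 R) = 1%:E.
Proof. by rewrite /T01 lebesgue_measure_itv /= lte_fin ltr01 oppr0 adde0. Qed.

Lemma int01D f g : integrable01 f -> integrable01 g ->
  int01 (fun x => f x + g x) = int01 f + int01 g.
Proof. exact: RintegralD. Qed.

Lemma int01B f g : integrable01 f -> integrable01 g ->
  int01 (fun x => f x - g x) = int01 f - int01 g.
Proof. exact: RintegralB. Qed.

Lemma int01Z c f : integrable01 f -> int01 (fun x => c * f x) = c * int01 f.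
Proof. exact: RintegralZl. Qed.

Lemma int01_cst c : int01 (fun=> c) = c :> R.
Proof.
rewrite /int01 Rintegral_cst//; transitivity (c * fine (1%:E : \bar R)); last exact: mulr1.
by congr (_ * fine _); exact: measure_T01.
Qed.

Lemma integrable01D f g : integrable01 f -> integrable01 g ->
  integrable01 (fun x => f x + g x).
Proof.
move=> hf hg; rewrite /integrable01.
by apply: eq_integrable (integrableD measurable_T01 hf hg) => // x _ /=; rewrite EFinD.
Qed.

Lemma integrable01Z c f : integrable01 f -> integrable01 (fun x => c * f x).
Proof.
move=> hf; rewrite /integrable01.
by apply: eq_integrable (integrableZl measurable_T01 c hf) => // x _ /=; rewrite EFinM.
Qed.

Lemma integrable01N f : integrable01 f -> integrable01 (fun x => - f x).
Proof.
by move=> hf; have := integrable01Z (-1) hf; under eq_fun do rewrite mulN1r.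
Qed.

Lemma integrable01B f g : integrable01 f -> integrable01 g ->
  integrable01 (fun x => f x - g x).
Proof. by move=> hf hg; apply: integrable01D => //; apply: integrable01N. Qed.

Lemma integrable01_sum (I : Type) (s : seq I) (F : I -> R -> R) :
  (forall i, integrable01 (F i)) -> integrable01 (fun x => \sum_(i <- s) F i x).
Proof.
move=> h; elim: s => [|i s IH].
  by under eq_fun do rewrite big_nil; apply: integrable0.
under eq_fun do rewrite big_cons.
exact: integrable01D.
Qed.

Lemma integrable01_bounded f C : measurable_fun (T01 R) f ->
  (forall x, T01 R x -> `|f x| <= C) -> integrable01 f.
Proof.
move=> mf hf; apply: measurable_bounded_integrable => //.
  exact: (eq_ind_r (fun z => z < +oo)%E (ltry 1) measure_T01).
exists C; split; first exact: num_real.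
by move=> D CD x xT; apply: le_trans (hf x xT) (ltW CD).
Qed.

Lemma integrable01_le f g : measurable_fun (T01 R) f -> integrable01 g ->
  (forall x, T01 R x -> `|f x| <= `|g x|) -> integrable01 f.
Proof.
move=> mf ig h; apply: (le_integrable measurable_T01 _ _ ig).
  exact/measurable_EFinP.
by move=> x xT /=; rewrite lee_fin; apply: h.
Qed.

Lemma integrable01_L2M f g : L2_01 f -> L2_01 g -> integrable01 (fun x => f x * g x).
Proof.
move=> [mf f2] [mg g2].
have h : integrable01 (fun x => f x ^+ 2 + g x ^+ 2) by apply: integrable01D.
apply: (integrable01_le _ h); first exact: measurable_funM.
move=> x _; rewrite normrM [leRHS]ger0_norm ?addr_ge0 ?sqr_ge0//.
rewrite -(real_normK (num_real (f x))) -(real_normK (num_real (g x))).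
have := sqr_ge0 (`|f x| - `|g x|); have := normr_ge0 (f x); have := normr_ge0 (g x).
nra.
Qed.

Lemma L2_bounded f C : measurable_fun (T01 R) f ->
  (forall x, T01 R x -> `|f x| <= C) -> L2_01 f.
Proof.
move=> mf h; split=> //; apply: (@integrable01_bounded _ (C ^+ 2)).
  exact: measurable_funX.
by move=> x xT; rewrite normrX lerXn2r ?nnegrE// ?h// (le_trans _ (h x xT)).
Qed.

Lemma L2_integrable f : L2_01 f -> integrable01 f.
Proof.
move=> hf; have h1 : L2_01 (fun=> 1 : R).
  by apply: (@L2_bounded _ 1) => // x _; rewrite normr1.
have := integrable01_L2M hf h1.
by under eq_fun do rewrite mulr1.
Qed.

Lemma L2D f g : L2_01 f -> L2_01 g -> L2_01 (fun x => f x + g x).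
Proof.
move=> hf hg; split; first exact: measurable_funD hf.1 hg.1.
have h : integrable01 (fun x => f x ^+ 2 + (2 * (f x * g x) + g x ^+ 2)).
  apply: integrable01D; first exact: hf.2.
  apply: integrable01D; last exact: hg.2.
  exact/integrable01Z/integrable01_L2M.
by apply: eq_integrable h => // x _ /=; congr (_%:E); ring.
Qed.

Lemma L2Z c f : L2_01 f -> L2_01 (fun x => c * f x).
Proof.
move=> [mf hf]; split; first exact: measurable_funM.
have h := @integrable01Z (c ^+ 2) _ hf.
by apply: eq_integrable h => // x _ /=; congr (_%:E); ring.
Qed.

Lemma L2B f g : L2_01 f -> L2_01 g -> L2_01 (fun x => f x - g x).
Proof.
move=> hf hg; have := L2D hf (L2Z (-1) hg).
by congr L2_01; apply/funext => x; rewrite mulN1r.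
Qed.

Lemma continuous_bounded f : continuous f ->
  exists C, forall x, T01 R x -> `|f x| <= C.
Proof.
move=> cf; have := @compact_bounded _ _ (f @` `[0, 1]).
have : compact (f @` `[0, 1]).
  apply: continuous_compact; last exact: segment_compact.
  by apply: continuous_subspaceT => x; apply: cf.
move=> h /(_ h)[M [_ hM]]; exists (M + 1) => x.
rewrite /T01 /= in_itv /= => /andP[x0 x1].
by apply: (hM (M + 1)); [rewrite ltrDl|exists x => //; rewrite /= in_itv /= x0 ltW].
Qed.

Lemma continuous_measurable01 f : continuous f -> measurable_fun (T01 R) f.
Proof. by move=> cf; apply: measurable_funTS; apply: continuous_measurable_fun. Qed.

Lemma continuous_L2 f : continuous f -> L2_01 f.
Proof.
move=> cf; have [C hC] := continuous_bounded cf.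
by apply: L2_bounded hC; apply: continuous_measurable01.
Qed.

Lemma eq_int01 f g : (forall x, T01 R x -> f x = g x) -> int01 f = int01 g.
Proof. by move=> h; apply: eq_Rintegral => x; rewrite inE => /h. Qed.

Lemma int01_sum (I : Type) (s : seq I) (F : I -> R -> R) :
  (forall i, integrable01 (F i)) ->
  int01 (fun x => \sum_(i <- s) F i x) = \sum_(i <- s) int01 (F i).
Proof.
move=> h; elim: s => [|i s IH].
  by rewrite big_nil -[RHS](int01_cst 0); apply: eq_int01 => x _; rewrite big_nil.
rewrite big_cons -IH -int01D//; last exact: integrable01_sum.
by apply: eq_int01 => x _; rewrite big_cons.
Qed.

Lemma int01_ge0 f : (forall x, T01 R x -> 0 <= f x) -> 0 <= int01 f.
Proof. by move=> h; rewrite /int01 /Rintegral fine_ge0// integral_ge0// => x /h; rewrite lee_fin. Qed.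

Lemma le_int01 f g : integrable01 f -> integrable01 g ->
  (forall x, T01 R x -> f x <= g x) -> int01 f <= int01 g.
Proof.
move=> hf hg h; rewrite -subr_ge0 -int01B//; apply: int01_ge0 => x /h.
by rewrite subr_ge0.
Qed.

End UnitInterval.
#[global] Hint Extern 0 (measurable (T01 _)) => (exact: measurable_T01) : core.
#[global] Hint Extern 0 (measurable (T01 _)) => (exact: measurable_T01R) : core.

Section Estimates.
Variable R : realType.
Implicit Types (f : R -> R) (x d a C : R).

(** Meant for [b3], which is differentiable at the integers although the [mod1] in its definition
    jumps there. *)
Lemma is_derive_quadratic f x a C :
  (forall d, `|d| <= 1 -> `|f (x + d) - f x - a * d| <= C * d ^+ 2) ->
  is_derive x 1 f a.
Proof.
move=> h.
have C0 : 0 <= C.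
  by have := h 1; rewrite normr1 expr1n !mulr1 => /(_ (lexx _)) hh; exact: le_trans (normr_ge0 _) hh.
suff : (fun d => d^-1 *: (f (d *: 1 + x) - f x)) @ 0^' --> a.
  by move=> l; apply: DeriveDef; [apply/cvg_ex; exists a | exact: cvg_lim].
apply/cvgrPdist_le => /= e e0; near=> d.
have d0 : d != 0 by near: d; exact: nbhs_dnbhs_neq.
have d1 : `|d| <= 1 by near: d; exact: dnbhs0_le.
have de : `|d| <= e / (C + 1).
  by near: d; apply: dnbhs0_le; rewrite divr_gt0// ltr_wpDl.
have := h d d1; rewrite [d *: 1]mulr1 [d + x]addrC => hd.
have -> : a - d^-1 *: (f (x + d) - f x) = - (d^-1 * (f (x + d) - f x - a * d)).
  by rewrite [_ *: _]/(d^-1 * _); rewrite mulrBr mulrCA mulVf// mulr1 opprB.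
rewrite normrN normrM normfV ler_pdivrMl ?normr_gt0// (le_trans hd)//.
rewrite -real_normK ?num_real// expr2 mulrCA ler_wpM2l//.
rewrite ler_pdivlMr in de; last by rewrite ltr_wpDl.
have := normr_ge0 d; nra.
Unshelve. all: by end_near. Qed.

Lemma continuous_linear_bound f C :
  (forall x d, `|d| <= 1 -> `|f (x + d) - f x| <= C * `|d|) -> continuous f.
Proof.
move=> h x.
have C0 : 0 <= C.
  by have := h 0 1; rewrite normr1 mulr1 => /(_ (lexx _)) hh; exact: le_trans (normr_ge0 _) hh.
apply/cvgrPdist_le => /= e e0; near=> y.
have d1 : `|x - y| <= 1 by near: y; exact: cvgr_dist_le.
have de : `|x - y| <= e / (C + 1).
  by near: y; apply: cvgr_dist_le => //; rewrite divr_gt0// ltr_wpDl.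
have hh : `|f x - f y| <= C * `|x - y|.
  have := h x (y - x); rewrite [x + _]addrC subrK -opprB normrN => /(_ d1).
  by rewrite distrC.
apply: le_trans hh _.
rewrite ler_pdivlMr in de; last by rewrite ltr_wpDl.
have := normr_ge0 (x - y); nra.
Unshelve. all: by end_near. Qed.

End Estimates.

(** * Periodized Bernoulli polynomials and their smoothing *)

Section Bernoulli.
Variable R : realType.
Implicit Types t d delta : R.

(** The derivative of [b3] is [3 b2], and that of [b2] is [2 b1] in the weak sense. Of the three
    only [b3] is a test function: [b2] has corners and [b1] jumps at the integers. *)
Definition b1 t : R := mod1 t - 2^-1.
Definition b2 t : R := mod1 t ^+ 2 - mod1 t + 6^-1.
Definition b3 t : R := mod1 t ^+ 3 - 3 / 2 * mod1 t ^+ 2 + mod1 t / 2.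

Lemma mod1_shift t d : `|d| <= 1 ->
  [\/ mod1 (t + d) = mod1 t + d,
      mod1 (t + d) = mod1 t + d - 1 /\ 1 <= mod1 t + d |
      mod1 (t + d) = mod1 t + d + 1 /\ mod1 t + d < 0].
Proof.
rewrite ler_norml => /andP[d1 d2]; have /andP[t0 t1] := mod1_itv t.
have [h|h] := ltP (mod1 t + d) 0.
  constructor 3; split=> //; rewrite -mod1D.
  by apply: (@mod1_unique _ _ _ 1) => //; lra.
have [h1|h1] := ltP (mod1 t + d) 1.
  by constructor 1; rewrite -mod1D mod1_small// h.
constructor 2; split=> //; rewrite -mod1D.
by apply: (@mod1_unique _ _ _ (-1)) => //; lra.
Qed.

Lemma mod1_period t : mod1 (t + 1) = mod1 t.
Proof.
by rewrite -mod1D; apply: (@mod1_unique _ _ _ (-1)); [exact: mod1_itv|rewrite /= addrK].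
Qed.

Lemma b2_shift t d : `|d| <= 1 -> `|b2 (t + d) - b2 t| <= 2 * `|d|.
Proof.
move=> hd; have hs := mod1_shift t hd; have /andP[t0 t1] := mod1_itv t.
have := mod1_itv (t + d); rewrite /b2.
have [d0|d0] := leP 0 d.
  rewrite (ger0_norm d0); rewrite (ger0_norm d0) in hd.
  case: hs => [-> h|[-> h1] h|[-> h1] h].
  - rewrite ler_norml; apply/andP; split; nra.
  - rewrite ler_norml; apply/andP; split; nra.
  - lra.
have nd := ltW d0.
rewrite (ler0_norm nd); rewrite (ler0_norm nd) in hd.
case: hs => [-> h|[-> h1] h|[-> h1] h].
- rewrite ler_norml; apply/andP; split; nra.
- lra.
- rewrite ler_norml; apply/andP; split; nra.
Qed.

(** With [m = mod1 t], the Taylor remainder is [(3 m - 3/2 + d) d^2], at most [3 d^2]. Crossing an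
    integer adds three times the square of the overshoot, again at most [3 d^2]. *)
Lemma b3_shift t d : `|d| <= 1 -> `|b3 (t + d) - b3 t - 3 * b2 t * d| <= 6 * d ^+ 2.
Proof.
move=> hd; have /andP[t0 t1] := mod1_itv t.
have := mod1_itv (t + d); rewrite /b3 /b2.
have hd' := hd; move: hd'; rewrite ler_norml => /andP[d1 d2].
have sq : 0 <= d ^+ 2 by exact: sqr_ge0.
set m := mod1 t in t0 t1 *.
have e : (m + d) ^+ 3 - 3 / 2 * (m + d) ^+ 2 + (m + d) / 2
    - (m ^+ 3 - 3 / 2 * m ^+ 2 + m / 2) - 3 * (m ^+ 2 - m + 6^-1) * d
  = (3 * m - 3 / 2 + d) * d ^+ 2 by field.
have b : `|(3 * m - 3 / 2 + d) * d ^+ 2| <= 3 * d ^+ 2.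
  rewrite normrM [`|d ^+ 2|]ger0_norm// ler_wpM2r// ler_norml; lra.
case: (@mod1_shift t d) => // [-> h|[-> h1] h|[-> h1] h]; rewrite -/m in h *.
- by rewrite e (le_trans b)// ler_wpM2r// ler_nat.
- have -> : (m + d - 1) ^+ 3 - 3 / 2 * (m + d - 1) ^+ 2 + (m + d - 1) / 2
    - (m ^+ 3 - 3 / 2 * m ^+ 2 + m / 2) - 3 * (m ^+ 2 - m + 6^-1) * d
    = (3 * m - 3 / 2 + d) * d ^+ 2 - 3 * (m + d - 1) ^+ 2 by field.
  move: b; rewrite !ler_norml => /andP[b1 b2].
  have h2 : 0 <= (m + d - 1) ^+ 2 by exact: sqr_ge0.
  have h3 : (m + d - 1) ^+ 2 <= d ^+ 2.
    by rewrite -/m in h1; rewrite lerXn2r ?nnegrE; lra.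
  apply/andP; split; lra.
- have -> : (m + d + 1) ^+ 3 - 3 / 2 * (m + d + 1) ^+ 2 + (m + d + 1) / 2
    - (m ^+ 3 - 3 / 2 * m ^+ 2 + m / 2) - 3 * (m ^+ 2 - m + 6^-1) * d
    = (3 * m - 3 / 2 + d) * d ^+ 2 + 3 * (m + d) ^+ 2 by field.
  move: b; rewrite !ler_norml => /andP[b1 b2].
  have h2 : 0 <= (m + d) ^+ 2 by exact: sqr_ge0.
  have h3 : (m + d) ^+ 2 <= d ^+ 2.
    by rewrite -/m in h1; rewrite -[leLHS]sqrrN -[leRHS]sqrrN lerXn2r ?nnegrE; lra.
  apply/andP; split; lra.
Qed.

Lemma continuous_b2 : continuous b2.
Proof. by apply: (@continuous_linear_bound _ _ 2) => x d; apply: b2_shift. Qed.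

Lemma is_derive_b3 t c : is_derive t 1 (fun x => b3 (x + c)) (3 * b2 (t + c)).
Proof.
apply: (@is_derive_quadratic _ _ _ _ 6) => d hd.
rewrite [t + d + c]addrAC; exact: b3_shift.
Qed.

(* [wave delta] and [1 - tent delta] are the second differences, divided by
   delta^2, of b3 / 6 and b2 / 2: the first is a continuously differentiable
   approximation of b1, the second its derivative, and [tent delta] is the
   periodized hat function of mass one. *)
Definition tent delta t : R :=
  1 - (b2 (t + delta) - 2 * b2 t + b2 (t - delta)) / (2 * delta ^+ 2).

Definition wave delta t : R :=
  (b3 (t + delta) - 2 * b3 t + b3 (t - delta)) / (6 * delta ^+ 2).

Lemma tentE delta t : 0 < delta < 2^-1 ->
  delta ^+ 2 * tent delta t = if mod1 t < delta then delta - mod1 t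
    else if 1 - delta <= mod1 t then mod1 t + delta - 1 else 0.
Proof.
move=> /andP[d0 d1]; have /andP[t0 t1] := mod1_itv t.
have nd : `|delta| <= 1 by rewrite gtr0_norm//; lra.
have nd' : `|- delta| <= 1 by rewrite normrN.
have dn : delta != 0 by rewrite gt_eqF.
have := mod1_itv (t + delta); have := mod1_itv (t - delta); rewrite /tent /b2.
case: (mod1_shift t nd) => [->|[-> h1]|[-> h1]];
  case: (mod1_shift t nd') => [->|[-> h2]|[-> h2]] h3 h4;
  case: ifPn => h5; try (case: ifPn => h6); try (exfalso; lra); try (by field).
Qed.

Lemma waveE delta t : 0 < delta < 2^-1 ->
  2 * delta ^+ 2 * (wave delta t - b1 t) = if mod1 t < delta then (delta - mod1 t) ^+ 2
    else if 1 - delta <= mod1 t then - (mod1 t + delta - 1) ^+ 2 else 0.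
Proof.
move=> /andP[d0 d1]; have /andP[t0 t1] := mod1_itv t.
have nd : `|delta| <= 1 by rewrite gtr0_norm//; lra.
have nd' : `|- delta| <= 1 by rewrite normrN.
have dn : delta != 0 by rewrite gt_eqF.
have := mod1_itv (t + delta); have := mod1_itv (t - delta); rewrite /wave /b3 /b1.
case: (mod1_shift t nd) => [->|[-> h1]|[-> h1]];
  case: (mod1_shift t nd') => [->|[-> h2]|[-> h2]] h3 h4;
  case: ifPn => h5; try (case: ifPn => h6); try (exfalso; lra); try (by field).
Qed.

End Bernoulli.

Section TestFunctions.
Variable R : realType.
Implicit Types (u g phi f : R -> R) (y delta : R).

Lemma test_functionI f f' : periodic1 f -> (forall x : R, is_derive x 1 f (f' x)) ->
  continuous f' -> test_function f /\ derive1 f = f'.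
Proof.
move=> pf df cf; have e : derive1 f = f'.
  by apply/funext => x; rewrite derive1E; apply: derive_val.
by split=> //; split=> //; rewrite e.
Qed.

Lemma test_function_continuous phi : test_function phi -> continuous phi.
Proof.
by case=> _ d _ x; apply: differentiable_continuous; apply/derivable1_diffP.
Qed.

Lemma int01_derive1 phi : test_function phi -> int01 (derive1 phi) = 0.
Proof.
move=> tp; have cphi := test_function_continuous tp; have [pp dp cp] := tp.
have h : (\int[lebesgue_measure]_(x in `[0%R, 1%R]) (derive1 phi x)%:E = (phi 1)%:E - (phi 0)%:E :> \bar R)%E.
  apply: (@continuous_FTC2 R (derive1 phi) phi 0 1 ltr01) => [||//].
    by apply: continuous_subspaceT => x; apply: cp.
  by split=> //; [apply: cvg_at_right_filter|apply: cvg_at_left_filter]; apply: cphi.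
rewrite /int01 Rintegral_itv_bndo_bndc; last first.
  exact/L2_integrable/continuous_L2.
have := pp 0; rewrite add0r => e.
by rewrite /Rintegral h e subee.
Qed.

Lemma test_function_cst c : test_function (fun=> c : R) /\ derive1 (fun=> c : R) = fun=> 0.
Proof.
by apply: test_functionI => [//|x]; exact: cvg_cst.
Qed.

Lemma test_functionM phi psi : test_function phi -> test_function psi ->
  test_function (fun x => phi x * psi x) /\
  derive1 (fun x => phi x * psi x) = (fun x => phi x * derive1 psi x + psi x * derive1 phi x).
Proof.
move=> tp tq; have cp := test_function_continuous tp; have cq := test_function_continuous tq.
have [pp dp cdp] := tp; have [pq dq cdq] := tq.
apply: test_functionI.
- by move=> x; rewrite pp pq.
- move=> x; have hp : is_derive x 1 phi (derive1 phi x).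
    by rewrite derive1E; apply/derivableP/dp.
  have hq : is_derive x 1 psi (derive1 psi x).
    by rewrite derive1E; apply/derivableP/dq.
  exact: is_deriveM.
- by move=> x; apply: cvgD; apply: cvgM; [exact: cp|exact: cdq|exact: cq|exact: cdp].
Qed.

Lemma b3_period (t : R) : b3 (t + 1) = b3 t.
Proof. by rewrite /b3 mod1_period. Qed.

Lemma b3_test y : test_function (fun x => b3 (x - y)) /\
  derive1 (fun x => b3 (x - y)) = (fun x => 3 * b2 (x - y)).
Proof.
apply: test_functionI => [x|x|x].
- by rewrite [x + 1 - y]addrAC b3_period.
- exact: is_derive_b3.
- apply: cvgM; first exact: cvg_cst.
  apply: (@continuous_comp _ _ _ (fun x => x - y)); last exact: continuous_b2.
  by apply: cvgB; [exact: cvg_id|exact: cvg_cst].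
Qed.

Lemma continuous_b2B y : continuous (fun x : R => b2 (x - y)).
Proof.
move=> x; apply: (@continuous_comp _ _ _ (fun x => x - y)); last exact: continuous_b2.
by apply: cvgB; [exact: cvg_id|exact: cvg_cst].
Qed.

Lemma int01_b2 y : int01 (fun x => b2 (x - y)) = 0.
Proof.
have [tb eb] := b3_test y; have := int01_derive1 tb.
rewrite eb int01Z; last exact/L2_integrable/continuous_L2/continuous_b2B.
by move/eqP; rewrite mulf_eq0 pnatr_eq0 => /eqP.
Qed.

Lemma wave_test delta y : 0 < delta -> test_function (fun x => wave delta (x - y)) /\
  derive1 (fun x => wave delta (x - y)) = (fun x => 1 - tent delta (x - y)).
Proof.
move=> d0; apply: test_functionI => [x|x|x].
- rewrite /wave [x + 1 - y]addrAC b3_period.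
  by rewrite [_ + 1 + delta]addrAC [_ + 1 - delta]addrAC !b3_period.
- rewrite /tent.
  have -> : 1 - (1 - (b2 (x - y + delta) - 2 * b2 (x - y) + b2 (x - y - delta)) / (2 * delta ^+ 2))
    = (6 * delta ^+ 2)^-1 * (3 * b2 (x + (delta - y)) - 2 * (3 * b2 (x - y)) + 3 * b2 (x + (- y - delta))).
    have -> : x + (delta - y) = x - y + delta by ring.
    have -> : x + (- y - delta) = x - y - delta by ring.
    by field; rewrite gt_eqF.
  have -> : (fun x => wave delta (x - y)) = (6 * delta ^+ 2)^-1 *:
     ((fun x => b3 (x + (delta - y))) - 2 *: (fun x => b3 (x - y)) + (fun x => b3 (x + (- y - delta)))).
    apply/funext => z; rewrite /wave.
    have -> : z - y + delta = z + (delta - y) by ring.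
    have -> : z - y - delta = z + (- y - delta) by ring.
    by rewrite mulrC.
  have h1 := is_derive_b3 x (delta - y); have h2 := is_derive_b3 x (- y).
  have h3 := is_derive_b3 x (- y - delta).
  apply: is_deriveZ; apply: is_deriveD; apply: is_deriveB; apply: is_deriveZ.
- have cs c : continuous (fun x : R => b2 (x - y + c)).
    by under eq_fun do rewrite -addrA -[- y + c]opprK; exact: continuous_b2B.
  rewrite /tent; apply: cvgB; first exact: cvg_cst.
  apply: cvgB; first exact: cvg_cst.
  apply: cvgM; last exact: cvg_cst.
  apply: cvgD; last exact: cs.
  apply: cvgB; first exact: cs.
  by apply: cvgM; [exact: cvg_cst|exact: continuous_b2B].
Qed.

Lemma tent_ge0 delta t : 0 < delta < 2^-1 -> 0 <= tent delta (t : R).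
Proof.
move=> hd; have /andP[d0 _] := hd; rewrite -(@pmulr_rge0 _ (delta ^+ 2)) ?exprn_gt0//.
by rewrite tentE//; case: ifPn => [|_]; [lra|case: ifPn => //; lra].
Qed.

(** The right side has integral [delta] over a period, so this is convergence of [wave] to [b1] in
    L2, with a pointwise majorant. *)
Lemma wave_b1_sq delta t : 0 < delta < 2^-1 ->
  (wave delta t - b1 t) ^+ 2 <= delta * tent delta (t : R).
Proof.
move=> hd; have /andP[d0 _] := hd; have /andP[t0 t1] := mod1_itv t.
have p4 : 0 < 4 * delta ^+ 4 by rewrite mulr_gt0// exprn_gt0.
rewrite -(ler_pM2l p4).
have -> : 4 * delta ^+ 4 * (wave delta t - b1 t) ^+ 2 = (2 * delta ^+ 2 * (wave delta t - b1 t)) ^+ 2 by ring.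
have -> : 4 * delta ^+ 4 * (delta * tent delta t) = 4 * delta ^+ 3 * (delta ^+ 2 * tent delta t) by ring.
have key s : 0 <= s <= delta -> (s ^+ 2) ^+ 2 <= 4 * delta ^+ 3 * s.
  move=> /andP[s0 sd]; have -> : (s ^+ 2) ^+ 2 = s ^+ 3 * s by ring.
  rewrite ler_wpM2r//.
  have : s ^+ 3 <= delta ^+ 3 by rewrite lerXn2r ?nnegrE// ltW.
  have := exprn_gt0 3 d0; lra.
rewrite tentE// waveE//; case: ifPn => h1; first by apply: key; lra.
case: ifPn => h2; last by rewrite expr0n mulr0.
by rewrite sqrrN; apply: key; lra.
Qed.

Lemma tent_near delta t : 0 < delta < 2^-1 -> tent delta (t : R) != 0 ->
  exists k : int, `|t + k%:~R| < delta.
Proof.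
move=> hd ht; have /andP[d0 _] := hd.
have : delta ^+ 2 * tent delta t != 0 by rewrite mulf_neq0// expf_neq0// gt_eqF.
have [k ek] := mod1_eq t; have /andP[t0 t1] := mod1_itv t.
rewrite tentE//; case: ifPn => h1; first by exists k; rewrite -ek ger0_norm.
case: ifPn => h2 h3; last by rewrite eqxx in h3.
exists (k - 1); rewrite rmorphB addrA -ek ler0_norm; last lra.
suff : mod1 t != 1 - delta by rewrite neq_lt; lra.
by apply: contraNneq h3 => ->; apply/eqP; ring.
Qed.

Lemma measurable_b1 y : measurable_fun (T01 R) (fun x => b1 (x - y)).
Proof.
apply: measurable_funB; last exact: measurable_cst.
apply: measurable_funB; first by apply: measurable_funB; [exact: measurable_id|exact: measurable_cst].
apply: nondecreasing_measurable => // s t st.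
by rewrite ler_int le_floor// lerB.
Qed.

Lemma L2_b1 y : L2_01 (fun x : R => b1 (x - y)).
Proof.
apply: (@L2_bounded _ _ 1); first exact: measurable_b1.
by move=> x _; rewrite /b1 ler_norml; have := mod1_itv (x - y); lra.
Qed.

End TestFunctions.

(** * Point values recovered from weak derivatives *)

Section Reproducing.
Variable R : realType.
Implicit Types (u g phi f : R -> R) (y delta : R).

Lemma periodic1_int f (k : int) x : periodic1 f -> f (x + k%:~R) = f x.
Proof.
move=> pf; have pn (n : nat) z : f (z + n%:R) = f z.
  elim: n z => [|n IH] z; first by rewrite addr0.
  by rewrite -natr1 addrA pf IH.
case: k => n; first exact: pn.
by rewrite NegzE rmorphN /= -(pn n.+1) subrK.
Qed.

Lemma continuous_wave delta y : 0 < delta -> continuous (fun x : R => wave delta (x - y)).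
Proof. by move=> d0; apply: test_function_continuous; exact: (wave_test y d0).1. Qed.

Lemma continuous_tent delta y : 0 < delta -> continuous (fun x : R => tent delta (x - y)).
Proof.
move=> d0; have [[_ _ c] e] := wave_test y d0; rewrite e in c.
have -> : (fun x : R => tent delta (x - y)) = (fun x => 1 - (1 - tent delta (x - y))).
  by apply/funext => x; rewrite subKr.
by move=> x; apply: cvgB; [exact: cvg_cst|exact: c].
Qed.

Lemma continuous_integrable01 f : continuous f -> integrable01 f.
Proof. by move=> /continuous_L2/L2_integrable. Qed.

Lemma int01_tent delta y : 0 < delta -> int01 (fun x => tent delta (x - y)) = 1.
Proof.
move=> d0; have [t e] := wave_test y d0; have := int01_derive1 t.
rewrite e int01B ?int01_cst; last 2 first.
- by apply: continuous_integrable01 => x; exact: cvg_cst.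
- exact/continuous_integrable01/continuous_tent.
by move/eqP; rewrite subr_eq0 => /eqP.
Qed.

Lemma tent_average u y (e : R) : periodic1 u -> continuous u -> 0 < e ->
  exists2 d0 : R, 0 < d0 < 2^-1 & forall delta, 0 < delta <= d0 ->
    `|int01 (fun x => u x * tent delta (x - y)) - u y| <= e.
Proof.
move=> pu cu e0.
have [r r0 hr] : exists2 r : R, 0 < r & forall z, `|y - z| < r -> `|u y - u z| <= e.
  have /cvgrPdist_le/(_ _ e0)/nbhs_ballP[r /= r0 hr] := cu y.
  by exists r => // z yz; apply: hr; rewrite -ball_normE.
exists (Num.min (r / 2) 4^-1) => [|delta /andP[d0 dr]].
  by rewrite lt_min divr_gt0//= gt_min; apply/andP; split; [|apply/orP; right]; lra.
have {dr} [dr d4] : delta <= r / 2 /\ delta <= 4^-1 by move: dr; rewrite le_min => /andP.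
have hd : 0 < delta < 2^-1 by lra.
have ct := @continuous_tent delta y d0.
have cut : continuous (fun x => u x * tent delta (x - y)).
  by move=> x; apply: cvgM; [exact: cu|exact: ct].
have it c : int01 (fun x => c * tent delta (x - y)) = c.
  by rewrite int01Z ?int01_tent ?mulr1//; exact: continuous_integrable01.
have key x : `|u x - u y| * tent delta (x - y) <= e * tent delta (x - y).
  have [->|/(tent_near hd)[k hk]] := eqVneq (tent delta (x - y)) 0; first by rewrite !mulr0.
  apply: ler_wpM2r; first exact: tent_ge0.
  rewrite -(periodic1_int k x pu) distrC; apply: hr; rewrite distrC.
  by rewrite addrAC; apply: (lt_le_trans hk); lra.
have i1 c : integrable01 (fun x => c * tent delta (x - y)).
  by apply/integrable01Z/continuous_integrable01.
have t0 x := tent_ge0 (x - y) hd.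
have b x : - (`|u x - u y| * tent delta (x - y)) <= (u x - u y) * tent delta (x - y)
    <= `|u x - u y| * tent delta (x - y).
  by rewrite -ler_norml normrM (ger0_norm (t0 x)).
suff : u y - e <= int01 (fun x => u x * tent delta (x - y)) <= u y + e.
  by rewrite ler_norml; lra.
rewrite -(it (u y - e)) -(it (u y + e)).
by apply/andP; split; apply: le_int01 => //; try exact: continuous_integrable01;
  move=> x _; have := key x; have := b x; lra.
Qed.

(** A pointwise Young inequality stands in for Cauchy-Schwarz: the integrand is at most
    [eta g^2 + (delta / eta) tent], and [tent] has mass one. *)
Lemma wave_L2 delta eta g y : L2_01 g -> 0 < delta < 2^-1 -> 0 < eta ->
  `|int01 (fun x => g x * wave delta (x - y)) - int01 (fun x => g x * b1 (x - y))|
  <= eta * int01 (fun x => g x ^+ 2) + delta / eta.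
Proof.
move=> hg hd e0; have /andP[d0 _] := hd.
have lw : L2_01 (fun x => wave delta (x - y)) by exact/continuous_L2/continuous_wave.
have iw := integrable01_L2M hg lw; have ib := integrable01_L2M hg (L2_b1 y).
have ig : integrable01 (fun x => g x ^+ 2) by exact: hg.2.
have it : integrable01 (fun x => tent delta (x - y)).
  exact/continuous_integrable01/continuous_tent.
rewrite -int01B//.
have key x : `|g x * wave delta (x - y) - g x * b1 (x - y)| <=
    eta * g x ^+ 2 + delta / eta * tent delta (x - y).
  have h1 := wave_b1_sq (x - y) hd.
  set a := g x; set b := wave _ _ - b1 _ in h1 *; set t := tent _ _ in h1 *.
  rewrite -mulrBr -/b.
  have h2 : eta * (eta * a ^+ 2 + delta / eta * t) = (eta * a) ^+ 2 + delta * t.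
    by field; rewrite gt_eqF.
  rewrite -(ler_pM2l e0) h2 -[eta in leLHS](gtr0_norm e0) -normrM mulrA.
  have [h3 h4] := (sqr_ge0 (eta * a - b), sqr_ge0 (eta * a + b)).
  have h5 := sqr_ge0 (eta * a); have h6 := sqr_ge0 b.
  by rewrite ler_norml; apply/andP; split; nra.
have ibd : integrable01 (fun x => eta * g x ^+ 2 + delta / eta * tent delta (x - y)).
  by apply: integrable01D; apply: integrable01Z.
have eb : int01 (fun x => eta * g x ^+ 2 + delta / eta * tent delta (x - y)) =
   eta * int01 (fun x => g x ^+ 2) + delta / eta.
  by rewrite int01D ?int01Z ?int01_tent ?mulr1//; apply: integrable01Z.
have iwb : integrable01 (fun x => g x * wave delta (x - y) - g x * b1 (x - y)).
  exact: integrable01B.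
rewrite -eb ler_norml; apply/andP; split; last first.
  by apply: le_int01 => // x _; have := key x; rewrite ler_norml => /andP[].
rewrite lerNl -mulN1r -int01Z//; apply: le_int01 => //; first exact: integrable01Z.
by move=> x _; rewrite mulN1r lerNl; have := key x; rewrite ler_norml => /andP[].
Qed.

(** Formally, [b1] has derivative 1 minus the point masses at the integers, and one integrates by
    parts. The proof tests the weak derivative with [wave], whose derivative is [1 - tent], and lets
    [delta] tend to 0. *)
Lemma weak_derivative_b1 u g y : periodic1 u -> continuous u -> is_weak_derivative u g ->
  int01 (fun x => g x * b1 (x - y)) = u y - int01 u.
Proof.
move=> pu cu [hg hw]; apply/eqP; rewrite -subr_eq0 -normr_le0; apply/ler_addgt0Pr => e e0.
rewrite add0r; set M := int01 (fun x => g x ^+ 2).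
have M0 : 0 <= M by apply: int01_ge0 => x _; apply: sqr_ge0.
have e2 : 0 < e / 2 by rewrite divr_gt0.
have [d0 /andP[d00 d01] hd0] := tent_average y pu cu e2.
(* Error budget: [e / 2] for averaging with [tent], [e / 4] for the term with [eta], and [e / 4] for
   [delta / eta]. *)
pose eta := e / (4 * (M + 1)).
have M1 : 0 < 4 * (M + 1) by lra.
have eta0 : 0 < eta by rewrite divr_gt0.
have etaM : eta * M <= e / 4.
  have -> : e / 4 = eta * (M + 1) by rewrite /eta; field; lra.
  by rewrite ler_wpM2l// ?ltW//; lra.
pose delta := Num.min d0 (eta * (e / 4)).
have dgt : 0 < delta by rewrite lt_min d00 /= mulr_gt0// divr_gt0.
have dd0 : delta <= d0 by rewrite ge_min lexx.
have hd : 0 < delta < 2^-1 by rewrite dgt (le_lt_trans dd0).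
have de : delta / eta <= e / 4.
  by rewrite ler_pdivrMr// mulrC ge_min lexx orbT.
have h1 := wave_L2 y hg hd eta0; rewrite -/M in h1.
have h2 := hd0 delta; rewrite dgt dd0 in h2; have {}h2 := h2 isT.
have [tw ew] := wave_test y dgt.
have h3 := hw _ tw; rewrite ew in h3.
have e3 : int01 (fun x => u x * (1 - tent delta (x - y))) =
    int01 u - int01 (fun x => u x * tent delta (x - y)).
  rewrite -int01B; [|exact: continuous_integrable01|].
    by apply: eq_int01 => x _; rewrite mulrBr mulr1.
  by apply: integrable01_L2M; apply: continuous_L2 => //; exact: continuous_tent.
rewrite e3 /= in h3.
have h4 := le_trans h1 (lerD etaM de).
move: h3 h4 h2; clear; set A := int01 _; set B := int01 (fun x => u x * _).
set C := int01 (fun x => g x * wave _ _); set D := int01 (fun x => g x * b1 _).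
rewrite !ler_norml; lra.
Qed.

End Reproducing.

Section Kernel.
Variable R : realType.
Implicit Types (u g phi f : R -> R) (y delta : R).

(** Within [delta] before an integer the difference quotient smears the jump of [b1], with an error
    of order one; [2 delta tent] dominates it and has integral only [2 delta]. *)
Lemma b2_forward delta t : 0 < delta < 2^-1 ->
  `|(b2 (t + delta) - b2 t) / delta - 2 * b1 t| <= delta + 2 * delta * tent delta (t : R).
Proof.
move=> hd; have /andP[d0 d1] := hd; have /andP[t0 t1] := mod1_itv t.
have nd : `|delta| <= 1 by rewrite gtr0_norm//; lra.
have dn : delta != 0 by rewrite gt_eqF.
have h0 : 0 <= 2 * delta * tent delta t by rewrite mulr_ge0 ?tent_ge0// mulr_ge0// ltW.
rewrite /b2 /b1; case: (mod1_shift t nd) => [->|[-> h1]|[-> h1]]; last by lra.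
  have -> : ((mod1 t + delta) ^+ 2 - (mod1 t + delta) + 6^-1 - (mod1 t ^+ 2 - mod1 t + 6^-1)) / delta -
    2 * (mod1 t - 2^-1) = delta by field.
  by rewrite gtr0_norm// lerDl.
have e : 2 * delta * tent delta t = 2 * (mod1 t + delta - 1) / delta.
  have -> : 2 * delta * tent delta t = 2 * (delta ^+ 2 * tent delta t) / delta by field.
  by rewrite tentE//; case: ifPn => h2; [exfalso; lra|case: ifPn => h3 //; exfalso; lra].
have -> : ((mod1 t + delta - 1) ^+ 2 - (mod1 t + delta - 1) + 6^-1 - (mod1 t ^+ 2 - mod1 t + 6^-1)) / delta -
    2 * (mod1 t - 2^-1) = delta - 2 * (mod1 t + delta - 1) / delta by field.
by rewrite -e ler_norml; lra.
Qed.

(** The scaled forward difference [psi] of [b3] is a test function within [2 delta] of [b2], and its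
    derivative is close to [2 b1]. Since the derivative of [psi phi] integrates to 0, the identity
    holds up to [5 C delta]. *)
Lemma weak_derivative_b2 y phi : test_function phi ->
  int01 (fun x => b2 (x - y) * derive1 phi x) = - 2 * int01 (fun x => b1 (x - y) * phi x).
Proof.
move=> tp; have cp := test_function_continuous tp; have [_ _ cdp] := tp.
have [C1 hC1] := continuous_bounded cp; have [C2 hC2] := continuous_bounded cdp.
pose C := `|C1| + `|C2| + 1.
have C0 : 0 < C by rewrite /C ltr_wpDl// addr_ge0.
have hp x : T01 R x -> `|phi x| <= C.
  move=> /hC1 h; have := ler_norm C1; have := normr_ge0 C2; rewrite /C; lra.
have hdp x : T01 R x -> `|derive1 phi x| <= C.
  move=> /hC2 h; have := ler_norm C2; have := normr_ge0 C1; rewrite /C; lra.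
apply/eqP; rewrite -subr_eq0 -normr_le0; apply/ler_addgt0Pr => e e0; rewrite add0r.
pose delta := Num.min 4^-1 (e / (5 * C)).
have C5 : 0 < 5 * C by rewrite mulr_gt0.
have d0 : 0 < delta by rewrite lt_min invr_gt0 ltr0n /= divr_gt0.
have d4 : delta <= 4^-1 by rewrite ge_min lexx.
have hd : 0 < delta < 2^-1 by rewrite d0; lra.
have dC : delta * (5 * C) <= e by rewrite -ler_pdivlMr// ge_min lexx orbT.
have nd : `|delta| <= 1 by rewrite gtr0_norm//; lra.
pose psi x := (3 * delta)^-1 * (b3 (x - y + delta) - b3 (x - y)).
have [tpsi epsi] : test_function psi /\
    derive1 psi = (fun x => (b2 (x - y + delta) - b2 (x - y)) / delta).
  apply: test_functionI => [x|x|x].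
  - by rewrite /psi [x + 1 - y]addrAC [_ + 1 + _]addrAC !b3_period.
  - have -> : (b2 (x - y + delta) - b2 (x - y)) / delta =
      (3 * delta)^-1 * (3 * b2 (x + (delta - y)) - 3 * b2 (x - y)).
      have -> : x + (delta - y) = x - y + delta by ring.
      by field; rewrite gt_eqF.
    have -> : psi = (3 * delta)^-1 *: ((fun x => b3 (x + (delta - y))) - (fun x => b3 (x - y))).
      apply/funext => z; rewrite /psi.
      by have -> : z - y + delta = z + (delta - y) by ring.
    have h1 := is_derive_b3 x (delta - y); have h2 := is_derive_b3 x (- y).
    by apply: is_deriveZ; apply: is_deriveB.
  - have cs c : continuous (fun x : R => b2 (x - y + c)).
      by under eq_fun do rewrite -addrA -[- y + c]opprK; exact: continuous_b2B.
    apply: cvgM; last exact: cvg_cst.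
    by apply: cvgB; [exact: cs|exact: continuous_b2B].
have [tM eM] := test_functionM tpsi tp.
have := int01_derive1 tM; rewrite eM => h0.
have cpsi := test_function_continuous tpsi; have [_ _ cdpsi] := tpsi.
have lphi := continuous_L2 cp; have ldphi := continuous_L2 cdp.
have lpsi := continuous_L2 cpsi; have ldpsi := continuous_L2 cdpsi.
have lb2 : L2_01 (fun x => b2 (x - y)) by exact/continuous_L2/continuous_b2B.
have lb1 := L2_b1 y.
have i1 := integrable01_L2M lpsi ldphi; have i2 := integrable01_L2M lphi ldpsi.
have i3 := integrable01_L2M lb2 ldphi; have i4 := integrable01_L2M lb1 lphi.
have it : integrable01 (fun x => tent delta (x - y)).
  exact/continuous_integrable01/continuous_tent.
have ic c : integrable01 (fun=> c : R) by apply: continuous_integrable01 => x; exact: cvg_cst.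
have eq1 : int01 (fun x => b2 (x - y) * derive1 phi x) - - 2 * int01 (fun x => b1 (x - y) * phi x)
  = int01 (fun x => b2 (x - y) * derive1 phi x + 2 * (b1 (x - y) * phi x)
      - (psi x * derive1 phi x + phi x * derive1 psi x)).
  rewrite int01B ?int01D ?int01Z//.
  - by move: h0; rewrite int01D// => ->; ring.
  - exact: integrable01Z.
  - by apply: integrable01D => //; apply: integrable01Z.
  - exact: integrable01D.
have ibig : integrable01 (fun x => b2 (x - y) * derive1 phi x + 2 * (b1 (x - y) * phi x)
      - (psi x * derive1 phi x + phi x * derive1 psi x)).
  by apply: integrable01B; apply: integrable01D => //; apply: integrable01Z.
have key x : T01 R x -> `|b2 (x - y) * derive1 phi x + 2 * (b1 (x - y) * phi x)
      - (psi x * derive1 phi x + phi x * derive1 psi x)|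
    <= 3 * delta * C + 2 * delta * C * tent delta (x - y).
  move=> xT; have -> : b2 (x - y) * derive1 phi x + 2 * (b1 (x - y) * phi x)
      - (psi x * derive1 phi x + phi x * derive1 psi x) =
      - ((psi x - b2 (x - y)) * derive1 phi x + (derive1 psi x - 2 * b1 (x - y)) * phi x) by ring.
  rewrite normrN (le_trans (ler_normD _ _))// !normrM.
  have h1 : `|psi x - b2 (x - y)| <= 2 * delta.
    have d3 : 0 < 3 * delta by rewrite mulr_gt0.
    rewrite -(ler_pM2l d3) -{1}(gtr0_norm d3) -normrM.
    have -> : 3 * delta * (psi x - b2 (x - y)) =
        b3 (x - y + delta) - b3 (x - y) - 3 * b2 (x - y) * delta.
      by rewrite /psi; field; rewrite gt_eqF.
    by apply: (le_trans (b3_shift _ nd)); rewrite le_eqVlt; apply/orP; left; apply/eqP; ring.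
  have h2 : `|derive1 psi x - 2 * b1 (x - y)| <= delta + 2 * delta * tent delta (x - y).
    by rewrite epsi; apply: b2_forward.
  have h3 := ler_pM (normr_ge0 _) (normr_ge0 _) h1 (hdp x xT).
  have h4 := ler_pM (normr_ge0 _) (normr_ge0 _) h2 (hp x xT).
  apply: (le_trans (lerD h3 h4)); rewrite le_eqVlt; apply/orP; left; apply/eqP; ring.
have ibd : integrable01 (fun x => 3 * delta * C + 2 * delta * C * tent delta (x - y)).
  by apply: integrable01D => //; apply: integrable01Z.
have ebd : int01 (fun x => 3 * delta * C + 2 * delta * C * tent delta (x - y)) = delta * (5 * C).
  rewrite int01D ?int01Z ?int01_cst ?int01_tent//; last exact: integrable01Z.
  by ring.
rewrite eq1 (le_trans _ dC)// -ebd ler_norml; apply/andP; split; last first.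
  by apply: le_int01 => // x /key; rewrite ler_norml => /andP[].
rewrite lerNl -mulN1r -int01Z//; apply: le_int01 => //; first exact: integrable01Z.
by move=> x /key; rewrite mulN1r lerNl ler_norml => /andP[].
Qed.

Definition kernel gamma y x : R := 1 + gamma / 2 * b2 (x - y).

Lemma continuous_kernel gamma y : continuous (kernel gamma y).
Proof.
move=> x; apply: cvgD; first exact: cvg_cst.
by apply: cvgM; [exact: cvg_cst|exact: continuous_b2B].
Qed.

Lemma int01_kernel gamma y : int01 (kernel gamma y) = 1.
Proof.
have i : integrable01 (fun x => b2 (x - y)).
  exact/continuous_integrable01/continuous_b2B.
have ic c : integrable01 (fun=> c : R) by apply: continuous_integrable01 => x; exact: cvg_cst.
by rewrite int01D ?int01_cst ?int01Z ?int01_b2 ?mulr0 ?addr0//; apply: integrable01Z.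
Qed.

Lemma kernel_weak_derivative c gamma y :
  is_weak_derivative (fun x => c * kernel gamma y x) (fun x => c * gamma * b1 (x - y)).
Proof.
split=> [|phi tp]; first exact/L2Z/L2_b1.
have [_ _ cdp] := tp; have cp := test_function_continuous tp.
have lb2 : L2_01 (fun x => b2 (x - y)) by exact/continuous_L2/continuous_b2B.
have i1 : integrable01 (fun x => b2 (x - y) * derive1 phi x).
  exact/integrable01_L2M/continuous_L2.
have i2 : integrable01 (fun x => b1 (x - y) * phi x).
  by apply: integrable01_L2M; [exact: L2_b1|exact: continuous_L2].
have i3 : integrable01 (derive1 phi) by exact: continuous_integrable01.
transitivity (int01 (fun x => c * derive1 phi x + c * gamma / 2 * (b2 (x - y) * derive1 phi x))).
  by apply: eq_int01 => x _; rewrite /kernel; ring.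
rewrite int01D ?int01Z//; try exact: integrable01Z.
rewrite int01_derive1// weak_derivative_b2//.
transitivity (- (c * gamma * int01 (fun x => b1 (x - y) * phi x))); first by field.
by rewrite -int01Z//; congr (- _); apply: eq_int01 => x _; ring.
Qed.

Lemma H1_kernel c gamma y : H1 (fun x => c * kernel gamma y x).
Proof.
split; last by eexists; apply: kernel_weak_derivative.
  by move=> x; rewrite /kernel /b2 [x + 1 - y]addrAC mod1_period.
by move=> x; apply: cvgM; [exact: cvg_cst|exact: continuous_kernel].
Qed.

Lemma cst_weak_derivative (c : R) : is_weak_derivative (fun=> c) (fun=> 0).
Proof.
split=> [|phi tp]; first by apply: continuous_L2 => x; exact: cvg_cst.
have [_ _ cdp] := tp.
rewrite int01Z ?int01_derive1//; last exact: continuous_integrable01.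
rewrite mulr0; transitivity (- (0 : R)); first by rewrite oppr0.
by congr (- _); rewrite -[LHS]int01_cst; apply: eq_int01 => x _; rewrite mul0r.
Qed.

Lemma H1_cst (c : R) : H1 (fun=> c).
Proof. by split=> //; [move=> x; exact: cvg_cst|eexists; exact: cst_weak_derivative]. Qed.

End Kernel.

(** * Weak derivatives are unique almost everywhere *)

Section Uniqueness.
Variable R : realType.
Implicit Types (u g phi f d : R -> R) (y : R).
Notation mu := (@lebesgue_measure R).

Lemma int01_weak0 d : is_weak_derivative (fun=> 0) d -> int01 d = 0.
Proof.
move=> [hd hw]; have [t e] := test_function_cst (1 : R).
have := hw _ t; rewrite e; rewrite (@eq_int01 _ _ (fun=> 0)) => [|x _]; last exact: mulr0.
rewrite int01_cst => /esym/eqP; rewrite oppr_eq0 => /eqP <-.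
by apply: eq_int01 => x _; rewrite mulr1.
Qed.

(** On the unit interval [b1 (x - y) - b1 x + y] is the indicator of [x < y], and [d] is orthogonal
    to each of the three terms. *)
Lemma int01_weak0_prefix d y : 0 <= y < 1 -> is_weak_derivative (fun=> 0) d ->
  int01 (fun x => if x < y then d x else 0) = 0.
Proof.
move=> hy hd; have [ld _] := hd.
have h z : int01 (fun x => d x * b1 (x - z)) = 0.
  rewrite (weak_derivative_b1 z _ _ hd) ?int01_cst ?subr0//.
  by move=> x; exact: cvg_cst.
have ib z := integrable01_L2M ld (L2_b1 z).
have id := L2_integrable ld.
transitivity (int01 (fun x => d x * b1 (x - y) - d x * b1 (x - 0) + y * d x)).
  apply: eq_int01 => x; rewrite /T01 /= in_itv /= => /andP[x0 x1].
  rewrite /b1 subr0 (mod1_small (x := x)) ?x0//.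
  have [xy|xy] := ltP x y.
    rewrite (@mod1_unique _ _ (x - y + 1) 1)//; last by lra.
    by rewrite /=; ring.
  by rewrite (@mod1_small _ (x - y)); [rewrite /=; ring|lra].
rewrite int01D ?int01B ?int01Z ?h ?int01_weak0 ?subr0 ?mulr0 ?addr0//.
  exact: integrable01B.
exact: integrable01Z.
Qed.

(** Extended by zero, [d] has a primitive that vanishes identically, and the derivative of the
    primitive equals [d] almost everywhere. *)
Lemma weak0_ae d : is_weak_derivative (fun=> 0) d ->
  {ae mu, forall x, T01 R x -> d x = 0}.
Proof.
move=> hd; have [ld _] := hd; have id := L2_integrable ld.
pose f := d \_ (T01 R).
have iF : mu.-integrable setT (EFin \o f).
  rewrite -restrict_EFin; have [h _] := @integrable_restrict _ _ _ mu _ (@measurable_T01 R) setT measurableT (EFin \o d).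
  by apply: h; rewrite setTI.
have iS (S : set (measurableTypeR R)) : measurable S -> mu.-integrable S (EFin \o f).
  by move=> mS; apply: integrableS iF.
have F0 y : (\int[mu]_(t in [set` `]-oo, y]]) f t)%R = 0.
  rewrite -Rintegral_itv_bndo_bndc; last by apply: iS; exact: measurable_itv.
  rewrite /f -Rintegral_mkcondr setIC Rintegral_mkcondr -/(int01 _).
  have [y0|y0] := ltP y 0.
    rewrite -[RHS]int01_cst; apply: eq_int01 => x; rewrite /T01 /= in_itv /= => /andP[x0 x1].
    rewrite patchE memNset//= in_itv /=; lra.
  have [y1|y1] := ltP y 1.
    rewrite -(@int01_weak0_prefix d y) ?y0//; apply: eq_int01 => x _.
    rewrite patchE; case: ifPn; rewrite ?(inE, notin_setE) /= in_itv /= => h.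
      by rewrite h.
    by move/negP/negbTE : h => ->.
  rewrite -(int01_weak0 hd); apply: eq_int01 => x; rewrite /T01 /= in_itv /= => /andP[x0 x1].
  by rewrite patchE mem_set//= in_itv /=; lra.
have iy y : mu.-integrable [set` `]-oo, y]] (EFin \o f).
  have my : measurable ([set` `]-oo, y]] : set (measurableTypeR R)) by exact: measurable_itv.
  exact: iS my.
have lf : locally_integrable [set: R] f by apply: integrable_locally.
have := FTC1Ny iy lf => /=.
apply: (@filterS _ _ (ae_filter_ringOfSetsType mu)) => x /= [_].
have -> : (fun x => \int[mu]_(t in [set` `]-oo, x]]) f t)%R = cst 0 by apply/funext.
rewrite derive1_cst => e xT.
by move: e => /= /esym; rewrite /f patchE mem_set.
Qed.

Lemma int01_weak0M d w : is_weak_derivative (fun=> 0) d -> L2_01 w ->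
  int01 (fun x => d x * w x) = 0.
Proof.
move=> hd lw; have [ld _] := hd; have := integrable01_L2M ld lw => i.
rewrite /int01 /Rintegral (@ae_eq_integral _ _ _ mu (T01 R) (cst 0%E))//.
- by rewrite integral0.
- exact: measurable_int i.
- have := weak0_ae hd; apply: (@filterS _ _ (ae_filter_ringOfSetsType mu)) => x h xT /=.
  by rewrite h// mul0r.
Qed.

Lemma is_weak_derivativeB u g1 g2 : is_weak_derivative u g1 -> is_weak_derivative u g2 ->
  is_weak_derivative (fun=> 0) (fun x => g1 x - g2 x).
Proof.
move=> [l1 h1] [l2 h2]; split=> [|phi tp]; first exact: L2B.
have lp := continuous_L2 (test_function_continuous tp).
rewrite (@eq_int01 _ _ (fun=> 0)) => [|x _]; last exact: mul0r.
rewrite int01_cst.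
transitivity (- (int01 (fun x => g1 x * phi x) - int01 (fun x => g2 x * phi x))).
  by have := h1 _ tp; rewrite h2// => /oppr_inj ->; rewrite subrr oppr0.
rewrite -int01B; [|exact: integrable01_L2M|exact: integrable01_L2M].
by congr (- _); apply: eq_int01 => x _; rewrite mulrBl.
Qed.

Lemma weak_derivativeP u : H1 u -> is_weak_derivative u (weak_derivative u).
Proof. by case=> _ _ [g hg]; rewrite /weak_derivative; apply: (@xgetPex _ _ [set g | is_weak_derivative u g]); exists g. Qed.

(** Replaces the chosen weak derivative of [v] by any explicit one. *)
Lemma H1_dotE gamma u v g : H1 u -> is_weak_derivative v g ->
  H1_dot gamma u v = int01 u * int01 v + gamma^-1 * int01 (fun x => weak_derivative u x * g x).
Proof.
move=> hu hg; rewrite /H1_dot; congr (_ + _ * _).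
have hv : is_weak_derivative v (weak_derivative v).
  by apply: (@xgetPex _ _ [set g | is_weak_derivative v g]); exists g.
have [lu _] := weak_derivativeP hu; have [lv _] := hv; have [lg _] := hg.
have := int01_weak0M (is_weak_derivativeB hv hg) lu.
have i1 := integrable01_L2M lu lv; have i2 := integrable01_L2M lu lg.
have -> : (fun x => (weak_derivative v x - g x) * weak_derivative u x) =
  (fun x => weak_derivative u x * weak_derivative v x - weak_derivative u x * g x).
  by apply/funext => x; ring.
by rewrite int01B// => /eqP; rewrite subr_eq0 => /eqP.
Qed.

Lemma H1_dot_kernel c gamma u y : gamma != 0 -> H1 u ->
  H1_dot gamma u (fun x => c * kernel gamma y x) = c * u y.
Proof.
move=> g0 hu; have [pu cu _] := hu.
rewrite (H1_dotE _ hu (kernel_weak_derivative c gamma y)).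
have hw := weak_derivativeP hu; have [lw _] := hw.
rewrite int01Z ?int01_kernel; last exact/continuous_integrable01/continuous_kernel.
transitivity (int01 u * (c * 1) + gamma^-1 * (c * gamma * int01 (fun x => weak_derivative u x * b1 (x - y)))).
  rewrite -int01Z; last exact: integrable01_L2M (L2_b1 y).
  by congr (_ + _ * _); apply: eq_int01 => x _; ring.
by rewrite (weak_derivative_b1 y pu cu hw); field.
Qed.

Lemma H1_dot_cst gamma u c : H1 u -> H1_dot gamma u (fun=> c) = c * int01 u.
Proof.
move=> hu; rewrite (H1_dotE _ hu (cst_weak_derivative c)) int01_cst.
have -> : int01 (fun x => weak_derivative u x * 0) = 0.
  by rewrite -[RHS]int01_cst; apply: eq_int01 => x _; exact: mulr0.
by rewrite mulr0 addr0 mulrC.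
Qed.

End Uniqueness.

(** * Tensor products and the worst case error *)

(* Keeps unification from unfolding the choice of a weak derivative. *)
#[local] Opaque weak_derivative.

(** * Cauchy-Schwarz for finite tensors *)

Section TensorAlgebra.
Variables (R : realType) (gamma : R).
Hypothesis gamma_gt0 : 0 < gamma.
Implicit Types (s t : tensor R) (f u v : R -> R).

Lemma H1_dotC u v : H1_dot gamma u v = H1_dot gamma v u.
Proof.
have e : int01 (fun x => weak_derivative u x * weak_derivative v x) =
    int01 (fun x => weak_derivative v x * weak_derivative u x).
  by apply: eq_int01 => x _; exact: mulrC.
exact: (congr2 (fun a b => a + gamma^-1 * b) (mulrC _ _) e).
Qed.

Lemma tensor_dotC s t : tensor_dot gamma s t = tensor_dot gamma t s.
Proof.
rewrite /tensor_dot exchange_big /=; apply: eq_bigr => q _; apply: eq_bigr => p _.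
by rewrite (H1_dotC p.1) (H1_dotC p.2).
Qed.

Lemma tensor_dot_cat s t1 t2 :
  tensor_dot gamma s (t1 ++ t2) = tensor_dot gamma s t1 + tensor_dot gamma s t2.
Proof. by rewrite /tensor_dot -big_split /=; apply: eq_bigr => p _; rewrite big_cat. Qed.

Section Gram.
Variable I : finType.
Implicit Types (c : I -> R) (U V : I -> R -> R).

Lemma int01_sqr_sum c U : (forall i, L2_01 (U i)) ->
  \sum_i \sum_j c i * c j * int01 (fun x => U i x * U j x)
  = int01 (fun x => (\sum_i c i * U i x) ^+ 2).
Proof.
move=> hU; have i1 i j := integrable01_L2M (hU i) (hU j).
transitivity (int01 (fun x => \sum_i \sum_j c i * c j * (U i x * U j x))); last first.
  apply: eq_int01 => x _; rewrite expr2 mulr_suml; apply: eq_bigr => i _.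
  by rewrite mulr_sumr; apply: eq_bigr => j _; rewrite mulrACA.
rewrite int01_sum => [|i].
  apply: eq_bigr => i _; rewrite int01_sum => [|j]; last exact: integrable01Z.
  by apply: eq_bigr => j _; rewrite int01Z.
by apply: integrable01_sum => j; apply: integrable01Z.
Qed.

Lemma H1_gram_ge0 c U : (forall i, H1 (U i)) ->
  0 <= \sum_i \sum_j c i * c j * H1_dot gamma (U i) (U j).
Proof.
move=> hU.
have -> : \sum_i \sum_j c i * c j * H1_dot gamma (U i) (U j) =
  (\sum_i c i * int01 (U i)) ^+ 2 + gamma^-1 *
   \sum_i \sum_j c i * c j * int01 (fun x => weak_derivative (U i) x * weak_derivative (U j) x).
  rewrite expr2 mulr_suml mulr_sumr -big_split /=; apply: eq_bigr => i _.
  rewrite !mulr_sumr -big_split /=; apply: eq_bigr => j _.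
  by rewrite /H1_dot; ring.
rewrite int01_sqr_sum; last by move=> i; have [] := weak_derivativeP (hU i).
apply: addr_ge0; first exact: sqr_ge0.
apply: mulr_ge0; first by rewrite invr_ge0 ltW.
by apply: int01_ge0 => x _; apply: sqr_ge0.
Qed.

(* Schur product theorem for the two Gram matrices, the second one being the
   superposition of the rank one matrices [int01 (V i) * int01 (V j)] and
   [weak_derivative (V i) x * weak_derivative (V j) x]. *)
Lemma tensor_gram_ge0 c U V : (forall i, H1 (U i)) -> (forall i, H1 (V i)) ->
  0 <= \sum_i \sum_j c i * c j * (H1_dot gamma (U i) (U j) * H1_dot gamma (V i) (V j)).
Proof.
move=> hU hV; pose A i j := H1_dot gamma (U i) (U j).
pose w i := weak_derivative (V i).
have lw i : L2_01 (w i) by have [] := weak_derivativeP (hV i).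
have i1 i j := integrable01_L2M (lw i) (lw j).
have -> : \sum_i \sum_j c i * c j * (A i j * H1_dot gamma (V i) (V j)) =
  \sum_i \sum_j (c i * int01 (V i)) * (c j * int01 (V j)) * A i j
  + gamma^-1 * int01 (fun x => \sum_i \sum_j (c i * w i x) * (c j * w j x) * A i j).
  have -> : int01 (fun x => \sum_i \sum_j (c i * w i x) * (c j * w j x) * A i j) =
    \sum_i \sum_j (c i * c j * A i j) * int01 (fun x => w i x * w j x).
    transitivity (int01 (fun x => \sum_i \sum_j (c i * c j * A i j) * (w i x * w j x))).
      apply: eq_int01 => x _; apply: eq_bigr => i _; apply: eq_bigr => j _; ring.
    rewrite int01_sum => [|i].
      apply: eq_bigr => i _; rewrite int01_sum => [|j]; last exact: integrable01Z.
      by apply: eq_bigr => j _; rewrite int01Z.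
    by apply: integrable01_sum => j; apply: integrable01Z.
  rewrite mulr_sumr -big_split /=; apply: eq_bigr => i _.
  rewrite mulr_sumr -big_split /=; apply: eq_bigr => j _.
  by rewrite /H1_dot -/(w i) -/(w j); ring.
apply: addr_ge0; first exact: H1_gram_ge0.
apply: mulr_ge0; first by rewrite invr_ge0 ltW.
by apply: int01_ge0 => x _; apply: H1_gram_ge0.
Qed.

End Gram.

Lemma tensor_dotE s t (p0 := ((fun=> 0 : R), (fun=> 0 : R))) :
  tensor_dot gamma s t = \sum_(i < size s) \sum_(j < size t)
    H1_dot gamma (nth p0 s i).1 (nth p0 t j).1 * H1_dot gamma (nth p0 s i).2 (nth p0 t j).2.
Proof.
rewrite /tensor_dot (big_nth p0) big_mkord; apply: eq_bigr => i _.
by rewrite (big_nth p0) big_mkord.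
Qed.

(** This is the squared norm of [s + lambda t], obtained as a Gram form on the disjoint union of the
    two index sets with weights 1 and [lambda]. *)
Lemma tensor_dot_pencil s t lambda : tensor_H1 s -> tensor_H1 t ->
  0 <= tensor_dot gamma s s + 2 * lambda * tensor_dot gamma s t
       + lambda ^+ 2 * tensor_dot gamma t t.
Proof.
move=> hs ht; pose p0 : (R -> R) * (R -> R) := ((fun=> 0), (fun=> 0)).
pose F (i : 'I_(size s) + 'I_(size t)) :=
  match i with inl i => nth p0 s i | inr j => nth p0 t j end.
pose c (i : 'I_(size s) + 'I_(size t)) := if i is inl _ then 1 else lambda.
have hF i : H1 (F i).1 /\ H1 (F i).2.
  by case: i => i /=; [apply: hs|apply: ht]; rewrite mem_nth.
have := @tensor_gram_ge0 _ c (fun i => (F i).1) (fun i => (F i).2)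
  (fun i => (hF i).1) (fun i => (hF i).2).
rewrite big_sumType /=.
under eq_bigr => i _ do rewrite big_sumType /=.
under [X in _ + X]eq_bigr => i _ do rewrite big_sumType /=.
rewrite !big_split /= => h; apply: le_trans h _; rewrite le_eqVlt; apply/orP; left; apply/eqP.
have e1 : tensor_dot gamma s t + tensor_dot gamma t s = 2 * tensor_dot gamma s t.
  by rewrite (tensor_dotC t); ring.
transitivity (tensor_dot gamma s s + lambda * (tensor_dot gamma s t + tensor_dot gamma t s)
   + lambda ^+ 2 * tensor_dot gamma t t); last by rewrite e1; ring.
rewrite !tensor_dotE -/p0 mulrDr !mulr_sumr !addrA.
set H := H1_dot gamma; clearbody H.
congr (_ + _ + _ + _); apply: eq_bigr => i _; rewrite ?mulr_sumr; apply: eq_bigr => j _; ring.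
Qed.

Lemma tensor_dot_ge0 s : tensor_H1 s -> 0 <= tensor_dot gamma s s.
Proof.
by move=> hs; have := tensor_dot_pencil 0 hs hs; rewrite mulr0 !mul0r !addr0 expr0n mul0r addr0.
Qed.

Lemma tensor_dot_CS s t : tensor_H1 s -> tensor_H1 t ->
  `|tensor_dot gamma s t| <= tensor_norm gamma s * tensor_norm gamma t.
Proof.
move=> hs ht; have := @tensor_dot_pencil s t ^~ hs ^~ ht.
rewrite /tensor_norm -sqrtrM ?tensor_dot_ge0// -sqrtr_sqr => h; apply: ler_wsqrtr; move: h.
have := tensor_dot_ge0 hs; have := tensor_dot_ge0 ht.
set a := tensor_dot gamma s s; set b := tensor_dot gamma s t; set d := tensor_dot gamma t t.
move=> d0 a0 h; have [dz|dn] := eqVneq d 0.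
  have [->|bn] := eqVneq b 0; first by rewrite expr0n mulr_ge0.
  (* If [t] has norm zero, the pencil is affine in [lambda]; this value of [lambda] would make it
     equal to -1. *)
  have := h (- (a + 1) / (2 * b)); rewrite dz mulr0 addr0.
  have -> : 2 * (- (a + 1) / (2 * b)) * b = - (a + 1) by field.
  lra.
have dp : 0 < d by rewrite lt_def dn.
have := h (- b / d).
have -> : a + 2 * (- b / d) * b + (- b / d) ^+ 2 * d = a - b ^+ 2 / d by field.
by rewrite subr_ge0 ler_pdivrMr.
Qed.

End TensorAlgebra.

(** * The representer of the integration error *)

Section Representer.
Variables (R : realType) (gamma : R).
Hypothesis gamma_gt0 : 0 < gamma.
Variables (N : nat) (P : 'I_N -> R * R).
Hypothesis N_gt0 : (0 < N)%N.
Implicit Types (s t : tensor R) (c : R).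

(** [c] times the Riesz representer of integral minus quadrature: the constant 1 represents the
    integral and the product kernels represent the point values. The scalars are absorbed into first
    factors because tensors are bare lists. *)
Definition representer c : tensor R :=
  ((fun=> c), (fun=> 1)) ::
  [seq ((fun x => - (c / N%:R) * kernel gamma (P i).1 x),
        (fun x => 1 * kernel gamma (P i).2 x)) | i <- enum 'I_N].

Definition defect s : R :=
  \sum_(p <- s) (int01 p.1 * int01 p.2 - N%:R^-1 * \sum_(i < N) p.1 (P i).1 * p.2 (P i).2).

Definition squared_wce : R :=
  (N%:R ^+ 2)^-1 *
    \sum_(i < N) \sum_(j < N) kernel gamma (P j).1 (P i).1 * kernel gamma (P j).2 (P i).2 - 1.

Lemma H1_representer c : tensor_H1 (representer c).
Proof.
move=> p; rewrite inE => /orP[/eqP ->|/mapP[i _ ->]] /=.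
  by split; apply: H1_cst.
by split; apply: H1_kernel.
Qed.

Lemma tensor_dot_representer s c : tensor_H1 s ->
  tensor_dot gamma s (representer c) = c * defect s.
Proof.
move=> hs; rewrite /tensor_dot /defect mulr_sumr; apply: eq_big_seq => p ps.
have [h1 h2] := hs p ps; have g0 : gamma != 0 by rewrite gt_eqF.
rewrite big_cons big_map big_enum /= !H1_dot_cst// mul1r mulrBr -mulrA; congr (_ + _).
rewrite mulrA -mulrN -sumrN mulr_sumr; apply: eq_bigr => i _.
by rewrite !H1_dot_kernel//; ring.
Qed.

Lemma defect_representer c : defect (representer c) = c * squared_wce.
Proof.
have nz : N%:R != 0 :> R by rewrite pnatr_eq0 -lt0n.
rewrite /defect big_cons big_map big_enum /= !int01_cst.
have -> : \sum_(i < N) c * 1 = N%:R * c.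
  by rewrite sumr_const card_ord mulr1 -[LHS]mulr_natl.
have ik y : integrable01 (kernel gamma y) by exact/continuous_integrable01/continuous_kernel.
have -> : c * 1 - N%:R^-1 * (N%:R * c) = 0 by field.
rewrite add0r.
transitivity (\sum_(i < N) (- (c / N%:R) + c / N%:R ^+ 2 *
    \sum_(j < N) kernel gamma (P i).1 (P j).1 * kernel gamma (P i).2 (P j).2)).
  apply: eq_bigr => i _; rewrite !int01Z// !int01_kernel; congr (_ + _); first by ring.
  rewrite -mulrN -sumrN !mulr_sumr; apply: eq_bigr => j _.
  by field.
rewrite big_split /= sumr_const card_ord -mulr_sumr -[_ *+ N]mulr_natl.
rewrite /squared_wce exchange_big /=; by field.
Qed.

Lemma tensor_dot_representer2 c :
  tensor_dot gamma (representer c) (representer c) = c ^+ 2 * squared_wce.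
Proof.
by rewrite tensor_dot_representer ?defect_representer ?mulrA//; exact: H1_representer.
Qed.

Lemma squared_wce_ge0 : 0 <= squared_wce.
Proof.
rewrite -[leRHS]mul1r -(expr1n _ 2) -tensor_dot_representer2.
exact/tensor_dot_ge0/H1_representer.
Qed.

Lemma representer_opp c :
  [seq ((fun x => - p.1 x), p.2) | p <- representer c] = representer (- c).
Proof.
rewrite /representer /= -map_comp; congr (_ :: _); apply: eq_map => i /=.
by congr (_, _); apply/funext => x; ring.
Qed.

(** The formal difference is a nonempty list, but its product with itself vanishes. This makes the
    constant sequence a Cauchy sequence. *)
Lemma tensor_norm_sub_representer c :
  tensor_norm gamma (tensor_sub (representer c) (representer c)) = 0.
Proof.
rewrite /tensor_norm; set t := tensor_sub _ _.
have tE : t = representer c ++ representer (- c) by rewrite /t /tensor_sub representer_opp.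
have ht : tensor_H1 t.
  move=> p; rewrite tE mem_cat => /orP[]; exact: H1_representer.
by rewrite {2}tE tensor_dot_cat !tensor_dot_representer// mulNr subrr sqrtr0.
Qed.

Lemma defect_bound s : tensor_H1 s ->
  `|defect s| <= tensor_norm gamma s * Num.sqrt squared_wce.
Proof.
move=> hs; have := tensor_dot_CS gamma_gt0 hs (@H1_representer 1).
by rewrite tensor_dot_representer// mul1r [X in _ * X]/tensor_norm tensor_dot_representer2 expr1n mul1r.
Qed.

End Representer.

Section PointEvaluation.
Variables (R : realType) (gamma : R).
Hypothesis gamma_gt0 : 0 < gamma.

(** Point evaluation is the inner product with the product kernel, whose norm [1 + gamma / 12] does
    not depend on the point. Bounded norms thus give a uniform bound, as dominated convergence
    requires. *)
Lemma tensor_fun_bound : exists2 C : R, 0 <= C &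
  forall s (x : R * R), tensor_H1 s -> `|tensor_fun s x| <= tensor_norm gamma s * C.
Proof.
pose t (x : R * R) : tensor R := [:: ((fun z => 1 * kernel gamma x.1 z), (fun z => 1 * kernel gamma x.2 z))].
have ht x : tensor_H1 (t x).
  by move=> p; rewrite inE => /eqP ->; split; apply: H1_kernel.
have g0 : gamma != 0 by rewrite gt_eqF.
have dt s x : tensor_H1 s -> tensor_dot gamma s (t x) = tensor_fun s x.
  move=> hs; apply: eq_big_seq => p /hs[h1 h2].
  by rewrite big_seq1 /= !H1_dot_kernel// !mul1r.
exists (1 + gamma / 12) => [|s x hs]; first by rewrite addr_ge0// divr_ge0// ltW.
rewrite -dt// (le_trans (tensor_dot_CS gamma_gt0 hs (ht x)))//.
rewrite ler_wpM2l ?sqrtr_ge0// /tensor_norm dt// /tensor_fun big_seq1 /=.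
have e y : 1 * kernel gamma y y = 1 + gamma / 12.
  by rewrite /kernel /b2 subrr mod1_small ?lexx ?ltr01//; field.
by rewrite !e -expr2 sqrtr_sqr ger0_norm// addr_ge0// divr_ge0// ltW.
Qed.

End PointEvaluation.

(** * Integrals of product functions over the square *)

Section ProductIntegral.
Variable R : realType.
Notation mu := (@lebesgue_measure R).
Notation mu2 := (mu \x mu)%E.
Notation TT := (T01 R `*` T01 R).
Notation RR := (measurableTypeR R * measurableTypeR R)%type.

Lemma measurable_TT : measurable (TT : set RR).
Proof. by apply: measurableX; exact: measurable_T01. Qed.

Lemma measure_TT : mu2 (TT : set RR) = 1%:E.
Proof.
rewrite product_measure1E; [|exact: measurable_T01|exact: measurable_T01].
by transitivity (1%:E * 1%:E : \bar R)%E; [congr (_ * _)%E; exact: measure_T01|rewrite mule1].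
Qed.

Definition integrableTT (f : R * R -> R) := mu2.-integrable TT (EFin \o f).

Lemma integrableTT_bounded (f : R * R -> R) C : measurable_fun (TT : set RR) f ->
  (forall x, TT x -> `|f x| <= C) -> integrableTT f.
Proof.
move=> mf hf; apply: measurable_bounded_integrable => //.
- exact: measurable_TT.
- exact: (eq_ind_r (fun z => z < +oo)%E (ltry 1) measure_TT).
exists C; split; first exact: num_real.
by move=> D CD x xT; apply: le_trans (hf x xT) (ltW CD).
Qed.

Lemma measurable_TT_mul (u v : R -> R) : continuous u -> continuous v ->
  measurable_fun (TT : set RR) (fun x : RR => u x.1 * v x.2).
Proof.
move=> cu cv; apply: measurable_funM.
  apply: measurable_funTS; apply: measurableT_comp; last exact: measurable_fst.
  exact: continuous_measurable_fun.
apply: measurable_funTS; apply: measurableT_comp; last exact: measurable_snd.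
exact: continuous_measurable_fun.
Qed.

Lemma integrableTT_mul (u v : R -> R) : continuous u -> continuous v ->
  integrableTT (fun x => u x.1 * v x.2).
Proof.
move=> cu cv; have [C1 hC1] := continuous_bounded cu; have [C2 hC2] := continuous_bounded cv.
apply: (@integrableTT_bounded _ (C1 * C2)); first exact: measurable_TT_mul.
by move=> x [x1 x2]; rewrite normrM ler_pM// ?hC1 ?hC2.
Qed.

Lemma int_torus2_mul (u v : R -> R) : continuous u -> continuous v ->
  int_torus2 (fun x => u x.1 * v x.2) = int01 u * int01 v.
Proof.
move=> cu cv; have i := integrableTT_mul cu cv.
have iu := continuous_integrable01 cu; have iv := continuous_integrable01 cv.
rewrite /int_torus2 /Rintegral integral_mkcond -integral12_prod_meas1; last first.
  have [h _] := @integrable_restrict _ _ _ mu2 _ measurable_TT setT measurableT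
    (EFin \o (fun x : RR => u x.1 * v x.2)).
  by apply: h; rewrite setTI.
have finv : (\int[mu]_(y in T01 R) (v y)%:E)%E = (int01 v)%:E.
  by rewrite /int01 /Rintegral fineK//; apply: integrable_fin_num.
transitivity (fine (\int[mu]_(x in T01 R) (u x * int01 v)%:E)%E); last first.
  rewrite -/(Rintegral mu (T01 R) (fun x => u x * int01 v)) mulrC -int01Z//.
  by apply: eq_int01 => x _; rewrite mulrC.
congr fine; rewrite [RHS]integral_mkcond; apply: eq_integral => x _.
rewrite /fubini_F [RHS]patchE; case: ifPn => hx; last first.
  rewrite integral0_eq// => y _; rewrite patchE memNset// => -[hx' _].
  by move/negP: hx; apply; rewrite inE.
rewrite EFinM -finv -(integralZl (@measurable_T01 R) iv).
rewrite [RHS]integral_mkcond; apply: eq_integral => y _.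
rewrite !patchE -EFinM; congr (if _ then _ else _).
by apply/idP/idP => [/set_mem[_ ?]|/set_mem ?]; apply/mem_set => //; split=> //; exact/set_mem.
Qed.

End ProductIntegral.

Section WorstCaseError.
Variable R : realType.
Implicit Types (s t : tensor R).
Notation mu := (@lebesgue_measure R).
Notation mu2 := (mu \x mu)%E.
Notation TT := (T01 R `*` T01 R).
Notation RR := (measurableTypeR R * measurableTypeR R)%type.

Lemma measurable_tensor_fun s : tensor_H1 s ->
  measurable_fun (TT : set RR) (tensor_fun s).
Proof.
elim: s => [|p s IH] hs.
  have -> : tensor_fun [::] = (fun=> 0 : R) by apply/funext => x; rewrite /tensor_fun big_nil.
  exact: measurable_cst.
have -> : tensor_fun (p :: s) = (fun x => p.1 x.1 * p.2 x.2 + tensor_fun s x).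
  by apply/funext => x; rewrite /tensor_fun big_cons.
have [[_ c1 _] [_ c2 _]] := hs p (mem_head _ _).
apply: measurable_funD; first exact: measurable_TT_mul.
by apply: IH => q qs; apply: hs; rewrite inE qs orbT.
Qed.

Lemma int_torus2_tensor s : tensor_H1 s ->
  integrableTT (tensor_fun s) /\
  int_torus2 (tensor_fun s) = \sum_(p <- s) int01 p.1 * int01 p.2.
Proof.
elim: s => [|p s IH] hs.
  have -> : tensor_fun [::] = (fun=> 0 : R) by apply/funext => x; rewrite /tensor_fun big_nil.
  split; first exact: integrable0.
  by rewrite big_nil /int_torus2 /Rintegral integral0.
have -> : tensor_fun (p :: s) = (fun x => p.1 x.1 * p.2 x.2 + tensor_fun s x).
  by apply/funext => x; rewrite /tensor_fun big_cons.
have [[_ c1 _] [_ c2 _]] := hs p (mem_head _ _).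
have [|js es] := IH; first by move=> q qs; apply: hs; rewrite inE qs orbT.
have ip := integrableTT_mul c1 c2.
split.
  rewrite /integrableTT.
  by apply: eq_integrable (integrableD (@measurable_TT R) ip js) => //; exact: measurable_TT.
rewrite big_cons -es -int_torus2_mul//.
exact: (RintegralD (@measurable_TT R) ip js).
Qed.

Lemma defectE N (P : 'I_N -> R * R) s : tensor_H1 s ->
  int_torus2 (tensor_fun s) - qmc P (tensor_fun s) = defect P s.
Proof.
move=> hs; rewrite (int_torus2_tensor hs).2 /defect big_split /= sumrN; congr (_ - _).
by rewrite /qmc /tensor_fun exchange_big /= mulr_sumr.
Qed.

Lemma int_torus2_cvg (f_ : nat -> R * R -> R) f C :
  (forall n, measurable_fun (TT : set RR) (f_ n)) ->
  (forall n x, `|f_ n x| <= C) -> (forall x, f_ n x @[n --> \oo] --> f x) ->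
  int_torus2 (f_ n) @[n --> \oo] --> int_torus2 f.
Proof.
move=> mf hC cf.
have mF : measurable_fun (TT : set RR) f.
  by apply: (measurable_fun_cvg mf) => x _; exact: cf.
have iC : integrableTT (fun=> C).
  by apply: (@integrableTT_bounded _ _ `|C|).
have [||||iF _ cI] := @dominated_convergence _ RR R mu2 TT (@measurable_TT R)
  (fun n => EFin \o f_ n) (EFin \o f) (EFin \o (fun=> C)) _ _ _ iC.
- by move=> n; apply/measurable_EFinP.
- exact/measurable_EFinP.
- by apply: aeW => x _; apply: cvg_EFin; [exact: nearW|exact: cf].
- by apply: aeW => x n _ /=; rewrite lee_fin.
rewrite /int_torus2 /Rintegral; apply: fine_cvg.
by rewrite fineK; [exact: cI|apply: integrable_fin_num => //; exact: measurable_TT].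
Qed.

(** For the upper bound, [defect_bound] passes to the pointwise limit of a Cauchy sequence of
    tensors. The lower bound is attained by the normalized representer. *)
Lemma wceE (gamma : R) N (P : 'I_N -> R * R) : 0 < gamma -> (0 < N)%N ->
  wce gamma P = (Num.sqrt (squared_wce gamma P))%:E.
Proof.
move=> g0 N0; set W := squared_wce gamma P; have W0 : 0 <= W by exact: squared_wce_ge0.
apply/eqP; rewrite eq_le; apply/andP; split.
  apply: ge_ereal_sup => _ [f [r [s [hs _ cf cr]] r1] <-]; rewrite lee_fin.
  have [C C0 hC] := tensor_fun_bound g0.
  have [M hM] : exists M, forall n, tensor_norm gamma (s n) <= M.
    have [M [_ hM]] := cvg_seq_bounded (cvgP _ cr); exists (M + 1) => n.
    by apply: le_trans (ler_norm _) (hM _ _ n I); rewrite ltrDl.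
  have cI : int_torus2 (tensor_fun (s n)) @[n --> \oo] --> int_torus2 f.
    apply: (@int_torus2_cvg _ _ (M * C)) => // n; first exact: measurable_tensor_fun.
    by move=> x; rewrite (le_trans (hC _ x (hs n)))// ler_wpM2r.
  have cq : qmc P (tensor_fun (s n)) @[n --> \oo] --> qmc P f.
    apply: cvgM; first exact: cvg_cst.
    by apply: cvg_big => [|i _]; [exact: add_continuous|exact: cf].
  have cd : `|int_torus2 (tensor_fun (s n)) - qmc P (tensor_fun (s n))| @[n --> \oo]
      --> `|int_torus2 f - qmc P f|.
    by apply: cvg_norm; apply: cvgB.
  apply: (@le_trans _ _ (r * Num.sqrt W)); last by rewrite ler_piMl// sqrtr_ge0.
  have cm : tensor_norm gamma (s n) * Num.sqrt W @[n --> \oo] --> r * Num.sqrt W.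
    by apply: cvgM cr _; exact: cvg_cst.
  apply: (ler_cvg_to cd cm).
  by apply: nearW => n /=; rewrite defectE//; exact: defect_bound.
(* If [W = 0], the inverse is 0 by convention and [t] represents the zero function, whose error is
   the required value 0. *)
apply: ereal_sup_ubound; pose c := (Num.sqrt W)^-1; pose t := representer gamma P c.
have ht : tensor_H1 t by exact: H1_representer.
have cW : c * Num.sqrt W = (Num.sqrt W != 0)%:R.
  by have [->|h] := eqVneq (Num.sqrt W) 0; [rewrite mulr0|rewrite mulVf].
exists (tensor_fun t); last first.
  have e : c * W = Num.sqrt W.
    rewrite -{1}(sqr_sqrtr W0) expr2 mulrA cW.
    by have [->|h] := eqVneq (Num.sqrt W) 0; rewrite ?mulr0 ?mul1r.
  by rewrite defectE// defect_representer// -/W e ger0_norm ?sqrtr_ge0.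
exists (tensor_norm gamma t).
  exists (fun=> t); split=> //.
  - move=> e e0; exists 0%N => m n _ _.
    by rewrite tensor_norm_sub_representer.
  - by move=> x; exact: cvg_cst.
  - exact: cvg_cst.
rewrite /tensor_norm tensor_dot_representer2// -/W -(sqr_sqrtr W0) -exprMn cW sqrtr_sqr.
by case: (_ != _); rewrite ?normr1 ?normr0 ?ler01.
Qed.

End WorstCaseError.

Local Close Scope classical_set_scope.

(** * Global minimizers *)

Section Lattices.
Variable R : realType.

Lemma lattice_in_torus2 N g : in_torus2 (lattice R N g).
Proof.
move=> i; have N0 : (0 < N)%N by case: i => ? /= ?; lia.
have frac a : (a < N)%N -> 0 <= (a%:R / N%:R : R) < 1.
  by move=> aN; rewrite divr_ge0 //= ltr_pdivrMr ?ltr0n// mul1r ltr_nat.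
by rewrite latticeE /= !frac// ltn_pmod.
Qed.

Lemma lattice_integration_lattice N g : (2 <= N)%N -> (1 <= g < N)%N -> coprime g N ->
  integration_lattice (lattice R N g).
Proof.
move=> N2 gN cg; right; split=> //; exists g; split=> //; first by lia.
exact: same_points_refl.
Qed.

(** Serves [N] = 3, 5, 8, 12, 13, where the inverse of the optimal generator is itself or its
    negative, so that interchanging the coordinates gives no further generator. *)
Lemma lattice_reflect_pair N g : (2 <= N)%N -> (0 < g < N)%N -> coprime g N -> forall h,
  h \in [:: g; N - g]%N ->
  [/\ torus_equivalent (lattice R N h) (lattice R N g),
      torus_equivalent (lattice R N g) (lattice R N h)
    & integration_lattice (lattice R N h)].
Proof.
move=> N2 /andP[g0 gN] cg h; rewrite !inE => /orP[]/eqP ->.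
  have r : torus_equivalent (lattice R N g) (lattice R N g).
    by exists id; [exact: TSid|exact: same_points_refl].
  by split=> //; apply: lattice_integration_lattice => //; rewrite g0.
split; [|exact/lattice_reflect/ltnW|].
  rewrite -{2}(subKn (ltnW gN)); apply: lattice_reflect; lia.
apply: lattice_integration_lattice => //; first by lia.
move: cg; rewrite /coprime -{1 3}(subnK (ltnW gN)) gcdnDr gcdnDl.
by rewrite gcdnC.
Qed.

(** Modulo 7 the inverse of 2 is 4, which differs from 2 and from -2. The class therefore has four
    generators, linked by the interchange of 2 with 4 and the reflections of 2 to 5 and of 3 to
    4. *)
Lemma lattice7_equivalent g : g \in [:: 2; 3; 4; 5]%N ->
  torus_equivalent (lattice R 7 g) (lattice R 7 2) /\
  torus_equivalent (lattice R 7 2) (lattice R 7 g).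
Proof.
have s24 : torus_equivalent (lattice R 7 2) (lattice R 7 4) by exact: lattice_swap.
have s42 : torus_equivalent (lattice R 7 4) (lattice R 7 2) by exact: lattice_swap.
have r34 : torus_equivalent (lattice R 7 3) (lattice R 7 4) by exact: (@lattice_reflect R 7 3).
have r43 : torus_equivalent (lattice R 7 4) (lattice R 7 3) by exact: (@lattice_reflect R 7 4).
rewrite !inE => /or4P[] /eqP ->; split=> //.
- by exists id; [exact: TSid|exact: same_points_refl].
- by exists id; [exact: TSid|exact: same_points_refl].
- exact: torus_equivalent_trans r34 s42.
- exact: torus_equivalent_trans s24 r43.
- exact: (@lattice_reflect R 7 5).
- exact: (@lattice_reflect R 7 2).
Qed.

End Lattices.

Section Minimizers.
Variables (R : realType) (gamma : R).
Hypotheses (gamma_gt0 : 0 < gamma) (gamma_le6 : gamma <= 6).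

Notation c0 := (1 - gamma / 24).
Notation c1 := (gamma / 8).

Lemma kernel_itv (x y : R) : 0 <= x < 1 -> 0 <= y < 1 ->
  kernel gamma y x = c0 + c1 * (2 * `|x - y| - 1) ^+ 2.
Proof.
move=> /andP[x0 x1] /andP[y0 y1]; rewrite /kernel /b2.
have [yx|xy] := leP y x.
  by rewrite ger0_norm ?subr_ge0// mod1_small; [field|lra].
rewrite ltr0_norm ?subr_lt0// (@mod1_unique _ _ (x - y + 1) 1)//; last by lra.
by field.
Qed.

Lemma squared_wceE N (P : 'I_N -> R * R) : in_torus2 P ->
  squared_wce gamma P = (N%:R ^+ 2)^-1 * energy c0 c1 P - 1.
Proof.
move=> hP; congr (_ * _ - 1); apply: eq_bigr => i _; apply: eq_bigr => j _.
have /andP[i1 i2] := hP i; have /andP[j1 j2] := hP j.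
by rewrite /pair_energy !kernel_itv.
Qed.

Lemma le_wce N (P Q : 'I_N -> R * R) : (0 < N)%N -> in_torus2 P -> in_torus2 Q ->
  (wce gamma P <= wce gamma Q)%E = (energy c0 c1 P <= energy c0 c1 Q).
Proof.
move=> N0 hP hQ; rewrite !wceE// lee_fin ler_sqrt ?squared_wce_ge0//.
rewrite !squared_wceE// lerD2r ler_pM2l// invr_gt0 exprn_gt0// ltr0n//.
Qed.

Theorem minimizers_are_lattices N gens C : (0 < N)%N ->
  check_optimal N gens C -> perm_eq (linear_perm N (head 1%N gens)) (iota 0 N) ->
  (forall g, g \in gens -> torus_equivalent (lattice R N g) (lattice R N (head 1%N gens)) /\
     torus_equivalent (lattice R N (head 1%N gens)) (lattice R N g)) ->
  (forall g, g \in gens -> integration_lattice (lattice R N g)) ->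
  (exists P : 'I_N -> R * R, global_minimizer gamma P) /\
  (forall P Q : 'I_N -> R * R,
     global_minimizer gamma P -> global_minimizer gamma Q ->
     torus_equivalent P Q) /\
  (forall P : 'I_N -> R * R, global_minimizer gamma P ->
     exists L : 'I_N -> R * R,
       integration_lattice L /\ torus_equivalent P L).
Proof.
move=> N0 hC hl heq hint.
have c1_gt0 : 0 < c1 by rewrite divr_gt0.
(* [gamma / 8 <= 1 - gamma / 24] is the same as [gamma <= 6]. *)
have c1_le : c1 <= c0.
  have h6 := gamma_le6; lra.
have opt (P : 'I_N -> R * R) := energy_optimal c1_gt0 c1_le N0 hC hl (P := P).
set L0 := lattice R N (head 1%N gens).
have hL0 : in_torus2 L0 by exact: lattice_in_torus2.
have shape P : global_minimizer gamma P -> exists g, [/\ g \in gens,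
    torus_equivalent P (lattice R N g) & torus_equivalent (lattice R N g) P].
  move=> [hP mP]; have [_] := opt _ hP; apply.
  by rewrite -le_wce//; exact: mP.
split; [|split] => [|P Q|P].
- by exists L0; split=> // Q hQ; rewrite le_wce//; have [] := opt _ hQ.
- move=> /shape[g [gg Pg _]] /shape[h [gh _ hQ]].
  apply: torus_equivalent_trans Pg (torus_equivalent_trans (heq g gg).1 _).
  exact: torus_equivalent_trans (heq h gh).2 hQ.
- by move=> /shape[g [gg Pg _]]; exists (lattice R N g); split=> //; exact: hint.
Qed.

End Minimizers.

Lemma check1 : check_optimal 1 [:: 1%N] None. Proof. by vm_compute. Qed.
Lemma check2 : check_optimal 2 [:: 1%N] None. Proof. by vm_compute. Qed.
Lemma check3 : check_optimal 3 [:: 1; 2]%N None. Proof. by vm_compute. Qed.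
Lemma check5 : check_optimal 5 [:: 2; 3]%N None. Proof. by vm_compute. Qed.
Lemma check7 : check_optimal 7 [:: 2; 3; 4; 5]%N None. Proof. by vm_compute. Qed.
Lemma check8 : check_optimal 8 [:: 3; 5]%N (Some cert8). Proof. by vm_compute. Qed.
Lemma check12 : check_optimal 12 [:: 5; 7]%N (Some cert12). Proof. by vm_compute. Qed.
Lemma check13 : check_optimal 13 [:: 5; 8]%N (Some cert13). Proof. by vm_compute. Qed.

Theorem mainTheorem2 (R : realType) (gamma : R) (N : nat)
    (hgamma : gamma = 1 \/ gamma = 6)
    (hN : N \in [:: 1; 2; 3; 5; 7; 8; 12; 13]%N) :
  (exists P : 'I_N -> R * R, global_minimizer gamma P) /\
  (forall P Q : 'I_N -> R * R,
     global_minimizer gamma P -> global_minimizer gamma Q ->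
     torus_equivalent P Q) /\
  (forall P : 'I_N -> R * R, global_minimizer gamma P ->
     exists L : 'I_N -> R * R,
       integration_lattice L /\ torus_equivalent P L).
Proof.
have [g0 g6] : 0 < gamma /\ gamma <= 6 by case: hgamma => ->; split; lra.
have pair M g C : check_optimal M [:: g; M - g]%N C -> (2 <= M)%N -> (0 < g < M)%N -> coprime g M ->
    perm_eq (linear_perm M g) (iota 0 M) -> _ := fun hC M2 gM cg hl =>
  minimizers_are_lattices g0 g6 (ltnW M2) hC hl
    (fun h gh => let: And3 a b _ := lattice_reflect_pair R M2 gM cg gh in conj a b)
    (fun h gh => let: And3 _ _ c := lattice_reflect_pair R M2 gM cg gh in c).
move: hN; rewrite !inE => /or4P[/eqP->|/eqP->|/eqP->|].
- apply: (minimizers_are_lattices g0 g6 _ check1) => // g; rewrite inE => /eqP ->.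
    by split; exists id; try exact: TSid; exact: same_points_refl.
  left; split=> // i; rewrite latticeE [i]ord1 /=.
  by rewrite mod0n mul0r.
- apply: (minimizers_are_lattices g0 g6 _ check2) => // g; rewrite inE => /eqP ->.
    by split; exists id; try exact: TSid; exact: same_points_refl.
  exact: lattice_integration_lattice.
- exact: (pair 3 1 None check3)%N.
move=> /or4P[/eqP->|/eqP->|/eqP->|/orP[]/eqP->].
- exact: (pair 5 2 None check5)%N.
- apply: (minimizers_are_lattices g0 g6 _ check7) => // g gg.
    exact: lattice7_equivalent.
  by move: gg; rewrite !inE => /or4P[] /eqP ->; exact: lattice_integration_lattice.
- exact: (pair 8 3 _ check8)%N.
- exact: (pair 12 5 _ check12)%N.
- exact: (pair 13 5 _ check13)%N.
Qed.
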